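(* Let $n,r,d$ be integers such that $n\ge 2$, $d\ge 1$ is odd, and $1\le r\le n-1$. For $a=0,1,\dots,\lfloor rd/2\rfloor$ write $\alpha=\lfloor a/(n-r)\rfloor$ and $s=a \bmod (n-r)$, and let $\mathbf K_a$ be the complete eigenstructure consisting of: $s$ left minimal indices equal to $\alpha+1$ and $n-r-s$ left minimal indices equal to $\alpha$; right minimal indices equal to the left minimal indices; and $rd-2a$ linear elementary divisors $(\lambda-\mu_1),\dots,(\lambda-\mu_{rd-2a})$ with arbitrary pairwise distinct $\mu_1,\dots,\mu_{rd-2a}\in\mathbb C$ (and no infinite elementary divisors). Let $K_a(\lambda)$ be an $n\times n$ complex symmetric matrix polynomial of degree exactly $d$ and rank exactly $r$ with complete eigenstructure $\mathbf K_a$. Then: (i) For every $n\times n$ complex symmetric matrix polynomial $M(\lambda)$ of grade $d$ and rank at most $r$, there is some $0\le a\le\lfloor rd/2\rfloor$ such that $\overline{\mathrm B^s}(K_a)\supseteq\overline{\mathrm B^s}(M)$. (ii) $\overline{\mathrm B^s}(K_a)\cap \mathrm B^s(K_{a'})=\emptyset$ whenever $a\ne a'$. (iii) The set of $n\times n$ complex symmetric matrix polynomials of grade $d$ with rank at most $r$ is a closed subset of $\mathrm{POL}^s_{d,n\times n}$ equal to $\bigcup_{0\le a\le\lfloor rd/2\rfloor}\overline{\mathrm B^s}(K_a)$.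
   Context: A matrix polynomial of grade $d$ is $P(\lambda)=\lambda^dA_d+\cdots+\lambda A_1+A_0$ with complex matrix coefficients, where $A_d$ may be zero (so the degree, i.e. the largest $i$ with $A_i\neq 0$, is at most $d$); it is symmetric if all $A_i^\top=A_i$. $\mathrm{POL}^s_{d,n\times n}$ is the space of $n\times n$ complex symmetric matrix polynomials of grade $d$, with distance $d(P,\widetilde P)=\big(\sum_{i=0}^d\|A_i-\widetilde A_i\|_F^2\big)^{1/2}$ (Frobenius norm). The rank of $P$ is its rank over the field $\mathbb C(\lambda)$. Finite eigenvalues and finite elementary divisors $(\lambda-\mu)^{\delta}$ are those obtained from the Smith form of $P$ (prime-power factors of the invariant polynomials). $P$, regarded with grade $d$, has $\infty$ as an eigenvalue if $0$ is an eigenvalue of $\operatorname{rev}P(\lambda):=\lambda^dP(1/\lambda)$, and the infinite elementary divisors of $P$ are the elementary divisors of $\operatorname{rev}P$ at $0$. The right (left) minimal indices of $P$ are the degrees of the vectors in a minimal basis (polynomial basis with minimal sum of degrees) of the right (left) null-space of $P$ over $\mathbb C(\lambda)$; for symmetric $P$ the left and right minimal indices coincide. The complete eigenstructure of $P$ is the collection of all its elementary divisors (finite and infinite) and its left and right minimal indices. The symmetric bundle $\mathrm B^s(P)\subset\mathrm{POL}^s_{d,n\times n}$ of $P\in\mathrm{POL}^s_{d,n\times n}$ is the set of symmetric matrix polynomials with the same size, grade and complete eigenstructure as $P$, except that the values of the distinct eigenvalues (which may include $\infty$) are unspecified as long as they remain distinct. $\overline{\mathrm B^s}(P)$ denotes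 the closure of $\mathrm B^s(P)$ in $\mathrm{POL}^s_{d,n\times n}$. For each $a=0,1,\dots,\lfloor rd/2\rfloor$ and each choice of distinct $\mu_i$ a polynomial $K_a$ as described exists, and $\mathrm B^s(K_a)$ does not depend on the choice. *)

(* Defs.v *)
From HB Require Import structures.
From mathcomp Require Import all_boot all_order all_algebra.
From mathcomp Require Import complex.
From mathcomp Require Import boolp classical_sets reals topology.

Set Implicit Arguments.
Unset Strict Implicit.
Unset Printing Implicit Defensive.

Import Order.TTheory GRing.Theory Num.Theory.
Import ComplexField.Normc.
Local Open Scope ring_scope.

(* POL^s_{d, n x n}: coefm P k is the coefficient A_k of lambda^k, for
   0 <= k <= d; the leading coefficient A_d may vanish. *)
Record sympol (R : realType) (d n : nat) := SymPol {
  coefm :> {ffun 'I_d.+1 -> 'M[R[i]]_n};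
  _ : [forall k, (coefm k)^T == coefm k]
}.

HB.instance Definition _ (R : realType) (d n : nat) :=
  [isSub for @coefm R d n].
HB.instance Definition _ (R : realType) (d n : nat) :=
  [Choice of sympol R d n by <:].

Definition sympol_dist (R : realType) (d n : nat) (P Q : sympol R d n) : R :=
  Num.sqrt (\sum_(k < d.+1) \sum_(i < n) \sum_(j < n)
              normc (P k i j - Q k i j) ^+ 2).

Section SympolMetric.
Variable R : realType.

Lemma cauchy_schwarz_sum (I : finType) (a b : I -> R) :
  (\sum_i a i * b i) ^+ 2 <= (\sum_i a i ^+ 2) * (\sum_i b i ^+ 2).
Proof.
have : 0 <= \sum_i \sum_j (a i * b j - a j * b i) ^+ 2.
  by apply: sumr_ge0 => i _; apply: sumr_ge0 => j _; exact: sqr_ge0.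
have -> : \sum_i \sum_j (a i * b j - a j * b i) ^+ 2 =
   ((\sum_i a i ^+ 2) * (\sum_i b i ^+ 2) - (\sum_i a i * b i) ^+ 2) *+ 2.
  transitivity (\sum_i \sum_j (a i ^+ 2 * b j ^+ 2 + b i ^+ 2 * a j ^+ 2
      - (a i * b i * (a j * b j)) *+ 2)).
    apply: eq_bigr => i _; apply: eq_bigr => j _.
    rewrite sqrrB !exprMn [b i ^+ 2 * _]mulrC addrAC; congr (_ - _ *+ 2).
    by rewrite -!mulrA; congr (_ * _); rewrite mulrCA [RHS]mulrCA [b j * _]mulrC.
  under eq_bigr do rewrite !big_split /= sumrN sumrMnl -!mulr_sumr.
  rewrite !big_split /= sumrN sumrMnl -!mulr_suml.
  by rewrite mulrnBl expr2 mulr2n [X in _ + X - _]mulrC.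
by rewrite pmulrn_lge0 // subr_ge0.
Qed.

Lemma minkowski_sum (I : finType) (a b c : I -> R) :
    (forall i, 0 <= c i <= a i + b i) ->
  Num.sqrt (\sum_i c i ^+ 2) <=
    Num.sqrt (\sum_i a i ^+ 2) + Num.sqrt (\sum_i b i ^+ 2).
Proof.
move=> cab; have sq0 (f : I -> R) : 0 <= \sum_i f i ^+ 2.
  by apply: sumr_ge0 => i _; exact: sqr_ge0.
rewrite -ler_sqr ?nnegrE ?addr_ge0 ?sqrtr_ge0 // sqrrD !sqr_sqrtr //.
apply: (@le_trans _ _ (\sum_i (a i + b i) ^+ 2)).
  apply: ler_sum => i _; have /andP[c0 cle] := cab i.
  by rewrite ler_sqr ?nnegrE // (le_trans c0).
under eq_bigr do rewrite sqrrD.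
rewrite !big_split /= -mulr2n lerD2r lerD2l lerMn2r /= -sqrtrM //.
apply: le_trans (ler_norm _) _.
by rewrite -sqrtr_sqr ler_wsqrtr // cauchy_schwarz_sum.
Qed.

Variables d n : nat.
Implicit Types P Q S : sympol R d n.

Lemma sympol_distE P Q : sympol_dist P Q =
  Num.sqrt (\sum_(u : 'I_d.+1 * ('I_n * 'I_n))
    normc (P u.1 u.2.1 u.2.2 - Q u.1 u.2.1 u.2.2) ^+ 2).
Proof.
rewrite /sympol_dist; congr Num.sqrt.
rewrite -(pair_bigA _ (fun k v => normc (P k v.1 v.2 - Q k v.1 v.2) ^+ 2)) /=.
apply: eq_bigr => k _.
by rewrite (pair_bigA _ (fun i j => normc (P k i j - Q k i j) ^+ 2)).
Qed.

Lemma sympol_distxx P : sympol_dist P P = 0.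
Proof.
rewrite sympol_distE big1 ?sqrtr0 // => u _.
by rewrite subrr normc0 expr0n.
Qed.

Lemma sympol_dist_positivity P Q : sympol_dist P Q = 0 -> P = Q.
Proof.
rewrite sympol_distE => /eqP; rewrite sqrtr_eq0 => le0.
apply: val_inj; apply/ffunP => k; apply/matrixP => i j.
have ge0 u : true -> 0 <= normc (P u.1 u.2.1 u.2.2 - Q u.1 u.2.1 u.2.2) ^+ 2.
  by move=> _; exact: sqr_ge0.
have /eqP s0 : \sum_(u : 'I_d.+1 * ('I_n * 'I_n))
    normc (P u.1 u.2.1 u.2.2 - Q u.1 u.2.1 u.2.2) ^+ 2 == 0.
  by rewrite eq_le le0 sumr_ge0.
have /eqP := psumr_eq0P ge0 s0 (i := (k, (i, j))) isT.
rewrite sqrf_eq0 => /eqP/eq0_normc/eqP.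
by rewrite subr_eq0 => /eqP.
Qed.

Lemma sympol_dist_sym P Q : sympol_dist P Q = sympol_dist Q P.
Proof.
rewrite !sympol_distE; congr Num.sqrt; apply: eq_bigr => u _.
by rewrite -normcN opprB.
Qed.

Lemma sympol_dist_triangle Q P S :
  sympol_dist P S <= sympol_dist P Q + sympol_dist Q S.
Proof.
rewrite !sympol_distE; apply: minkowski_sum => u; apply/andP; split.
  by case: (_ - _) => x y; exact: sqrtr_ge0.
by apply: le_trans (le_normcD _ _); rewrite subrKA.
Qed.

End SympolMetric.

HB.instance Definition _ (R : realType) (d n : nat) :=
  isMetric.Build R (sympol R d n) (@sympol_distxx R d n)
    (@sympol_dist_positivity R d n) (@sympol_dist_sym R d n)
    (@sympol_dist_triangle R d n).

Definition pmx (R : realType) (d n : nat) (P : sympol R d n)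
    : 'M[{poly R[i]}]_n :=
  \sum_(k < d.+1) 'X^k *: map_mx polyC (P k).

(* lambda^d P(1/lambda) *)
Definition revmx (R : realType) (d n : nat) (P : sympol R d n)
    : 'M[{poly R[i]}]_n :=
  \sum_(k < d.+1) 'X^(d - k) *: map_mx polyC (P k).

Definition fracmx (F : fieldType) (m n : nat) (A : 'M[{poly F}]_(m, n))
    : 'M[{fraction {poly F}}]_(m, n) :=
  map_mx (@tofrac {poly F}) A.

Definition pol_rank (R : realType) (d n : nat) (P : sympol R d n) : nat :=
  \rank (fracmx (pmx P)).

(* s lists the (monic, nonzero) invariant polynomials of A; the Smith form of A
   is diagonal with entries s followed by zeros. *)
Definition smith_form (F : fieldType) (n : nat) (A : 'M[{poly F}]_n)
    (s : seq {poly F}) : Prop :=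
  [/\ (size s <= n)%N, all (fun p => p \is monic) s,
      sorted (fun p q => p %| q) s
    & exists U V : 'M[{poly F}]_n, [/\ U \in unitmx, V \in unitmx
        & U *m A *m V = \matrix_(i, j) (s`_i *+ (i == j))]].

(* Exponents of the elementary divisors at mu, given invariant polynomials s. *)
Definition exponents (F : fieldType) (mu : F) (s : seq {poly F}) : seq nat :=
  [seq e <- [seq mup mu p | p <- s] | (0 < e)%N].

Definition row_degree (F : fieldType) (m n : nat) (B : 'M[{poly F}]_(m, n))
    (i : 'I_m) : nat :=
  (\max_(j < n) size (B i j)).-1.

(* The rows of B form a polynomial basis of the row space of V. *)
Definition poly_basis (F : fieldType) (n k : nat)
    (V : 'M[{fraction {poly F}}]_n) (B : 'M[{poly F}]_(k, n)) : bool :=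
  row_free (fracmx B) && (fracmx B == V)%MS.

Definition minimal_basis (F : fieldType) (n k : nat)
    (V : 'M[{fraction {poly F}}]_n) (B : 'M[{poly F}]_(k, n)) : Prop :=
  poly_basis V B /\
  forall B' : 'M[{poly F}]_(k, n), poly_basis V B' ->
    (\sum_(i < k) row_degree B i <= \sum_(i < k) row_degree B' i)%N.

Definition minimal_indices (F : fieldType) (n : nat)
    (V : 'M[{fraction {poly F}}]_n) (e : seq nat) : Prop :=
  exists (k : nat) (B : 'M[{poly F}]_(k, n)),
    minimal_basis V B /\ perm_eq e [seq row_degree B i | i <- enum 'I_k].

(* All three lists are multisets, i.e. only meaningful up to perm_eq.
   (Some mu, e) is the elementary divisor (lambda - mu)^e, and (None, e) an
   infinite elementary divisor of exponent e. *)
Record eigenstructure (F : Type) := Eigenstructure {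
  eldivs : seq (option F * nat);
  left_indices : seq nat;
  right_indices : seq nat
}.

(* The right null space {x | P x = 0} is represented by the row vectors x^T,
   i.e. by the left kernel of P^T. *)
Definition has_eigenstructure (R : realType) (d n : nat) (P : sympol R d n)
    (E : eigenstructure R[i]) : Prop :=
  [/\ exists2 s, smith_form (pmx P) s & forall mu : R[i],
        perm_eq [seq x.2 | x <- eldivs E & x.1 == Some mu] (exponents mu s),
      exists2 t, smith_form (revmx P) t &
        perm_eq [seq x.2 | x <- eldivs E & x.1 == None] (exponents 0 t),
      minimal_indices (kermx (fracmx (pmx P))) (left_indices E)
    & minimal_indices (kermx (fracmx (pmx P))^T) (right_indices E)].

(* E' is E up to renaming the distinct eigenvalues into distinct eigenvalues in
   C u {oo}; f may move finite eigenvalues to oo and conversely. *)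
Definition same_up_to_eigenvalues (F : eqType) (E E' : eigenstructure F)
    : Prop :=
  [/\ exists2 f : option F -> option F,
        {in [seq x.1 | x <- eldivs E] &, injective f} &
        perm_eq (eldivs E') [seq (f x.1, x.2) | x <- eldivs E],
      perm_eq (left_indices E') (left_indices E)
    & perm_eq (right_indices E') (right_indices E)].

Definition sym_bundle (R : realType) (d n : nat) (P : sympol R d n)
    : set (sympol R d n) :=
  [set Q | exists E E' : eigenstructure R[i],
    [/\ has_eigenstructure P E, has_eigenstructure Q E'
      & same_up_to_eigenvalues E E']]%classic.

Definition generic_eigenstructure (F : Type) (n r a : nat) (mus : seq F)
    : eigenstructure F :=
  let alpha := (a %/ (n - r))%N in
  let s := (a %% (n - r))%N in
  let idx := nseq s alpha.+1 ++ nseq (n - r - s) alpha in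
  Eigenstructure [seq (Some mu, 1%N) | mu <- mus] idx idx.

Definition is_generic (R : realType) (d n r a : nat) (K : sympol R d n)
    : Prop :=
  [/\ K ord_max != 0, pol_rank K = r
    & exists mus : seq R[i],
      [/\ uniq mus, size mus = (r * d - 2 * a)%N
        & has_eigenstructure K (generic_eigenstructure n r a mus)]].

(* Main.v *)
(* A symmetric Q of rank r and grade d factors as Q = V^T D V, where V has r rows
   of degrees eta_i and deg D_ij <= d - eta_i - eta_j, so that det D is a binary
   form of degree r d - 2 a with a = sum_i eta_i.  If det D has a double root at a
   point of the projective line, then the kernel of D there contains a vector u
   with u^T D u vanishing to order two; absorbing the corresponding linear factor
   into V raises a by one.  Hence, when a is maximal, det D is squarefree, and its
   roots are the points where the total multiplicity of the elementary divisors of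
   Q is odd: thus a only depends on the bundle of Q.  Fixing D and moving V along
   the line towards a suitable "zigzag" matrix, all but finitely many V are
   primitive with balanced kernel, and then V^T D V lies in the bundle of K_a; when
   rank Q < r one first pads V by zero rows and D by polynomials X^d - c.  This
   gives (i), and (iii) follows since having rank at most r is a closed condition.
   For (ii), the r x r minors of an element of the bundle of K_a are those of
   p w w^T with p of degree r d - 2 a and w of degree a.  By compactness this
   passes to the limit, and comparing the orders of vanishing at every point forces
   a to be the same. *)
Require Import Defs.
From mathcomp Require Import all_boot all_order all_algebra all_fingroup complex.
From mathcomp Require Import boolp classical_sets filter reals topology.
From mathcomp Require Import normedtype interval_inference ring lra zify.

Set Implicit Arguments.
Unset Strict Implicit.
Unset Printing Implicit Defensive.

Import Order.TTheory GRing.Theory Num.Theory.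
Import ComplexField.Normc.
Local Open Scope ring_scope.

(** * Smith form *)

(** No canonical form of symmetric matrix polynomials is used. From the eigenstructure of an
    arbitrary element only two things are read off: the exponent sum at each point and the number of
    minimal indices. The exponent sums come from a determinant identity: if Q = V^T D V has rank
    equal to the size of D, the product of its invariant polynomials is det D times a square, up to
    a unit. Bundles let eigenvalues move to infinity, so every argument must also work there. This
    is why factorizations carry degree bounds [eta] on the rows of V: reversal then maps
    factorizations to factorizations with the same [eta], and infinity becomes the point 0. Being
    primitive with balanced kernel amounts to rank conditions on convolution matrices. Along a line
    V + t (V0 - V) these are nonvanishing conditions on polynomials in t, so a single good V0 with
    the same [eta] suffices; the zigzag matrix provides it. In (ii) the pair (p, w) is determined
    only up to scaling, so it is normalized before a limit is taken. *)

Section Smith.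
Variable F : fieldType.
Implicit Types p q : {poly F}.

Lemma dvdp_sumr (I : finType) (f : I -> {poly F}) p :
  (forall i, true -> p %| f i) -> p %| \sum_i f i.
Proof. by move=> H; elim/big_ind: _ => // x y; exact: dvdp_add. Qed.

Definition equivmx n (A B : 'M[{poly F}]_n) :=
  exists U V, [/\ U \in unitmx, V \in unitmx & B = U *m A *m V].

Lemma equivmx_refl n (A : 'M_n) : equivmx A A.
Proof. by exists 1%:M, 1%:M; rewrite !unitmx1 mul1mx mulmx1. Qed.

Lemma equivmx_trans n (B A C : 'M_n) :
  equivmx A B -> equivmx B C -> equivmx A C.
Proof.
move=> [U [V [uU uV ->]]] [U' [V' [uU' uV' ->]]].
by exists (U' *m U), (V *m V'); rewrite !unitmx_mul uU uU' uV uV' !mulmxA.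
Qed.

Lemma equivmx_mull n (A U : 'M_n) : U \in unitmx -> equivmx A (U *m A).
Proof. by move=> uU; exists U, 1%:M; rewrite unitmx1 mulmx1. Qed.

Lemma equivmx_mulr n (A V : 'M_n) : V \in unitmx -> equivmx A (A *m V).
Proof. by move=> uV; exists 1%:M, V; rewrite unitmx1 mul1mx. Qed.

Lemma unitmx_lshear n (q : 'cV[{poly F}]_n) :
  block_mx 1%:M 0 q 1%:M \in @unitmx _ (1 + n).
Proof. by rewrite unitmxE det_lblock !det1 mulr1 unitr1. Qed.

Lemma unitmx_rshear n (q : 'rV[{poly F}]_n) :
  block_mx 1%:M q 0 1%:M \in @unitmx _ (1 + n).
Proof. by rewrite unitmxE det_ublock !det1 mulr1 unitr1. Qed.

(** Minimality over the whole equivalence class replaces the termination argument of Euclidean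
    elimination: a nonzero remainder in any equivalent matrix contradicts it at once. *)
Definition min_pivot n (A : 'M[{poly F}]_n) (b : {poly F}) :=
  b != 0 /\ forall B, equivmx A B -> forall i j, B i j != 0 ->
    (size b <= size (B i j))%N.

Lemma min_pivot_ex n (A : 'M[{poly F}]_n.+1) : A != 0 ->
  exists2 B, equivmx A B & min_pivot A (B 0 0).
Proof.
move=> A0.
pose P k := exists2 B : 'M_n.+1, equivmx A B &
  exists i j, B i j != 0 /\ size (B i j) = k.
have [k Pk]: exists k, P k.
  have /existsP[i /existsP[j Aij]] : [exists i, exists j, A i j != 0].
    apply: contra_neqT A0; rewrite negb_exists => /forallP H.
    apply/matrixP => i j; rewrite mxE; apply/eqP.
    by have := H i; rewrite negb_exists => /forallP/(_ j); rewrite negbK.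
  by exists (size (A i j)), A; [exact: equivmx_refl | exists i, j].
have [m /asboolP Pm mmin] := @ex_minnP (fun k => `[< P k >])
  (ex_intro _ k (asboolT Pk)).
case: Pm => B AB [i [j [Bij sB]]].
exists (tperm_mx 0 i *m B *m tperm_mx 0 j).
  apply: equivmx_trans AB _; apply: equivmx_trans (equivmx_mull _ _) (equivmx_mulr _ _);
  by rewrite unitmx_perm.
have -> : (tperm_mx 0 i *m B *m tperm_mx 0 j) 0 0 = B i j.
  by rewrite -xrowE -xcolE !mxE !tpermL.
by split=> // C AC i' j' Cij; rewrite sB; apply/mmin/asboolP; exists C => //; exists i', j'.
Qed.

(** A column operation replaces an entry of the first row by its remainder modulo [b], which
    minimality forces to be 0. *)
Lemma min_pivot_dvdr n (A : 'M[{poly F}]_(1 + n)) b r c C :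
  min_pivot A b -> equivmx A (block_mx b%:M r c C) ->
  forall j, b %| r 0 j.
Proof.
move=> [b0 bmin] AB j; rewrite -[_ %| _]negbK; apply/negP => nd.
pose q := \row_j (r 0 j %/ b).
have := bmin _ (equivmx_trans AB (equivmx_mulr _ (unitmx_rshear (- q)))) 
  (lshift n (0 : 'I_1)) (rshift 1 j).
rewrite mulmx_block !mulmx1 !mulmx0 !addr0 block_mxEur.
rewrite mulmxN mul_scalar_mx !mxE (sameP (modp_eq0P _ _) eqP) in nd *.
have -> : - (b * (r 0 j %/ b)) + r 0 j = r 0 j %% b.
  by rewrite [X in _ + X](divp_eq _ b) mulrC addKr.
by move=> /(_ nd); rewrite leqNgt ltn_modp b0.
Qed.

Lemma min_pivot_dvdl n (A : 'M[{poly F}]_(1 + n)) b r c C :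
  min_pivot A b -> equivmx A (block_mx b%:M r c C) ->
  forall i, b %| c i 0.
Proof.
move=> [b0 bmin] AB i; rewrite -[_ %| _]negbK; apply/negP => nd.
pose q := \col_i (c i 0 %/ b).
have := bmin _ (equivmx_trans AB (equivmx_mull _ (unitmx_lshear (- q)))) 
  (rshift 1 i) (lshift n (0 : 'I_1)).
rewrite mulmx_block !mul1mx !mul0mx !addr0 block_mxEdl.
rewrite mulNmx mul_mx_scalar !mxE (sameP (modp_eq0P _ _) eqP) in nd *.
have -> : - (b * (c i 0 %/ b)) + c i 0 = c i 0 %% b.
  by rewrite [X in _ + X](divp_eq _ b) mulrC addKr.
by move=> /(_ nd); rewrite leqNgt ltn_modp b0.
Qed.

Definition diag_seq n (s : seq {poly F}) : 'M[{poly F}]_n :=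
  \matrix_(i, j) (s`_i *+ (i == j)).

Lemma smith_ex n (A : 'M[{poly F}]_n) : exists s,
  [/\ (size s <= n)%N, all (fun p => p \is monic) s,
      sorted (fun p q => p %| q) s & equivmx A (diag_seq n s)].
Proof.
elim: n A => [|n IH] A.
  exists [::]; split=> //; exists 1%:M, 1%:M; rewrite !unitmx1; split=> //.
  by apply/matrixP => -[].
have [->|A0] := eqVneq A 0.
  exists [::]; split=> //; suff -> : diag_seq n.+1 [::] = 0 by exact: equivmx_refl.
  by apply/matrixP => i j; rewrite !mxE nth_nil mul0rn.
have [B AB pivB] := min_pivot_ex A0.
move: A B A0 AB pivB; rewrite -[n.+1]/(1 + n)%N => A B A0 AB pivB.
set b := B 0 0 in pivB; have b0 : b != 0 by case: pivB.
have BE : B = block_mx b%:M (ursubmx B) (dlsubmx B) (drsubmx B).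
  rewrite -[LHS]submxK; congr block_mx; apply/matrixP => i j.
  by rewrite !ord1 !mxE mulr1n; congr (B _ _); apply/val_inj.
rewrite BE in AB; move: (ursubmx B) (dlsubmx B) (drsubmx B) AB => r c C AB {BE}.
have dr := min_pivot_dvdr pivB AB; have dc := min_pivot_dvdl pivB AB.
pose qr := \row_j (r 0 j %/ b); pose qc := \col_i (c i 0 %/ b).
have {}AB : equivmx A (block_mx b%:M 0 0 (C - qc *m r)).
  apply: equivmx_trans AB _.
  exists (block_mx 1%:M 0 (- qc) 1%:M), (block_mx 1%:M (- qr) 0 1%:M).
  rewrite unitmx_lshear unitmx_rshear; split=> //.
  rewrite !mulmx_block !mul1mx !mul0mx !mulmx1 !mulmx0 !addr0 mulNmx.
  have -> : qc *m b%:M = c.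
    by rewrite mul_mx_scalar; apply/matrixP => i j; rewrite !mxE ord1 mulrC divpK.
  have -> : b%:M *m - qr = - r.
    by rewrite mulmxN mul_scalar_mx; congr (- _); apply/matrixP => i j;
       rewrite !mxE ord1 mulrC divpK.
  by rewrite !addNr mul0mx add0r mulNmx addrC.
move: {C dr dc qr qc} (C - _) AB => C AB.
(* Adding row i of [C] to the first row keeps the pivot and makes that row the off-diagonal part. *)
have dC i j : b %| C i j.
  have := @min_pivot_dvdr _ A b (row i C) 0 C pivB _ j; rewrite mxE; apply.
  apply: equivmx_trans AB _; rewrite -[in X in equivmx _ X](mulmx1 C).
  have := equivmx_mull (block_mx b%:M 0 0 C) (unitmx_rshear (delta_mx 0 i)).
  by rewrite mulmx_block !mul1mx !mul0mx !mulmx0 !addr0 !add0r -rowE mulmx1.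
have [s [ss mons sos [U [V [uU uV dE]]]]] := IH C.
(* The invariant polynomials of [C] are combinations of its entries, so the pivot divides them; this
   extends the divisibility chain. *)
have ds p : p \in s -> b %| p.
  move=> /(nthP 0)[i lti <-]; have ltin := leq_trans lti ss.
  have -> : s`_i = diag_seq n s (Ordinal ltin) (Ordinal ltin).
    by rewrite mxE eqxx.
  rewrite dE mxE; apply: dvdp_sumr => k _; rewrite mxE dvdp_mulr //.
  by apply: dvdp_sumr => l _; rewrite dvdp_mull.
pose l := (lead_coef b)^-1; have l0 : l != 0 by rewrite invr_eq0 lead_coef_eq0.
exists (l *: b :: s); split=> //=.
- by apply/andP; split=> //; rewrite monicE lead_coefZ mulVf ?lead_coef_eq0.
- case: {ss mons dE} s ds sos => [|p s] ds /= sos; rewrite ?sos ?andbT //.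
  by rewrite dvdpZl // ds ?mem_head.
apply: equivmx_trans AB _.
exists (block_mx (l%:P)%:M 0 0 U), (block_mx 1%:M 0 0 V).
rewrite !unitmxE !det_ublock !det_scalar !expr1 mul1r -!unitmxE uV.
rewrite unitrM -unitmxE uU andbT poly_unitE size_polyC l0 coefC /= unitfE l0.
split=> //; rewrite !mulmx_block !(mul0mx, mulmx0, addr0, add0r) mulmx1 -dE.
apply/matrixP => i j; rewrite !mxE.
case: splitP => i' ei; rewrite !mxE; case: splitP => j' ej;
  rewrite !mxE -val_eqE /= ei ej ?ord1 //=.
by rewrite big_ord1 !mxE !mulr1n mul_polyC.
Qed.
End Smith.

(** * Determinant identities from the Smith form *)

Section SmithFactor.
Variable F : fieldType.
Implicit Types p q : {poly F}.

Lemma det_diag_seq (s : seq {poly F}) : \det (diag_seq (size s) s) = \prod_(p <- s) p.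
Proof.
have -> : diag_seq (size s) s = diag_mx (\row_i s`_i) by apply/matrixP => i j; rewrite !mxE.
by rewrite det_diag (big_nth 0) big_mkord; apply: eq_bigr => i _; rewrite mxE.
Qed.

Lemma diag_seq_pid n (s : seq {poly F}) : (size s <= n)%N ->
  diag_seq n s = pid_mx (size s) *m diag_seq (size s) s *m pid_mx (size s).
Proof.
move=> sn; apply/matrixP => i j; rewrite !mxE.
have [lti|gei] := ltnP i (size s); last first.
  rewrite nth_default // mul0rn big1 // => k _; rewrite mxE big1 ?mul0r // => l _.
  by rewrite mxE ltnNge gei andbF mul0r.
rewrite (bigD1 (Ordinal lti)) //= big1 => [|k nk]; last first.
  rewrite mxE (bigD1 (Ordinal lti)) //= big1 => [|l nl]; last first.
    by rewrite mxE -(inj_eq val_inj) eq_sym in nl *; rewrite (negPf nl) mul0r.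
  by rewrite !mxE [_ == k]eq_sym (negPf nk) mulr0n mulr0 addr0 mul0r.
rewrite !mxE addr0 lti andbT /= (bigD1 (Ordinal lti)) //= big1 => [|l nl]; last first.
  by rewrite mxE -(inj_eq val_inj) eq_sym in nl *; rewrite (negPf nl) mul0r.
by rewrite !mxE /= lti !eqxx addr0 /= mul1r -val_eqE /= mulr_natr mulr1n.
Qed.

(** The one-sided inverses [Z] and [W] recover the Smith block from [A]; divisibility of
    determinants is transported through them. *)
Lemma smith_factors n (A : 'M[{poly F}]_n) s :
    (size s <= n)%N -> equivmx A (diag_seq n s) ->
  exists (X : 'M_(n, size s)) (Y : 'M_(size s, n)) (Z : 'M_(size s, n)) (W : 'M_(n, size s)),
  [/\ A = X *m diag_seq (size s) s *m Y, Z *m X = 1%:M & Y *m W = 1%:M].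
Proof.
move=> sn [U [V [uU uV e]]].
exists (invmx U *m pid_mx (size s)), (pid_mx (size s) *m invmx V),
  (pid_mx (size s) *m U), (V *m pid_mx (size s)).
have pp : (pid_mx (size s) : 'M[{poly F}]_(_, n)) *m pid_mx (size s) = 1%:M :> 'M_(size s).
  by rewrite mul_pid_mx minnn (minn_idPr sn) pid_mx_1.
split.
- rewrite !mulmxA; have := diag_seq_pid sn; rewrite e => /(congr1 (fun M => invmx U *m M *m invmx V)).
  by rewrite !mulmxA mulVmx // mul1mx mulmxK.
- by rewrite mulmxA mulmxK.
- by rewrite mulmxA mulmxKV.
Qed.

Lemma prod_monic_neq0 (s : seq {poly F}) : all (fun p => p \is monic) s -> \prod_(p <- s) p != 0.
Proof. by move=> H; rewrite prodf_seq_neq0; apply/allP => p /(allP H) /monic_neq0. Qed.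

Local Notation fr A := (map_mx (@tofrac {poly F}) A).

Lemma rank_frac_det r (D : 'M[{poly F}]_r) : \det D != 0 -> \rank (fr D) = r.
Proof.
by move=> D0; apply/mxrank_unit; rewrite unitmxE det_map_mx unitfE tofrac_eq0.
Qed.

Lemma smith_rank n (A : 'M[{poly F}]_n) s :
    (size s <= n)%N -> all (fun p => p \is monic) s -> equivmx A (diag_seq n s) ->
  \rank (fr A) = size s.
Proof.
move=> sn mon /(smith_factors sn)[X [Y [Z [W [-> ZX YW]]]]].
have D0 : \det (diag_seq (size s) s) != 0 by rewrite det_diag_seq prod_monic_neq0.
set B := _ *m Y; apply/eqP; rewrite eqn_leq; apply/andP; split.
  by rewrite map_mxM; apply: leq_trans (mxrankM_maxr _ _) (rank_leq_row _).
rewrite -[X in (X <= _)%N](rank_frac_det D0).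
have -> : diag_seq (size s) s = Z *m B *m W.
  by rewrite /B !mulmxA ZX mul1mx -mulmxA YW mulmx1.
rewrite !map_mxM; move: (fr B) (fr Z) (fr W) => A' Z' W'.
by apply: leq_trans (mxrankM_maxl _ _) (mxrankM_maxr _ _).
Qed.

(* If A = X S Y is symmetric, then W^T X is unimodular, so that W^T A W and the
   Smith form have the same determinant. *)
Lemma smith_symm n (A : 'M[{poly F}]_n) s : A^T = A ->
    (size s <= n)%N -> all (fun p => p \is monic) s -> equivmx A (diag_seq n s) ->
  exists (Y : 'M_(size s, n)) (W : 'M_(n, size s)),
    [/\ Y *m W = 1%:M, A = Y^T *m (W^T *m A *m W) *m Y
      & \det (W^T *m A *m W) %= \prod_(p <- s) p].
Proof.
move=> symA sn mon /(smith_factors sn)[X [Y [Z [W [eA ZX YW]]]]].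
set S := diag_seq _ _ in eA; exists Y, W; split=> //.
  have AWY : A *m (W *m Y) = A by rewrite eA !mulmxA -[_ *m Y *m W]mulmxA YW mulmx1.
  have AWY' : (W *m Y)^T *m A = A by rewrite -{1}symA -trmx_mul AWY.
  by rewrite !mulmxA -trmx_mul AWY' -mulmxA AWY.
have -> : W^T *m A *m W = W^T *m X *m S by rewrite eA !mulmxA -mulmxA YW mulmx1.
have symS : S^T = S by apply/matrixP => i j; rewrite !mxE eq_sym; case: eqP => // ->.
have eA' : A = Y^T *m S *m X^T by rewrite -symA eA !trmx_mul symS mulmxA.
have : S = Z *m Y^T *m S *m (X^T *m W).
  have -> : Z *m Y^T *m S *m (X^T *m W) = Z *m A *m W by rewrite eA' !mulmxA.
  by rewrite eA !mulmxA ZX mul1mx -mulmxA YW mulmx1.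
move=> /(congr1 determinant); rewrite !det_mulmx det_diag_seq mulrAC mulrC -[LHS]mulr1.
move=> /(mulfI (prod_monic_neq0 mon)) /esym e.
rewrite -[X in _ %= X]mul1r eqp_mul2r ?prod_monic_neq0 //.
rewrite -det_tr trmx_mul trmxK /eqp dvd1p andbT.
by rewrite -e dvdp_mull.
Qed.

(** With [W] from [smith_symm], W^T A W = (V W)^T D (V W). The square is what makes the parity of a
    multiplicity readable on [D] alone. *)
Lemma smith_fact_symm n (A : 'M[{poly F}]_n) s r (V : 'M_(r, n)) (D : 'M_r) :
    A^T = A -> size s = r -> (size s <= n)%N -> all (fun p => p \is monic) s ->
    equivmx A (diag_seq n s) -> A = V^T *m D *m V ->
  exists W, \prod_(p <- s) p %= \det D * (\det (V *m W)) ^+ 2.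
Proof.
move=> symA er; subst r => sn mon eqv eA.
have [Y [W [YW _ eD]]] := smith_symm symA sn mon eqv; exists W.
rewrite eqp_sym; apply: eqp_trans eD; rewrite eA.
have -> : W^T *m (V^T *m D *m V) *m W = (V *m W)^T *m D *m (V *m W).
  by rewrite trmx_mul !mulmxA.
by rewrite 2!det_mulmx det_tr mulrAC -expr2 mulrC eqpxx.
Qed.

(** A right inverse of [V] removes the square: D = W'^T A W', so the product of the invariant
    polynomials divides det D, and [smith_fact_symm] gives the converse. *)
Lemma smith_fact_right_inv n (A : 'M[{poly F}]_n) s r (V : 'M_(r, n)) (D : 'M_r) W' :
    A^T = A -> size s = r -> (size s <= n)%N -> all (fun p => p \is monic) s ->
    equivmx A (diag_seq n s) -> A = V^T *m D *m V -> V *m W' = 1%:M ->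
  \prod_(p <- s) p %= \det D.
Proof.
move=> symA er sn mon eqv eA VW'.
have [W eW] := smith_fact_symm symA er sn mon eqv eA.
subst r; have [X [Y [Z [W2 [eX ZX YW]]]]] := smith_factors sn eqv.
apply/andP; split; last by rewrite (eqp_dvdr _ eW) dvdp_mulr.
have -> : D = (W'^T *m X) *m diag_seq (size s) s *m (Y *m W').
  have -> : D = W'^T *m (V^T *m D *m V) *m W'.
    by rewrite !mulmxA -trmx_mul VW' trmx1 mul1mx -mulmxA VW' mulmx1.
  by rewrite -eA eX !mulmxA.
by rewrite !det_mulmx det_diag_seq mulrAC dvdp_mull.
Qed.
End SmithFactor.

(** * Reversal *)

Section Reversal.
Variable F : numFieldType.
Implicit Types p q : {poly F}.

Definition revp k p : {poly F} := \poly_(i < k.+1) p`_(k - i).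

Lemma size_revp k p : (size (revp k p) <= k.+1)%N.
Proof. exact: size_poly. Qed.

Lemma revpK k p : (size p <= k.+1)%N -> revp k (revp k p) = p.
Proof.
move=> sp; apply/polyP => i; rewrite coef_poly ltnS.
case: leqP => [ik|ki]; last by rewrite nth_default // (leq_trans sp).
by rewrite coef_poly ltnS leq_subr subKn.
Qed.

Lemma horner_revp k p x : (size p <= k.+1)%N -> x != 0 ->
  (revp k p).[x] = x ^+ k * p.[x^-1].
Proof.
move=> sp x0; rewrite horner_poly (horner_coef_wide _ sp) mulr_sumr.
rewrite (reindex_inj rev_ord_inj) /=; apply: eq_bigr => i _.
rewrite subSS subKn -1?ltnS // mulrCA; congr (_ * _).
by rewrite exprVn expfB_cond // (negPf x0) add0n -ltnS.
Qed.

(** Reversal is x^k p(1/x) away from 0, so identities between reversed polynomials are checked at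
    nonzero points only. *)
Lemma poly_eq_nonzero p q : (forall x, x != 0 -> p.[x] = q.[x]) -> p = q.
Proof.
move=> H; apply/eqP; rewrite -subr_eq0; apply/negPn/negP => pq0.
pose s := [seq i.+1%:R : F | i <- iota 0 (size (p - q))].
have us : uniq s.
  rewrite map_inj_uniq ?iota_uniq // => i j /eqP.
  by rewrite eqr_nat eqSS => /eqP.
have rs : all (root (p - q)) s.
  apply/allP => _ /mapP[i _ ->]; have nz : i.+1%:R != 0 :> F by rewrite pnatr_eq0.
  by rewrite rootE hornerD hornerN (H _ nz) subrr.
by have := max_poly_roots pq0 rs us; rewrite size_map size_iota ltnn.
Qed.

Lemma revp_neq0 k p : (size p <= k.+1)%N -> p != 0 -> revp k p != 0.
Proof.
by move=> sp; apply: contra_neq => e; rewrite -(revpK sp) e; apply/polyP => i;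
  rewrite coef_poly !coef0 if_same.
Qed.

(** The order of a form of degree k at infinity is the drop in degree of its dehomogenization. *)
Lemma mup0_revp k p : p != 0 -> (size p <= k.+1)%N ->
  (mup 0 (revp k p) + size p = k.+1)%N.
Proof.
move=> p0 sp; have sp0 : (0 < size p)%N by rewrite size_poly_gt0.
pose N := (size p).-1; have sN : size p = N.+1 by rewrite prednK.
have r0 : revp N p != 0 by apply: revp_neq0; rewrite ?sN.
(* With N the degree of [p], the reversal of degree N has the leading coefficient of [p] as its
   constant term, so it does not vanish at 0. *)
have -> : revp k p = ('X - 0%:P) ^+ (k - N) * revp N p.
  apply: poly_eq_nonzero => x x0; rewrite hornerM horner_exp hornerXsubC subr0.
  by rewrite (horner_revp sp x0) (horner_revp _ x0) ?sN // mulrA -exprD subnK // -ltnS -sN.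
rewrite mupM ?expf_neq0 ?polyXsubC_eq0 // mup_XsubCX eqxx mupNroot.
  by rewrite addn0 sN addnS subnK // -ltnS -sN.
by rewrite rootE horner_coef0 coef_poly /= subn0 -lead_coefE lead_coef_eq0.
Qed.

Variables (d n r : nat) (eta : nat -> nat).

Definition rev_sym (Q : 'M[{poly F}]_n) := \matrix_(i, j) revp d (Q i j).
Definition rev_rows (V : 'M[{poly F}]_(r, n)) := \matrix_(i, j) revp (eta i) (V i j).
(* Entries of negative degree bound vanish, see graded_gram. *)
Definition rev_gram (D : 'M[{poly F}]_r) : 'M[{poly F}]_r :=
  \matrix_(i, j) if (eta i + eta j <= d)%N then revp (d - (eta i + eta j)) (D i j) else 0.

(** The [eta i] are nominal degrees, possibly larger than the true ones. They are indexed by [nat],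
    so adding or removing a first row is a shift of [eta]. *)
Definition graded_rows (V : 'M[{poly F}]_(r, n)) :=
  forall i j, (size (V i j) <= (eta i).+1)%N.
(** The first alternative serves negative bounds: the zero polynomial has size 0 and would violate
    the inequality once [eta i + eta j] exceeds d + 1. *)
Definition graded_gram (D : 'M[{poly F}]_r) :=
  forall i j, D i j = 0 \/ (size (D i j) + (eta i + eta j) <= d.+1)%N.

Lemma graded_rev_rows V : graded_rows (rev_rows V).
Proof. by move=> i j; rewrite mxE size_revp. Qed.

Lemma graded_rev_gram D : graded_gram (rev_gram D).
Proof.
move=> i j; rewrite mxE; case: leqP => [le|]; last by left.
by right; rewrite -[X in (_ <= X.+1)%N](subnK le) -addSn leq_add2r size_revp.
Qed.

Lemma graded_gram_size D (i j : 'I_r) : graded_gram D -> (eta i + eta j <= d)%N ->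
  (size (D i j) <= (d - (eta i + eta j)).+1)%N.
Proof.
move=> gD le; have [->|] := gD i j; first by rewrite size_poly0.
by rewrite -{1}(subnK le) -addSn leq_add2r.
Qed.

Lemma graded_gram_eq0 D (i j : 'I_r) : graded_gram D -> (d < eta i + eta j)%N -> D i j = 0.
Proof.
move=> gD lt; case: (gD i j) => // /leq_trans/(_ lt).
by rewrite -[X in (_ <= X)%N]add0n leq_add2r leqn0 size_poly_eq0 => /eqP.
Qed.

Lemma tr_rev_gram D : (rev_gram D)^T = rev_gram D^T.
Proof. by apply/matrixP => i j; rewrite !mxE addnC. Qed.

Lemma horner_rev_gram D (i j : 'I_r) x : graded_gram D -> x != 0 ->
  x ^+ eta i * (rev_gram D i j).[x] * x ^+ eta j = x ^+ d * (D i j).[x^-1].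
Proof.
move=> gD x0; rewrite mxE; case: leqP => [le|lt]; last first.
  by rewrite (graded_gram_eq0 gD) // !horner0 mulr0 mul0r mulr0.
rewrite horner_revp ?graded_gram_size // mulrAC -exprD mulrA -exprD.
by rewrite subnKC.
Qed.

Lemma rev_fact (Q : 'M[{poly F}]_n) V D : graded_rows V -> graded_gram D ->
  (forall i j, size (Q i j) <= d.+1)%N ->
  Q = V^T *m D *m V -> rev_sym Q = (rev_rows V)^T *m rev_gram D *m rev_rows V.
Proof.
move=> gV gD sQ eQ; apply/matrixP => i j; apply: poly_eq_nonzero => x x0.
have hG k l := horner_rev_gram k l gD x0; move: (rev_gram D) hG => G hG.
rewrite mxE horner_revp // eQ !mxE !horner_sum mulr_sumr; apply: eq_bigr => l _.
rewrite !mxE !hornerM !horner_sum !mulr_suml mulr_sumr.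
apply: eq_bigr => k _; rewrite !mxE !hornerM !horner_revp //.
transitivity (x ^+ d * (D k l).[x^-1] * ((V k i).[x^-1] * (V l j).[x^-1])).
  by ring.
by rewrite -hG; ring.
Qed.

(** This is the degree r d - 2 a of the binary form det D, split into its degree and its order at
    infinity. It follows by taking determinants in diag(x^eta) rev(D)(x) diag(x^eta) = x^d
    D(1/x). *)
Lemma rev_gram_det D : graded_gram D -> \det D != 0 ->
  [/\ \det (rev_gram D) != 0 &
   (2 * (\sum_(i < r) eta i) + (size (\det D)).-1 + mup 0 (\det (rev_gram D)) = r * d)%N].
Proof.
move=> gD D0; set a := (\sum_(i < r) eta i)%N.
have sp0 : (0 < size (\det D))%N by rewrite size_poly_gt0.
set N := (size (\det D)).-1; have sN : size (\det D) = N.+1 by rewrite prednK.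
have e : 'X ^+ (2 * a + N) * \det (rev_gram D) = 'X ^+ (r * d) * revp N (\det D).
  apply: poly_eq_nonzero => x x0.
  rewrite !hornerM !hornerXn horner_revp ?sN //.
  have E : diag_mx (\row_i x ^+ eta i) *m map_mx (horner_eval x) (rev_gram D)
      *m diag_mx (\row_i x ^+ eta i) = x ^+ d *: map_mx (horner_eval x^-1) D.
    apply/matrixP => i j; rewrite mul_mx_diag mul_diag_mx !mxE !horner_evalE.
    by rewrite -(horner_rev_gram _ _ gD x0) mxE.
  have dx : \det (diag_mx (\row_(i < r) x ^+ eta i)) = x ^+ a.
    by rewrite det_diag /a expr_sum; apply: eq_bigr => i _; rewrite mxE.
  have := congr1 determinant E.
  rewrite !det_mulmx detZ !det_map_mx /= !horner_evalE dx => E'.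
  rewrite mulrCA [(r * d)%N]mulnC exprM -E' exprD mul2n -addnn exprD.
  by move: (x ^+ a) (x ^+ N) (_.[x]) => u v w; ring.
have q0 : \det (rev_gram D) != 0.
  apply: contra_eq_neq e => ->; rewrite mulr0 eq_sym mulf_neq0 ?expf_neq0 ?polyX_eq0 //.
  by rewrite revp_neq0 ?sN.
split=> //; have := congr1 (mup 0) e; rewrite -['X]subr0 -polyC0.
rewrite !mupM ?expf_neq0 ?polyXsubC_eq0 // ?revp_neq0 ?sN // !mup_XsubCX eqxx.
by rewrite (mupNroot (q := revp _ _)) ?addn0 // rootE horner_coef0 coef_poly /=
  subn0 -lead_coefE lead_coef_eq0.
Qed.

End Reversal.

(** * Raising the degrees at a double root *)

Section Shear.
Variable R : comUnitRingType.

(** The identity matrix with row [i0] replaced by [u], written as a rank one update so that its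
    inverse is explicit. *)
Definition shear r (i0 : 'I_r) (u : 'rV[R]_r) : 'M[R]_r :=
  1%:M + delta_mx i0 0 *m (u - delta_mx 0 i0).

Lemma shearE r (i0 : 'I_r) u i j :
  shear i0 u i j = if i == i0 then u 0 j else (i == j)%:R.
Proof.
rewrite !mxE big_ord1 !mxE eqxx andbT /=.
by case: (i =P i0) => [->|_]; rewrite ?mul0r ?addr0 // mul1r [j == i0]eq_sym addrC subrK.
Qed.

Lemma shear_row r (i0 : 'I_r) u : delta_mx 0 i0 *m shear i0 u = u.
Proof. by rewrite -rowE; apply/rowP => j; rewrite mxE shearE eqxx. Qed.

(** The update N squares to zero because [u - delta_mx 0 i0] vanishes at [i0]; hence 1 + N has
    inverse 1 - N. *)
Lemma shear_inv r (i0 : 'I_r) (u : 'rV[R]_r) : u 0 i0 = 1 ->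
  shear i0 u *m (1%:M - delta_mx i0 0 *m (u - delta_mx 0 i0)) = 1%:M.
Proof.
move=> u1; set v := u - _; set N := delta_mx i0 0 *m v.
have vd : v *m delta_mx i0 (0 : 'I_1) = 0.
  by rewrite -colE; apply/matrixP => i j; rewrite !mxE !ord1 u1 !eqxx subrr.
have NN : N *m N = 0.
  have vN : v *m N = 0 by rewrite /N mulmxA vd mul0mx.
  have -> : N *m N = delta_mx i0 0 *m (v *m N) by rewrite [RHS]mulmxA.
  by rewrite vN mulmx0.
by rewrite /shear -/N mulmxBr mulmx1 mulmxDl mul1mx NN addr0 addrK.
Qed.

Lemma unitmx_shear r (i0 : 'I_r) (u : 'rV[R]_r) : u 0 i0 = 1 -> shear i0 u \in unitmx.
Proof. by move=> /shear_inv/mulmx1_unit[]. Qed.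

End Shear.

Section Step.
Variable F : numClosedFieldType.
Implicit Types p q : {poly F}.

Local Notation C := (map_mx (@polyC F)).
Local Notation "A .at m" := (map_mx (horner_eval m) A) (at level 2, m at level 1).

Lemma map_polyC_at m n k (A : 'M[F]_(m, n)) : (C A).at k = A.
Proof. by apply/matrixP => i j; rewrite !mxE /= /horner_eval hornerC. Qed.

Definition rowdiag r (i0 : 'I_r) (t : {poly F}) : 'M[{poly F}]_r :=
  diag_mx (\row_i t ^+ (i == i0)).

Lemma det_rowdiag r (i0 : 'I_r) t : \det (rowdiag i0 t) = t.
Proof.
rewrite det_diag (bigD1 i0) //= !mxE eqxx expr1 big1 ?mulr1 // => i /negPf ni.
by rewrite mxE ni.
Qed.

(* The form u^T D u / t on ker D(mu) has an isotropic vector if dim ker D(mu) > 1,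
   and it vanishes if dim ker D(mu) = 1, because t^2 divides det D. *)
Lemma isotropic_kernel r (D : 'M[{poly F}]_r) mu : D^T = D ->
    ('X - mu%:P) ^+ 2 %| \det D ->
  exists u : 'rV[F]_r, [/\ u != 0, forall j, 'X - mu%:P %| (C u *m D) 0 j
    & ('X - mu%:P) ^+ 2 %| (C u *m D *m C u^T) 0 0].
Proof.
set t := 'X - _ => symD t2D; pose E := D.at mu.
have symE : E^T = E by rewrite /E map_trmx symD.
have kerP (v : 'rV_r) : v *m E = 0 -> forall j, t %| (C v *m D) 0 j.
  move=> vE j; rewrite dvdp_XsubCl rootE.
  have -> : ((C v *m D) 0 j).[mu] = (v *m E) 0 j.
    by rewrite -[v in RHS](map_polyC_at mu v) /E -map_mxM [RHS]mxE.
  by rewrite vE mxE.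
have kerQ (v w : 'rV_r) : v *m E = 0 -> t %| (C v *m D *m C w^T) 0 0.
  by move=> /kerP vE; rewrite mxE; apply: dvdp_sumr => k _; rewrite dvdp_mulr.
have dE : \det E = 0.
  rewrite /E det_map_mx; apply/eqP; rewrite -[_ == 0]/(root _ _) -dvdp_XsubCl.
  by apply: dvdp_trans t2D; rewrite dvdp_exp.
move/eqP/det0P: dE => [u0 u0n u0E].
have [i0 ui0] : exists i0, u0 0 i0 != 0 by apply/rV0Pn.
pose u := (u0 0 i0)^-1 *: u0.
have u1 : u 0 i0 = 1 by rewrite mxE mulVf.
have uE : u *m E = 0 by rewrite -scalemxAl u0E scaler0.
have un : u != 0 by rewrite scaler_eq0 negb_or invr_eq0 ui0.
clearbody u; have [|nt2] := boolP (t ^+ 2 %| (C u *m D *m C u^T) 0 0).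
  by move=> ?; exists u; split=> //; exact: kerP.
pose H := shear i0 u; have uH : H \in unitmx := unitmx_shear u1.
have [D1 eqD1] : {D1 | D1 = C H *m D *m (C H)^T} by eexists.
have rH : C u = delta_mx 0 i0 *m C H.
  by rewrite -[u in LHS](shear_row i0) map_mxM map_delta_mx.
have rD1 : row i0 D1 = C u *m D *m (C H)^T by rewrite eqD1 rH rowE !mulmxA.
have D1i0 j : t %| D1 i0 j.
  have -> : D1 i0 j = (row i0 D1) 0 j by rewrite [RHS]mxE.
  by rewrite rD1 mxE; apply: dvdp_sumr => k _; rewrite dvdp_mulr // kerP.
have D1ii : D1 i0 i0 = (C u *m D *m C u^T) 0 0.
  have -> : C u^T = (C H)^T *m delta_mx i0 0.
    by rewrite -[C u^T]map_trmx rH trmx_mul trmx_delta.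
  by rewrite mulmxA -rD1 -colE !mxE.
(* In the basis starting with [u], row [i0] is divisible by t. Dividing it out uses up one factor of
   det D, and the second one makes det D2 vanish at [mu]. *)
pose D2 : 'M[{poly F}]_r := \matrix_(i, j) (if i == i0 then D1 i j %/ t else D1 i j).
have eD1 : D1 = rowdiag i0 t *m D2.
  apply/matrixP => i j; rewrite mul_diag_mx !mxE; case: eqP => [->|_].
    by rewrite expr1 mulrC divpK.
  by rewrite expr0 mul1r.
have t0 : t != 0 by rewrite polyXsubC_eq0.
have tD2 : \det (D2.at mu) = 0.
  rewrite det_map_mx; apply/eqP; rewrite -[_ == 0]/(root _ _) -dvdp_XsubCl.
  rewrite -(dvdp_mul2l _ _ t0) -{2}(det_rowdiag i0 t) -det_mulmx -eD1 -expr2 eqD1.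
  by rewrite !det_mulmx dvdp_mulr // dvdp_mull.
have /eqP : \det (D2.at mu)^T = 0 by rewrite det_tr.
move=> /det0P[w' w'n w'D2].
have {}w'D2 : (D2.at mu) *m w'^T = 0.
  by rewrite -[LHS]trmxK trmx_mul trmxK w'D2 trmx0.
have symD1 : D1^T = D1 by rewrite eqD1 !trmx_mul trmxK symD mulmxA.
have w'D1 : w' *m D1.at mu = 0.
  rewrite -[LHS]trmxK trmx_mul map_trmx symD1 eD1 map_mxM -mulmxA w'D2.
  by rewrite mulmx0 trmx0.
pose w := w' *m H.
have wE : w *m E = 0.
  have uHt : H^T \in unitmx by rewrite unitmx_tr.
  apply: (can_inj (mulmxK uHt)).
  rewrite mul0mx -{}[RHS]w'D1 eqD1 !map_mxM map_polyC_at -map_trmx map_polyC_at.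
  by rewrite /w !mulmxA.
(* If [w] were a multiple of [u], a nonzero multiple of e_{i0} would be a null vector of D2(mu);
   then D1_{i0 i0} / t would vanish at [mu], that is, u would already satisfy the order two
   condition. *)
have indep x : x *: u + w != 0.
  apply/eqP => e; have {}e : x *: delta_mx 0 i0 + w' = 0.
    apply: (can_inj (mulmxK uH)).
    by rewrite mul0mx mulmxDl -scalemxAl shear_row e.
  have ew : w' = - x *: delta_mx 0 i0 by apply/eqP; rewrite scaleNr -addr_eq0 addrC e.
  have /matrixP/(_ i0 0) := w'D2.
  rewrite ew linearZ /= trmx_delta -scalemxAr -colE !mxE eqxx => /eqP.
  rewrite mulf_eq0 oppr_eq0 => /orP[/eqP x0|].
    by move: w'n; rewrite ew x0 oppr0 scale0r eqxx.
  rewrite -[_ == 0]/(root _ _) -dvdp_XsubCl -(dvdp_mul2l _ _ t0) -expr2 mulrC divpK //.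
  by rewrite D1ii (negPf nt2).
clearbody w; pose al := (C u *m D *m C u^T) 0 0 %/ t; pose be := (C u *m D *m C w^T) 0 0 %/ t.
pose ga := (C w *m D *m C w^T) 0 0 %/ t.
have al0 : al.[mu] != 0.
  rewrite -[_ == 0]/(root _ _) -dvdp_XsubCl -(dvdp_mul2l _ _ t0) -expr2 mulrC divpK //.
  exact: kerQ.
(* A root of al x^2 + 2 be x + ga, the value at x u + w of the quadratic form (v^T D v / t)(mu). *)
pose x := (- be.[mu] + sqrtC (be.[mu] ^+ 2 - al.[mu] * ga.[mu])) / al.[mu].
have ex : al.[mu] * x ^+ 2 + (2 * x) * be.[mu] + ga.[mu] = 0.
  rewrite /x; set s := sqrtC _; have es : s ^+ 2 = be.[mu] ^+ 2 - al.[mu] * ga.[mu] by rewrite sqrtCK.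
  have -> : ga.[mu] = (be.[mu] ^+ 2 - s ^+ 2) / al.[mu].
    by rewrite es opprB addrC subrK mulrC mulKf.
  by move: al0 {es}; move: al.[mu] be.[mu] s => A B S A0; field.
have vE : (x *: u + w) *m E = 0 by rewrite mulmxDl -scalemxAl uE wE scaler0 addr0.
exists (x *: u + w); split=> //; first exact: kerP.
have -> : (C (x *: u + w) *m D *m C (x *: u + w)^T) 0 0 =
    t * (al * (x ^+ 2)%:P + (2 * x)%:P * be + ga).
  have eq0 (a b : 'rV_r) (a0 : a *m E = 0) : (C a *m D *m C b^T) 0 0 = t * ((C a *m D *m C b^T) 0 0 %/ t).
    by rewrite mulrC divpK // kerQ.
  have sw : (C w *m D *m C u^T) 0 0 = (C u *m D *m C w^T) 0 0.
    have -> : C w *m D *m C u^T = (C u *m D *m C w^T)^T.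
      by rewrite !trmx_mul !map_trmx trmxK symD mulmxA.
    by rewrite mxE.
  have sc : C (x *: u + w) = x%:P *: C u + C w.
    by apply/matrixP => i j; rewrite !mxE rmorphD rmorphM.
  have sct : C (x *: u + w)^T = x%:P *: C u^T + C w^T.
    by apply/matrixP => i j; rewrite !mxE rmorphD rmorphM.
  have -> : (C (x *: u + w) *m D *m C (x *: u + w)^T) 0 0 =
      x%:P ^+ 2 * (C u *m D *m C u^T) 0 0 + x%:P * ((C u *m D *m C w^T) 0 0 +
      (C w *m D *m C u^T) 0 0) + (C w *m D *m C w^T) 0 0.
    rewrite sc sct !mulmxDl !mulmxDr -!scalemxAl -!scalemxAr.
    move: (C u *m D *m C u^T) (C u *m D *m C w^T) (C w *m D *m C u^T)
      (C w *m D *m C w^T) => m1 m2 m3 m4.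
    by rewrite !mxE; ring.
  rewrite sw (eq0 u u uE) (eq0 u w uE) (eq0 w w wE) -/al -/be -/ga.
  rewrite polyC_exp mulr_natl polyCMn.
  by move: (t) (al) (be) (ga) (x%:P) => ? ? ? ? ?; ring.
rewrite expr2 dvdp_mul2l // dvdp_XsubCl rootE !(hornerD, hornerM, hornerC).
apply/eqP; rewrite -[RHS]ex; clearbody x al be ga; ring.
Qed.
End Step.

(** * Graded factorizations with squarefree Gram determinant *)

Section GradedFactorization.
Variable F : numClosedFieldType.
Implicit Types p q : {poly F}.
Local Notation C := (map_mx (@polyC F)).

Definition graded_fact d n (Q : 'M[{poly F}]_n) r (eta : nat -> nat)
    (V : 'M[{poly F}]_(r, n)) (D : 'M[{poly F}]_r) : Prop :=
  [/\ graded_rows eta V, graded_gram d eta D, D^T = D, \det D != 0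
    & Q = V^T *m D *m V].

(** The coefficientwise form treats both alternatives alike and passes to linear combinations. *)
Lemma graded_gramP d r eta (D : 'M[{poly F}]_r) :
  graded_gram d eta D <->
  forall (i j : 'I_r) k, (d < k + (eta i + eta j))%N -> (D i j)`_k = 0.
Proof.
split=> [gD i j k lt|gD i j].
  have [->|le] := gD i j; first by rewrite coef0.
  rewrite nth_default // -ltnS -(ltn_add2r (eta i + eta j)).
  by apply: leq_ltn_trans le _; rewrite addSn ltnS.
have [->|nz] := eqVneq (D i j) 0; [by left | right].
have sp : (0 < size (D i j))%N by rewrite size_poly_gt0.
rewrite leqNgt; apply/negP => lt; case/negP: nz; rewrite -lead_coef_eq0 lead_coefE.
by rewrite gD // -ltnS -addSn prednK.
Qed.

Lemma graded_fact_step d n (Q : 'M[{poly F}]_n) r eta (V : 'M_(r, n)) D mu :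
    graded_fact d Q eta V D -> ('X - mu%:P) ^+ 2 %| \det D ->
  exists eta' V' D', graded_fact (r := r) d Q eta' V' D' /\
    (\sum_(i < r) eta' i = (\sum_(i < r) eta i).+1)%N.
Proof.
set t := 'X - _ => -[gV gD symD D0 eQ] t2D.
have [u [un uD uDu]] := isotropic_kernel symD t2D.
have [i1 ui1] : exists i, u 0 i != 0 by apply/rV0Pn.
(* Choosing the least [eta] on the support of [u] makes the constant change of basis graded: row i0
   of V is only subtracted from rows with larger or equal bounds, and row i0 of D only receives rows
   with smaller or equal bounds. *)
case: (@arg_minnP _ i1 (fun i => u 0 i != 0) (fun i : 'I_r => eta i) ui1) => i0 ui0 min0.
pose v := (u 0 i0)^-1 *: u.
have v1 : v 0 i0 = 1 by rewrite mxE mulVf.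
have vn k : v 0 k != 0 -> (eta i0 <= eta k)%N.
  by rewrite mxE mulf_eq0 negb_or => /andP[_ /min0].
have Cv : C v = ((u 0 i0)^-1)%:P *: C u by rewrite map_mxZ.
have Cvt : C v^T = ((u 0 i0)^-1)%:P *: C u^T by rewrite -!map_trmx Cv linearZ.
have vD j : t %| (C v *m D) 0 j.
  by rewrite Cv -scalemxAl mxE dvdp_mull.
have vDv : t ^+ 2 %| (C v *m D *m C v^T) 0 0.
  by rewrite Cv Cvt -scalemxAr -!scalemxAl mxE dvdp_mull // mxE dvdp_mull.
clearbody v; clear Cv Cvt u un uD uDu i1 ui1 ui0 min0.
have [H eH] : {H | H = shear i0 v} by eexists.
have uH : H \in unitmx by rewrite eH unitmx_shear.
have [D1 eD1] : {D1 | D1 = C H *m D *m (C H)^T} by eexists.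
have [V1 eV1] : {V1 | V1 = (C (invmx H))^T *m V} by eexists.
have CH1 : C (invmx H) *m C H = 1%:M by rewrite -map_mxM mulVmx // map_mx1.
have eQ1 : Q = V1^T *m D1 *m V1.
  rewrite eD1 eV1 trmx_mul trmxK !mulmxA -[V^T *m _ *m C H]mulmxA CH1 mulmx1.
  by rewrite -[_ *m (C H)^T *m _]mulmxA -trmx_mul CH1 trmx1 mulmx1.
have rH : C v = delta_mx 0 i0 *m C H.
  by rewrite -[v in LHS](shear_row i0) -eH map_mxM map_delta_mx.
have rD1 : row i0 D1 = C v *m D *m (C H)^T by rewrite eD1 rH rowE !mulmxA.
have D1i0 j : t %| D1 i0 j.
  have -> : D1 i0 j = (row i0 D1) 0 j by rewrite [RHS]mxE.
  by rewrite rD1 mxE; apply: dvdp_sumr => k _; rewrite dvdp_mulr // vD.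
have D1ii : t ^+ 2 %| D1 i0 i0.
  have -> : D1 i0 i0 = (C v *m D *m C v^T) 0 0.
    have -> : C v^T = (C H)^T *m delta_mx i0 0.
      by rewrite -[C v^T]map_trmx rH trmx_mul trmx_delta.
    by rewrite mulmxA -rD1 -colE !mxE.
  by [].
have symD1 : D1^T = D1 by rewrite eD1 !trmx_mul trmxK symD mulmxA.
have detD1 : \det D1 = (\det H)%:P ^+ 2 * \det D.
  by rewrite eD1 !det_mulmx det_tr det_map_mx /= mulrAC.
have H0 : \det H != 0 by rewrite -unitfE -unitmxE.
have gD1 : graded_gram d eta D1.
  apply/graded_gramP => i j k lt; rewrite eD1 mxE coef_sum big1 // => l _.
  rewrite !mxE mulr_suml coef_sum big1 // => m _.
  rewrite !mxE coefMC coefCM.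
  move/graded_gramP: gD => gD.
  have [->|Him] := eqVneq (H i m) 0; first by rewrite !mul0r.
  have [->|Hjl] := eqVneq (H j l) 0; first by rewrite mulr0.
  rewrite gD ?mulr0 ?mul0r //; apply: leq_trans lt _; rewrite leq_add2l leq_add //.
    move: Him; rewrite eH shearE; case: (_ =P i0) => [->|_]; first exact: vn.
    by case: (i =P m) => [->|]; rewrite ?eqxx.
  move: Hjl; rewrite eH shearE; case: (_ =P i0) => [->|_]; first exact: vn.
  by case: (j =P l) => [->|]; rewrite ?eqxx.
have iH : invmx H = 1%:M - delta_mx i0 0 *m (v - delta_mx 0 i0).
  by rewrite -[RHS](mulKmx uH) [in X in _ *m X]eH shear_inv // mulmx1.
have gV1 : graded_rows eta V1.
  move=> i j; rewrite eV1 mxE; apply: leq_trans (size_sum _ _ _) _.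
  apply/bigmax_leqP => k _; rewrite !mxE.
  have [->|ne] := eqVneq (invmx H k i) 0; first by rewrite mul0r size_poly0.
  apply: leq_trans (size_polyMleq _ _) _; rewrite size_polyC ne /=.
  apply: leq_trans (gV _ _) _; rewrite ltnS.
  move: ne; rewrite iH !mxE big_ord1 !mxE eqxx andbT /=.
  have [->|_] := eqVneq k i0; last first.
    by rewrite mul0r subr0; case: (k =P i) => [->|]; rewrite ?eqxx.
  rewrite mul1r opprB addrA [_ == i]eq_sym; case: (i =P i0) => [-> //|_].
  by rewrite addr0 sub0r oppr_eq0 => /vn.
have t0 : t != 0 by rewrite polyXsubC_eq0.
pose e i : nat := (i == i0).
(* Each index equal to [i0] carries one factor t, so D1 = diag D' diag; the diagonal factor moves
   into V and raises the bound of row [i0] by one. *)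
pose D' : 'M[{poly F}]_r := \matrix_(i, j) (D1 i j %/ t ^+ (e i + e j)).
have eD' i j : D1 i j = t ^+ (e i + e j) * D' i j.
  rewrite mxE mulrC divpK // /e.
  case: (i =P i0) => [->|_]; case: (j =P i0) => [->|_]; rewrite ?addn0 ?add0n.
  - exact: D1ii.
  - by rewrite expr1.
  - by rewrite -symD1 mxE expr1.
  - by rewrite expr0 dvd1p.
have symD' : D'^T = D'.
  by apply/matrixP => i j; rewrite !mxE addnC -[in LHS]symD1 mxE.
clearbody D'.
have eD1' : D1 = rowdiag i0 t *m D' *m rowdiag i0 t.
  by apply/matrixP => i j; rewrite mul_mx_diag mul_diag_mx !mxE -/(e i) -/(e j) eD' exprD mulrAC.
exists (fun i => eta i + (i == i0))%N, (rowdiag i0 t *m V1), D'; split; last first.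
  rewrite big_split /= -[in RHS]addn1; congr (_ + _)%N.
  by rewrite (bigD1 i0) //= eqxx big1 // => i /negPf; rewrite -val_eqE /= => ->.
have tt : (rowdiag i0 t)^T = rowdiag i0 t by rewrite tr_diag_mx.
split.
- move=> i j; rewrite mul_diag_mx !mxE; apply: leq_trans (size_polyMleq _ _) _.
  by rewrite size_exp_XsubC addSn /= addnC -addSn leq_add ?gV1.
- move=> i j; have [->|D'n] := eqVneq (D' i j) 0; [by left|right].
  have [D1z|] := gD1 i j.
    by move/eqP: (eD' i j); rewrite D1z eq_sym mulf_eq0 expf_eq0 (negPf t0) andbF (negPf D'n).
  rewrite eD' size_proper_mul ?mulf_neq0 ?lead_coef_eq0 ?expf_neq0 //.
  rewrite size_exp_XsubC addSn /=; have ve (k : 'I_r) : ((k == i0 :> nat) : nat) = e k by [].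
  rewrite !ve; move: (size _) (e i) (e j) (eta i) (eta j) => s ei ej a b; clear; lia.
- exact: symD'.
- have : \det D1 != 0 by rewrite detD1 mulf_neq0 // expf_neq0 // polyC_eq0.
  by rewrite eD1' !det_mulmx !mulf_eq0 !negb_or => /andP[/andP[]].
by rewrite eQ1 eD1' trmx_mul tt !mulmxA.
Qed.

Lemma graded_fact_rev d n (Q : 'M[{poly F}]_n) r eta (V : 'M_(r, n)) D :
    (forall i j, size (Q i j) <= d.+1)%N -> graded_fact d Q eta V D ->
  graded_fact d (rev_sym d Q) eta (rev_rows eta V) (rev_gram d eta D).
Proof.
move=> sQ [gV gD symD D0 eQ]; split.
- exact: graded_rev_rows.
- exact: graded_rev_gram.
- by rewrite tr_rev_gram symD.
- by case: (rev_gram_det gD D0).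
exact: rev_fact.
Qed.

Lemma rev_symK d n (Q : 'M[{poly F}]_n) : (forall i j, size (Q i j) <= d.+1)%N ->
  rev_sym d (rev_sym d Q) = Q.
Proof. by move=> sQ; apply/matrixP => i j; rewrite !mxE revpK. Qed.

Lemma graded_fact_sum_le d n (Q : 'M[{poly F}]_n) r eta (V : 'M_(r, n)) D :
  graded_fact d Q eta V D -> (2 * (\sum_(i < r) eta i) <= r * d)%N.
Proof.
by case=> _ gD _ /(rev_gram_det gD)[_ <-] _; rewrite -addnA leq_addr.
Qed.

(** Squarefreeness of det D as a binary form of degree r d - 2 a; the second condition is the one at
    infinity. *)
Definition squarefree_gram d r eta (D : 'M[{poly F}]_r) :=
  (forall mu, (mup mu (\det D) <= 1)%N) /\ (mup 0 (\det (rev_gram d eta D)) <= 1)%N.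

(** The sum of [eta] is bounded by r d / 2, so a factorization with maximal sum exists, and
    [graded_fact_step] cannot apply to it. *)
Lemma graded_fact_squarefree d n (Q : 'M[{poly F}]_n) r :
    (forall i j, size (Q i j) <= d.+1)%N ->
    (exists eta (V : 'M_(r, n)) D, graded_fact d Q eta V D) ->
  exists eta (V : 'M_(r, n)) D, graded_fact d Q eta V D /\ squarefree_gram d eta D.
Proof.
move=> sQ [eta0 [V0 [D0 f0]]].
pose P k := exists eta (V : 'M_(r, n)) D, graded_fact d Q eta V D /\ (\sum_(i < r) eta i = k)%N.
have Pb k : `[< P k >] -> (k <= r * d)%N.
  move/asboolP => [eta [V [D [/graded_fact_sum_le le <-]]]].
  by apply: leq_trans le; rewrite leq_pmull.
have Pex : exists k, `[< P k >].
  by exists (\sum_(i < r) eta0 i)%N; apply/asboolP; exists eta0, V0, D0.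
have [k /asboolP [eta [V [D [f sk]]]] kmax] := ex_maxnP Pex Pb.
exists eta, V, D; split=> //; have [gV gD symD D1 eQ] := f.
have no eta' V' D' : graded_fact (r := r) d Q eta' V' D' ->
    (\sum_(i < r) eta' i)%N = (\sum_(i < r) eta i).+1 -> False.
  move=> f' s'; have /kmax : `[< P k.+1 >] by apply/asboolP; exists eta', V', D'; rewrite s' sk.
  by rewrite ltnn.
split.
  move=> mu; rewrite mup_leq //; apply/negP => /(graded_fact_step f)[eta' [V' [D' [f' s']]]].
  exact: no f' s'.
(* A double root at infinity is one at 0 for the reversal; the improved factorization is reversed
   back with its [eta']. *)
have fr := graded_fact_rev sQ f; have [_ _ _ Dr0 _] := fr.
rewrite mup_leq //; apply/negP => /(graded_fact_step fr)[eta' [V' [D' [f' s']]]].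
have := graded_fact_rev _ f'; rewrite rev_symK // => H; apply: no s'; apply: H.
by move=> i j; rewrite mxE size_revp.
Qed.

End GradedFactorization.

(** * Row reduction and existence of graded factorizations *)

Section RowReduction.
Variable F : numClosedFieldType.
Implicit Types p q : {poly F}.
Local Notation C := (map_mx (@polyC F)).

Definition lead_rows r n (eta : nat -> nat) (V : 'M[{poly F}]_(r, n)) : 'M[F]_(r, n) :=
  \matrix_(i, j) (V i j)`_(eta i).

(** Predictable degree property: independent leading rows exclude cancellation of the highest terms
    of [x *m V]. The conclusion bounds the size of [x_k] by [e - eta k], phrased without a
    subtraction that could truncate. *)
Lemma predictable_degree r n eta (V : 'M[{poly F}]_(r, n)) (x : 'rV[{poly F}]_r) e :
    graded_rows eta V -> row_free (lead_rows eta V) ->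
    (forall j, size ((x *m V) 0%R j) <= e)%N ->
  forall (k : 'I_r) l, (e <= l + eta k)%N -> (x 0 k)`_l = 0.
Proof.
move=> gV fL sx.
pose B := (\max_(k < r) (size (x 0%R k) + eta k))%N.
(* Descending induction on the total degree N: beyond B all coefficients vanish, and at level N the
   coefficients of [x_k] at [N - eta k] form a vector killed by the leading matrix. *)
suff H m N : (e <= N)%N -> (B <= N + m)%N -> forall (k : 'I_r) l, (l + eta k)%N = N -> (x 0 k)`_l = 0.
  by move=> k l lt; apply: (H B (l + eta k)%N); rewrite ?leq_addl.
elim: m N => [|m IH] N eN BN k l lk.
  rewrite addn0 in BN; rewrite nth_default //.
  rewrite -(leq_add2r (eta k)) lk; apply: leq_trans BN.
  by rewrite /B (bigD1 k) //= leq_max leqnn.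
pose y := \row_k (if (eta k <= N)%N then (x 0 k)`_(N - eta k) else 0).
have : y = 0.
  apply: (row_free_inj fL); rewrite mul0mx; apply/rowP => j; rewrite mxE [RHS]mxE.
  have xN : ((x *m V) 0 j)`_N = 0 by rewrite nth_default // (leq_trans (sx j)).
  rewrite -[RHS]xN.
  rewrite [(x *m V) 0 j]mxE coef_sum; apply: eq_bigr => i _; rewrite !mxE coefM.
  case: leqP => [le|gt]; last first.
    rewrite mul0r big1 // => a _; have [->|] := eqVneq (V i j)`_(N - a) 0; first by rewrite mulr0.
    move=> _; rewrite (IH (a + eta i)%N) ?mul0r //.
      by apply: leq_trans eN _; rewrite (leq_trans (ltnW gt)) ?leq_addl.
    by apply: leq_trans BN _; rewrite addnS -addSn leq_add2r (leq_trans gt) ?leq_addl.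
  have ltn : (N - eta i < N.+1)%N by rewrite ltnS leq_subr.
  rewrite (bigD1 (Ordinal ltn)) //= subKn // big1 ?addr0 // => a na.
  have [lt|ge] := ltnP (a + eta i) N.
    rewrite (nth_default _ (s := V i j)) ?mulr0 //; apply: leq_trans (gV i j) _.
    by rewrite ltn_subRL.
  rewrite (IH (a + eta i)%N) ?mul0r ?(leq_trans eN) //.
  apply: leq_trans BN _; rewrite addnS -addSn leq_add2r ltn_neqAle ge andbT.
  apply: contra_neq na => eqN; by apply/val_inj => /=; move: (nat_of_ord a) eqN => a'; lia.
by move/rowP/(_ k); rewrite !mxE -lk leq_addl addnK.
Qed.

(* As graded_fact, before any degree bound on D; the rows of V are independent. *)
Definition gram_fact n (Q : 'M[{poly F}]_n) r eta (V : 'M[{poly F}]_(r, n)) (D : 'M[{poly F}]_r) :=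
  [/\ graded_rows eta V, forall x : 'rV_r, x *m V = 0 -> x = 0, D^T = D,
    \det D != 0 & Q = V^T *m D *m V].

(* A constant dependency between the leading rows lowers the degree of one row. *)
Lemma gram_fact_reduce n (Q : 'M[{poly F}]_n) r eta (V : 'M_(r, n)) D :
    gram_fact Q eta V D -> ~~ row_free (lead_rows eta V) ->
  exists eta' V' D', gram_fact (r := r) Q eta' V' D' /\
    (\sum_(i < r) eta' i < \sum_(i < r) eta i)%N.
Proof.
move=> [gV iV symD D0 eQ] nf.
have [u u0 uL] : exists2 u : 'rV_r, u != 0 & u *m lead_rows eta V = 0.
  by move: nf; rewrite -kermx_eq0 => /rowV0Pn[u /sub_kermxP]; exists u.
have [i1 ui1] : exists i, u 0 i != 0 by apply/rV0Pn.
(* The row of largest degree in the dependency gets replaced: the powers ['X^(eta i0 - eta i)] lift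
   the other rows to its degree, and the terms of degree [eta i0] cancel. *)
case: (@arg_maxnP _ i1 (fun i => u 0 i != 0) (fun i : 'I_r => eta i) ui1) => i0 ui0 max0.
pose v : 'rV[{poly F}]_r := \row_i (((u 0 i0)^-1 * u 0 i)%:P * 'X^(eta i0 - eta i)).
have v1 : v 0 i0 = 1 by rewrite mxE mulVf // subnn expr0 mulr1.
have vVs j : (size ((v *m V) 0%R j) <= eta i0)%N.
  apply/leq_sizeP => k le; rewrite mxE coef_sum.
  have [lt|eq] := ltnP (eta i0) k.
    apply: big1 => i _; rewrite mxE -mulrA coefCM coefXnM.
    have [->|ui] := eqVneq (u 0 i) 0; first by rewrite mulr0 mul0r.
    case: ltnP => ?; first by rewrite mulr0.
    rewrite nth_default ?mulr0 //; apply: leq_trans (gV i j) _.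
    by have := max0 _ ui; lia.
  have -> : k = eta i0 by apply/eqP; rewrite eqn_leq le eq.
  move/rowP/(_ j): uL; rewrite mxE [RHS]mxE => uL.
  transitivity ((u 0 i0)^-1 * (\sum_k u 0 k * lead_rows eta V k j)); last by rewrite uL mulr0.
  rewrite mulr_sumr; apply: eq_bigr => i _.
  rewrite !mxE -!mulrA coefCM coefXnM -mulrA; congr (_ * _).
  have [->|ui] := eqVneq (u 0 i) 0; first by rewrite !mul0r.
  by rewrite ltnNge leq_subr /= subKn //; exact: max0.
have [H eH] : {H | H = shear i0 v} by eexists.
have uH : H \in unitmx by rewrite eH unitmx_shear.
have rH : row i0 H = v by rewrite eH rowE shear_row.
(* If [eta i0] were 0, the bound [vVs] would give v V = 0 with v nonzero; so the predecessor below
   is a genuine decrease. *)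
have e0 : (0 < eta i0)%N.
  rewrite lt0n; apply/eqP => e0; have : v = 0.
    apply: iV; apply/rowP => j; rewrite [RHS]mxE; apply/eqP.
    by rewrite -size_poly_eq0 -leqn0 (leq_trans (vVs j)) ?e0.
  by move/rowP/(_ i0); rewrite v1 mxE => /eqP; rewrite oner_eq0.
exists (fun i => if i == i0 :> nat then (eta i0).-1 else eta i), (H *m V),
  ((invmx H)^T *m D *m invmx H); split; last first.
  rewrite (bigD1 i0) //= [X in (_ < X)%N](bigD1 i0) //= eqxx.
  rewrite -[X in (_ < X + _)%N](prednK e0) addSn ltnS leq_add2l.
  apply: leq_sum => i /negPf; rewrite -val_eqE /= => ->; exact: leqnn.
split.
- move=> i j; have -> : (H *m V) i j = (row i H *m V) 0 j by rewrite -row_mul [RHS]mxE.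
  case: (i =P i0) => [->|ni]; first by rewrite rH eqxx prednK.
  have -> : row i H = delta_mx 0 i.
    by apply/rowP => k; rewrite mxE eH shearE; case: eqP => // _; rewrite mxE eqxx eq_sym.
  rewrite -rowE mxE; have -> : (i == i0 :> nat) = false by apply/eqP => /val_inj.
  exact: gV.
- move=> x; rewrite mulmxA => /iV /(congr1 (mulmx^~ (invmx H))).
  by rewrite mulmxK // mul0mx.
- by rewrite !trmx_mul trmxK symD mulmxA.
- rewrite !det_mulmx det_tr !mulf_neq0 //; 
  by have := uH; rewrite -unitmx_inv unitmxE; apply: contraL => /eqP ->; rewrite unitr0.
rewrite eQ trmx_mul !mulmxA -[V^T *m H^T *m _]mulmxA -trmx_mul mulVmx // trmx1 mulmx1.
by rewrite -[_ *m invmx H *m H]mulmxA mulVmx // mulmx1.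
Qed.

(** Starting from the Smith rows, minimizing the sum of row degrees makes the leading rows
    independent; the predictable degree property then converts the bound on Q into the bound on
    D. *)
Lemma graded_fact_ex d n (Q : 'M[{poly F}]_n) : Q^T = Q ->
    (forall i j, size (Q i j) <= d.+1)%N ->
  exists eta (V : 'M_(\rank (map_mx (@tofrac _) Q), n)) D, graded_fact d Q eta V D.
Proof.
move=> symQ sQ; have [s [sn mon _ eqv]] := smith_ex Q.
rewrite (smith_rank sn mon eqv); set r := size s.
have [Y [W [YW eQ dD]]] := smith_symm symQ sn mon eqv.
pose P k := exists eta (V : 'M_(r, n)) D, gram_fact Q eta V D /\ (\sum_(i < r) eta i = k)%N.
have [k0 Pk0] : exists k, P k.
  pose e0 := (\max_(i < r) \max_(j < n) size (Y i j))%N.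
  eexists; exists (fun _ => e0), Y, (W^T *m Q *m W); split; last by [].
  split=> //.
  - move=> i j; apply: leq_trans (leqnSn _); rewrite /e0 (bigD1 i) //= (bigD1 j) //=.
    by rewrite !leq_max leqnn.
  - by move=> x /(congr1 (mulmx^~ W)); rewrite -mulmxA YW mulmx1 mul0mx.
  - by rewrite !trmx_mul trmxK symQ mulmxA.
  - by rewrite -size_poly_eq0 (eqp_size dD) size_poly_eq0 prod_monic_neq0.
have [k /asboolP [eta [V [D [f sk]]]] kmin] := @ex_minnP (fun k => `[< P k >])
  (ex_intro _ k0 (asboolT Pk0)).
have fL : row_free (lead_rows eta V).
  apply/negPn/negP => /(gram_fact_reduce f)[eta' [V' [D' [f' lt]]]].
  suff : (k <= \sum_(i < r) eta' i)%N by rewrite leqNgt -sk lt.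
  by apply/kmin/asboolP; exists eta', V', D'.
have [gV iV symD D0 eQ'] := f.
exists eta, V, D; split=> //; apply/graded_gramP => i j k' lt.
(* Q = (V^T D) V bounds V^T D. By symmetry of D this is a bound on D V, and a second application
   bounds D. *)
have X1 a (b : 'I_r) l : (d < l + eta b)%N -> ((V^T *m D) a b)`_l = 0.
  move=> lt'; have -> : (V^T *m D) a b = (row a (V^T *m D)) 0 b by rewrite [RHS]mxE.
  apply: (predictable_degree gV fL) lt' => c.
  by rewrite -row_mul -eQ' mxE.
have -> : D i j = (row i D) 0 j by rewrite [RHS]mxE.
apply: (predictable_degree (e := (d.+1 - eta i)%N) gV fL); last by lia.
move=> c; apply/leq_sizeP => l le; rewrite -row_mul mxE.
have -> : (D *m V) i c = (V^T *m D) c i by rewrite -[in RHS]symD -trmx_mul [RHS]mxE.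
by apply: X1; lia.
Qed.
End RowReduction.

(** * Zigzag matrices *)

Section Zigzag.
Variable F : numClosedFieldType.
Implicit Types p q : {poly F}.

Lemma row_freeI m n (A : 'M[F]_(m, n)) : (forall u : 'rV_m, u *m A = 0 -> u = 0) -> row_free A.
Proof.
move=> H; rewrite -kermx_eq0; apply/rowV0P => u /sub_kermxP; exact: H.
Qed.

(* The conditions on the first column of V and on the first row of N carry the
   recursion that constructs zigzag pairs. *)
Definition zigzag r m n (eta eps : nat -> nat)
    (V : 'M[{poly F}]_(r, n)) (N : 'M[{poly F}]_(n, m)) : Prop :=
  [/\ [/\ graded_rows eta V, graded_rows eps N^T & V *m N = 0],
      forall x : 'cV_n, V *m x = 0 -> exists z, x = N *m z,
      row_free (lead_rows eps N^T),
      forall K (y : 'cV[{poly F}]_r), (forall i : 'I_m, eps i <= K)%N ->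
        (forall i, size (y i 0%R) <= K + eta i)%N ->
        exists2 x : 'cV[{poly F}]_n, (forall j, size (x j 0%R) <= K)%N & V *m x = y
    & (forall i (j : 'I_n), j = 0%N :> nat -> V i j = (i == 0%N :> nat)%:R) /\
      (forall (j : 'I_n) k, j = 0%N :> nat ->
         N j k = if k == 0%N :> nat then 'X^(eps k) else 0)].

(** One subtraction step, for [eta 0 <= eps 0]: V gains the row (1, -X^(eta 0), 0, ...), and [eps 0]
    decreases by [eta 0]. *)
Lemma zigzag_row r m n eta eps (V : 'M_(r, n.+1)) (N : 'M_(n.+1, m.+1)) :
    (eta 0 <= eps 0)%N ->
    zigzag (fun i => eta i.+1) (fun i => if i is 0 then eps 0 - eta 0 else eps i)%N V N ->
  zigzag eta eps
    (block_mx (1%:M : 'M_1) (- 'X^(eta 0%N) *: delta_mx 0 0) 0 V : 'M_(1 + r, 1 + n.+1))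
    (col_mx ('X^(eta 0%N) *: row 0 N) N : 'M_(1 + n.+1, m.+1)).
Proof.
set eps' := (X in zigzag _ X) => le [[gV gN VN] exN fN sV [V0 N0]].
have leps (k : nat) : (eps' k <= eps k)%N by case: k => //=; rewrite leq_subr.
have dx (x : 'cV_n.+1) : (- 'X^(eta 0%N) *: delta_mx 0 0 : 'rV_n.+1) *m x = (- 'X^(eta 0%N) * x 0 0)%:M.
  by apply/matrixP => i j; rewrite -scalemxAl -rowE !mxE !ord1.
split.
- split.
  + move=> i j; rewrite !mxE; case: splitP => i' ei; rewrite !mxE;
      case: splitP => j' ej; rewrite ?mxE.
    * by rewrite !ord1 size_poly1.
    * rewrite ei ord1 /=; case: (j' == 0); last by rewrite mulr0 size_poly0.
      by rewrite mulr1 size_polyN size_polyXn.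
    * by rewrite size_poly0.
    by rewrite ei; exact: gV.
  + move=> k j; rewrite !mxE; case: splitP => j' ej; rewrite ?mxE; last first.
      by have := gN k j'; rewrite mxE => /leq_trans; apply; rewrite ltnS leps.
    rewrite N0 //; case: (k =P 0%N :> nat) => [->|_]; last by rewrite mulr0 size_poly0.
    by rewrite -exprD subnKC // size_polyXn.
  + rewrite mul_block_col mul1mx mul0mx add0r VN -scalemxAl -rowE scaleNr subrr.
    by rewrite col_mx0.
- move=> x; rewrite -[x]vsubmxK mul_block_col mul1mx mul0mx add0r => e.
  have /eqP := congr1 usubmx e; have := congr1 dsubmx e.
  rewrite !col_mxKu !col_mxKd !linear0 => /exN[z ->].
  rewrite addr_eq0 -mulNmx -scaleNr opprK => /eqP ->; exists z.
  by rewrite mul_col_mx -!scalemxAl -!rowE row_mul.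
- apply: row_freeI => u uL.
  have u0 : u 0 0 = 0.
    move/rowP/(_ (lshift _ 0)): uL; rewrite mxE [RHS]mxE big_ord_recl big1 ?addr0.
      rewrite !mxE; case: splitP => [j _|k] //; rewrite !mxE N0 //= -exprD subnKC //.
      by rewrite coefXn eqxx mulr1.
    move=> k _; rewrite !mxE; case: splitP => [j _|j] //; rewrite !mxE N0 //=.
    by rewrite mulr0 coef0 mulr0.
  apply: (row_free_inj fN); rewrite mul0mx; apply/rowP => j; rewrite mxE [RHS]mxE.
  move/rowP/(_ (rshift 1 j)): uL; rewrite mxE [RHS]mxE => uL; rewrite -[RHS]uL.
  rewrite !big_ord_recl u0 !mul0r; congr (_ + _); apply: eq_bigr => k _.
  rewrite !mxE; case: splitP => [l /= el|l [el]]; first by have := ltn_ord l; rewrite -el ltnS leqn0.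
  by rewrite (_ : l = j) //; apply/val_inj.
- move=> K y eK sy.
  have eK' (i : 'I_m.+1) : (eps' i <= K)%N := leq_trans (leps i) (eK i).
  have [|x sx Vx] := sV K (dsubmx y) eK'.
    by move=> i; rewrite mxE; exact: sy (rshift 1 i).
  (* The new coordinate has to be [w], which may be too large. Subtracting q times the first kernel
     column, whose top entry is X^(eps 0), leaves the remainder of [w], of degree below
     [eps 0 <= K]. *)
  pose w := y 0 0 + 'X^(eta 0%N) * x 0 0.
  have sw : (size w <= K + eta 0%N)%N.
    apply: leq_trans (size_polyD _ _) _; rewrite geq_max (sy 0) /=.
    apply: leq_trans (size_polyMleq _ _) _; rewrite size_polyXn addSn /= addnC leq_add2r.
    exact: sx.
  have sX : size ('X^(eps 0%N) : {poly F}) = (eps 0%N).+1 by rewrite size_polyXn.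
  pose q := w %/ 'X^(eps 0%N).
  have sq : (size q + eps 0 <= K + eta 0)%N || (q == 0).
    have [->|q0] := eqVneq q 0; first by rewrite orbT.
    have qs : (0 < size q)%N by rewrite size_poly_gt0.
    move: qs; rewrite /q size_divp ?monic_neq0 ?monicXn // sX /= => qs.
    by rewrite orbF subnK // ltnW // -subn_gt0.
  exists (col_mx ((w %% 'X^(eps 0%N))%:M) (x - q *: col 0 N)).
    move=> j; rewrite mxE; case: splitP => [l _|l _]; rewrite !mxE ?ord1.
      by apply: leq_trans (eK 0); rewrite -ltnS -sX mulr1n ltn_modp monic_neq0 // monicXn.
    apply: leq_trans (size_polyD _ _) _; rewrite geq_max sx size_polyN.
    case/orP: sq => [sq|/eqP ->]; last by rewrite mul0r size_poly0.
    apply: leq_trans (size_polyMleq _ _) _.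
    have := gN 0 l; rewrite mxE /= => gN0; move: sq gN0 (eK 0).
    move: (size q) (size (N l 0)) => a b /=; clear -le; lia.
  rewrite mul_block_col mul1mx mul0mx add0r dx -[RHS]vsubmxK; congr col_mx; last first.
    have VN0 : V *m col 0 N = 0 by rewrite colE mulmxA VN mul0mx.
    by rewrite mulmxBr Vx -scalemxAr VN0 scaler0 subr0.
  apply/matrixP => i j; rewrite !ord1 !mxE !mulr1n N0 //=.
  have -> : y (lshift r 0) 0 = w - 'X^(eta 0%N) * x 0 0.
    by rewrite /w addrK; congr (y _ _); apply/val_inj.
  have ew : w = q * ('X^(eta 0%N) * 'X^(eps 0%N - eta 0%N)) + w %% 'X^(eps 0%N).
    by rewrite -exprD subnKC // -divp_eq.
  rewrite [in RHS]ew; move: (w %% _) (x 0 0) (q) 'X^(eta 0%N) 'X^(eps 0%N - eta 0%N).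
  by move=> a b c e f; ring.
split=> [i j j0|j k j0].
  rewrite mxE; case: splitP => i' ei; rewrite mxE; case: splitP => j' ej; rewrite ?mxE.
  - by rewrite !ord1 ei ord1.
  - by rewrite ej in j0.
  - by rewrite ei.
  by rewrite ej in j0.
rewrite mxE; case: splitP => j' ej; last by rewrite ej in j0.
rewrite !mxE N0 //; case: (k =P 0%N :> nat) => [->|_]; last by rewrite mulr0.
by rewrite -exprD subnKC.
Qed.

(** The opposite subtraction step, for [eps 0 <= eta 0]: the kernel gains the column (X^(eps 0),
    -e_0), since the first column of the smaller V is e_0. *)
Lemma zigzag_col r m n eta eps (V : 'M_(1 + r, n.+1)) (N : 'M_(n.+1, m)) :
    (eps 0 <= eta 0)%N ->
    zigzag (fun i => if i is 0 then eta 0 - eps 0 else eta i)%N (fun i => eps i.+1) V N ->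
  zigzag eta eps
    (block_mx (1%:M : 'M_1) ('X^(eps 0%N) *: usubmx V) 0 (dsubmx V) : 'M_(1 + r, 1 + n.+1))
    (block_mx ('X^(eps 0%N))%:M 0 (- delta_mx 0 0) N : 'M_(1 + n.+1, 1 + m)).
Proof.
set eta' := (X in zigzag X) => le [[gV gN VN] exN fN sV [V0 N0]].
have Vu : usubmx V *m N = 0 by rewrite mul_usub_mx VN linear0.
have Vd : dsubmx V *m N = 0 by rewrite mul_dsub_mx VN linear0.
have Vud : usubmx V *m delta_mx 0 (0 : 'I_1) = 1%:M.
  by apply/matrixP => i j; rewrite -colE !mxE V0 // !ord1.
have Vdd : dsubmx V *m delta_mx 0 (0 : 'I_1) = 0.
  by apply/matrixP => i j; rewrite -colE !mxE V0.
split.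
- split.
  + move=> i j; rewrite !mxE; case: splitP => i' ei; rewrite !mxE;
      case: splitP => j' ej; rewrite ?mxE.
    * by rewrite !ord1 size_poly1.
    * apply: leq_trans (size_polyMleq _ _) _; rewrite size_polyXn addSn /=.
      have := gV (lshift r i') j'; rewrite ei ord1 /= -(leq_add2l (eps 0%N)) addnS subnKC //.
    * by rewrite size_poly0.
    by rewrite ei; exact: gV (rshift 1 i') j'.
  + move=> k j; rewrite !mxE; case: splitP => j' ej; rewrite !mxE; case: splitP => k' ek; rewrite ?mxE.
    * by rewrite !ord1 ek ord1 size_polyXn.
    * by rewrite size_poly0.
    * by rewrite size_polyN; case: (_ && _); rewrite ?size_poly1 ?size_poly0.
    by have := gN k' j'; rewrite mxE ek.
  + rewrite mulmx_block !mul1mx !mul0mx !mulmxN Vdd -!scalemxAl Vu Vd Vud scalemx1.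
    by rewrite !scaler0 !addr0 oppr0 addr0 subrr block_mx0.
- move=> x; rewrite -[x]vsubmxK mul_block_col mul1mx mul0mx add0r => e.
  have /eqP := congr1 usubmx e; have := congr1 dsubmx e.
  rewrite !col_mxKu !col_mxKd !linear0; move: (usubmx x) (dsubmx x) => x0 x1 dV.
  rewrite addr_eq0 => /eqP ->.
  pose c := usubmx V *m x1.
  have [|z ez] := exN (x1 - delta_mx 0 0 *m c).
    rewrite -[V]vsubmxK mul_col_mx !mulmxBr dV !mulmxA Vdd Vud mul1mx !mul0mx !subrr.
    exact: col_mx0.
  exists (col_mx (- c) z); rewrite mul_block_col mul0mx addr0 mul_scalar_mx -scalemxAl scalerN.
  by rewrite mulmxN mulNmx opprK -ez addrC subrK.
- apply: row_freeI => u uL.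
  have u0 : u 0 0 = 0.
    move/rowP/(_ (lshift _ 0)): uL; rewrite mxE [RHS]mxE big_ord_recl big1 ?addr0.
      rewrite !mxE; case: splitP => [j _|k] //; rewrite mxE; case: splitP => // l _.
      by rewrite !mxE !ord1 mulr1n coefXn eqxx mulr1.
    move=> k _; rewrite !mxE; case: splitP => [j _|j] //; rewrite mxE; case: splitP => l.
      by rewrite ord1.
    by rewrite !mxE coef0 mulr0.
  suff : rsubmx u = 0.
    move=> ru; rewrite -[u]hsubmxK ru; apply/rowP => k; rewrite !mxE; case: splitP => l _.
      by rewrite mxE ord1 -[RHS]u0; congr (u _ _); apply/val_inj.
    by rewrite mxE.
  apply: (row_free_inj fN); rewrite mul0mx; apply/rowP => j; rewrite mxE [RHS]mxE.
  move/rowP/(_ (rshift 1 j)): uL; rewrite mxE [RHS]mxE => uL; rewrite -[RHS]uL.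
  rewrite big_ord_recl u0 !mul0r add0r; apply: eq_bigr => k _.
  rewrite !mxE; congr (u _ _ * _); first by apply/val_inj.
  case: splitP => [l /= el|l [el]]; first by have := ltn_ord l; rewrite -el ltnS leqn0.
  rewrite mxE; case: splitP => [l' /= el'|l' [el']].
    by have := ltn_ord l'; rewrite -el' ltnS leqn0.
  rewrite (_ : l = j) 1?(_ : l' = k) //; exact/val_inj.
- move=> K y eK sy.
  have sX : size ('X^(eps 0%N) : {poly F}) = (eps 0%N).+1 by rewrite size_polyXn.
  (* The remainder of the first entry becomes the new coordinate, and the quotient is the right-hand
     side handed to the smaller system. *)
  pose q := y 0 0 %/ 'X^(eps 0%N).
  have [i|i|x sx Vx] := sV K (col_mx q%:M (dsubmx y)).
  + exact: eK (rshift 1 i).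
  + rewrite mxE; case: splitP => j ej; rewrite mxE; last first.
      by rewrite ej; exact: sy (rshift 1 j).
    rewrite ej !ord1 mulr1n /q size_divp ?monic_neq0 ?monicXn // sX /=.
    by rewrite leq_subLR addnA [(_ + K)%N]addnC -addnA subnKC.
  exists (col_mx (y 0 0 %% 'X^(eps 0%N))%:M x).
    move=> j; rewrite mxE; case: splitP => [l _|l _]; rewrite ?mxE ?ord1 //.
    by apply: leq_trans (eK 0); rewrite -ltnS -sX mulr1n ltn_modp monic_neq0 // monicXn.
  rewrite mul_block_col mul1mx mul0mx add0r -scalemxAl mul_usub_mx mul_dsub_mx Vx.
  rewrite col_mxKu col_mxKd -[RHS]vsubmxK; congr col_mx.
  apply/matrixP => i j; rewrite !ord1 !mxE !mulr1n.
  have -> : y (lshift r 0) 0 = y 0 0 by congr (y _ _); apply/val_inj.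
  by rewrite [RHS](divp_eq _ 'X^(eps 0%N)) addrC mulrC.
split=> [i j j0|j k j0].
  rewrite mxE; case: splitP => i' ei; rewrite mxE; case: splitP => j' ej; rewrite ?mxE.
  - by rewrite !ord1 ei ord1.
  - by rewrite ej in j0.
  - by rewrite ei.
  by rewrite ej in j0.
rewrite mxE; case: splitP => j' ej; last by rewrite ej in j0.
rewrite mxE; case: splitP => k' ek; rewrite !mxE ek ?ord1 //= mulr1n.
Qed.

(** The two lists cut an interval of common length into pieces; removing the shorter of the two
    first pieces from both keeps the sums equal and shortens one list. *)
Lemma zigzag_ex r m (eta eps : nat -> nat) :
    (\sum_(i < r) eta i = \sum_(i < m) eps i)%N ->
  exists (V : 'M_(r, r + m)) (N : 'M_(r + m, m)), zigzag eta eps V N.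
Proof.
have [n] := ubnP (r + m); elim: n r m eta eps => // n IH [|r] m eta eps.
  move=> _; rewrite big_ord0 => /esym/eqP; rewrite sum_nat_eq0 => /forallP e0.
  have {}e0 (i : 'I_m) : eps i = 0%N by apply/eqP; exact: e0.
  exists 0, 1%:M; split.
  - split; first by case.
      by move=> i j; rewrite !mxE e0; case: (j == i); rewrite ?size_poly1 ?size_poly0.
    by rewrite mul0mx.
  - by move=> x _; exists x; rewrite mul1mx.
  - apply: row_freeI => u; rewrite (_ : lead_rows _ _ = 1%:M) ?mulmx1 //.
    by apply/matrixP => i j; rewrite !mxE e0 eq_sym; case: (_ == _); rewrite ?coef1 ?coef0.
  - move=> K y _ _; exists 0; first by move=> j; rewrite mxE size_poly0.
    by rewrite mul0mx; apply/matrixP => -[].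
  split=> [[]//|j k j0]; rewrite mxE e0 expr0 -val_eqE /= j0 eq_sym.
  by case: eqP.
case: m => [|m].
  rewrite big_ord0 => _ /eqP; rewrite sum_nat_eq0 => /forallP e0.
  have {}e0 (i : 'I_r.+1) : eta i = 0%N by apply/eqP; exact: e0.
  rewrite addn0; exists 1%:M, 0; split.
  - split; last by rewrite mulmx0.
      by move=> i j; rewrite mxE e0; case: (i == j); rewrite ?size_poly1 ?size_poly0.
    by case.
  - by move=> x; rewrite mul1mx => ->; exists 0; rewrite mul0mx.
  - by apply: row_freeI => u _; apply/rowP => -[].
  - move=> K y _ sy; exists y; last by rewrite mul1mx.
    by move=> j; rewrite (leq_trans (sy j)) // e0 addn0.
  split=> [i j j0|j []//]; by rewrite mxE -val_eqE /= j0.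
rewrite ltnS => lt es; have [le|/ltnW le] := leqP (eta 0%N) (eps 0%N).
  pose eps' i := if i is 0 then (eps 0 - eta 0)%N else eps i.
  have [||V [N z]] := IH r m.+1 (fun i => eta i.+1) eps'; first by rewrite addSn in lt.
    move: es; rewrite !big_ord_recl /=; move: (\sum_(i < r) _)%N (\sum_(i < m) _)%N; lia.
  move: V N z; rewrite addSn !addnS => V N z.
  by eexists; eexists; exact: (zigzag_row le z).
pose eta' i := if i is 0 then (eta 0 - eps 0)%N else eta i.
have [||V [N z]] := IH r.+1 m eta' (fun i => eps i.+1); first by rewrite addnS in lt.
  move: es; rewrite !big_ord_recl /=; move: (\sum_(i < r) _)%N (\sum_(i < m) _)%N; lia.
move: V N z; rewrite !addnS !addSn => V N z.
by eexists; eexists; exact: (zigzag_col le z).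
Qed.
End Zigzag.

(** * Generic matrices with balanced kernel *)

Section Generic.
Variable F : numClosedFieldType.
Local Notation C := (map_mx (@polyC F)).
Local Notation "A .at m" := (map_mx (horner_eval m) A) (at level 2, m at level 1).

Lemma at_mul m n p (A : 'M[{poly F}]_(m, n)) (B : 'M_(n, p)) t :
  (A *m B).at t = A.at t *m B.at t.
Proof. exact: map_mxM. Qed.

(** A right inverse S at [t0] turns full rank into the nonvanishing of the polynomial det(M S). *)
Lemma generic_row_free m n (M : 'M[{poly F}]_(m, n)) t0 :
    row_free (M.at t0) ->
  exists2 q : {poly F}, q.[t0] != 0 & forall t, q.[t] != 0 -> row_free (M.at t).
Proof.
move=> /row_freeP[S MS]; exists (\det (M *m C S)).
  have -> : (\det (M *m C S)).[t0] = \det ((M *m C S).at t0) by rewrite det_map_mx.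
  by rewrite at_mul map_polyC_at MS det1 oner_eq0.
move=> t; have -> : (\det (M *m C S)).[t] = \det ((M *m C S).at t) by rewrite det_map_mx.
rewrite at_mul map_polyC_at -unitfE -unitmxE => u; apply/row_freeP.
by exists (S *m invmx (M.at t *m S)); rewrite mulmxA mulmxV.
Qed.

Lemma generic_row_full m n (M : 'M[{poly F}]_(m, n)) t0 :
    row_full (M.at t0) ->
  exists2 q : {poly F}, q.[t0] != 0 & forall t, q.[t] != 0 -> row_full (M.at t).
Proof.
have tr t : row_full (M.at t) = row_free (M^T.at t).
  by rewrite /row_free -map_trmx mxrank_tr.
rewrite tr => /generic_row_free[q q0 H]; exists q => // t /H; by rewrite tr.
Qed.

(* Cramer's rule: S T is square with determinant 1 at t0. *)
Lemma generic_kernel m n (T : 'M[{poly F}]_(m, n)) t0 (xi0 : 'rV[F]_m) :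
    row_full (T.at t0) -> xi0 *m T.at t0 = 0 ->
  exists2 xi : 'rV[{poly F}]_m, xi *m T = 0 & xi.at t0 = xi0.
Proof.
move=> /row_fullP[S ST] k0; pose q := \det (C S *m T).
have q1 : q.[t0] = 1.
  have -> : q.[t0] = \det ((C S *m T).at t0) by rewrite det_map_mx.
  by rewrite at_mul map_polyC_at ST det1.
exists (q *: C xi0 - C xi0 *m T *m \adj (C S *m T) *m C S).
  rewrite mulmxBl -!mulmxA mul_adj_mx -/q mul_mx_scalar -scalemxAr -scalemxAl.
  by rewrite subrr.
rewrite map_mxB !at_mul map_polyC_at k0 !mul0mx subr0.
apply/matrixP => i j; rewrite !mxE /= /horner_eval hornerM hornerC q1 mul1r.
by [].
Qed.

Section Convolution.
Variables (r n k : nat) (eta : nat -> nat).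

Let X := ('I_n * 'I_k)%type.
Let Y := {i : 'I_r & 'I_(k + eta i)}.

(* The matrix of x |-> V x, from vectors of polynomials of size at most k. *)
Definition convmx (V : 'M[{poly F}]_(r, n)) : 'M[F]_(#|{: X}|, #|{: Y}|) :=
  \matrix_(u < #|{: X}|, v < #|{: Y}|)
    ('X^((enum_val u).2) * V (tag (enum_val v)) (enum_val u).1)`_(tagged (enum_val v)).

Definition poly_of_row (xi : 'rV[F]_#|{: X}|) : 'cV[{poly F}]_n :=
  \col_j \sum_(c < k) (xi 0 (enum_rank (j, c)))%:P * 'X^c.

Definition row_of_poly (x : 'cV[{poly F}]_n) : 'rV[F]_#|{: X}| :=
  \row_(u < #|{: X}|) (x (enum_val u).1 0)`_((enum_val u).2).

Lemma coef_poly_of_row xi j (c : 'I_k) :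
  (poly_of_row xi j 0)`_c = xi 0 (enum_rank (j, c)).
Proof.
rewrite mxE coef_sum (bigD1 c) //= coefCM coefXn eqxx mulr1 big1 ?addr0 // => e ne.
by rewrite coefCM coefXn eq_sym val_eqE (negPf ne) mulr0.
Qed.

Lemma size_poly_of_row xi j : (size (poly_of_row xi j 0%R) <= k)%N.
Proof.
rewrite mxE; apply: leq_trans (size_sum _ _ _) _; apply/bigmax_leqP => c _.
apply: leq_trans (size_polyMleq _ _) _; rewrite size_polyXn addnS /=.
by apply: leq_trans (ltn_ord c); rewrite -[c.+1]add1n leq_add2r size_polyC_leq1.
Qed.

Lemma row_of_polyK (x : 'cV[{poly F}]_n) : (forall j, size (x j 0%R) <= k)%N -> poly_of_row (row_of_poly x) = x.
Proof.
move=> sx; apply/matrixP => j i; rewrite ord1; apply/polyP => c.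
have [lt|ge] := ltnP c k; last first.
  by rewrite !nth_default // (leq_trans _ ge) // size_poly_of_row.
by rewrite (coef_poly_of_row _ _ (Ordinal lt)) mxE enum_rankK.
Qed.

Lemma poly_of_rowK xi : row_of_poly (poly_of_row xi) = xi.
Proof.
apply/rowP => u; rewrite mxE coef_poly_of_row; congr (xi _ _).
by rewrite -[RHS]enum_valK; congr enum_rank; case: (enum_val u).
Qed.

Lemma mul_convmx xi V (y : Y) :
  (xi *m convmx V) 0 (enum_rank y) = ((V *m poly_of_row xi) (tag y) 0)`_(tagged y).
Proof.
rewrite [LHS]mxE [in RHS]mxE coef_sum (reindex (enum_rank : X -> _)) /=; last first.
  by apply: onW_bij; exact: enum_rank_bij.
transitivity (\sum_(p : X) xi 0 (enum_rank (p.1, p.2)) * convmx V (enum_rank (p.1, p.2)) (enum_rank y)).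
  by apply: eq_bigr => -[].
rewrite -(pair_bigA _ (fun j c => xi 0 (enum_rank (j, c)) * convmx V (enum_rank (j, c)) (enum_rank y))).
apply: eq_bigr => j _; rewrite mxE mulr_sumr coef_sum; apply: eq_bigr => c _ /=.
by rewrite mxE !enum_rankK /= mulrCA coefCM [V _ _ * _]mulrC.
Qed.

Lemma size_mul_graded (V : 'M[{poly F}]_(r, n)) (x : 'cV[{poly F}]_n) i : graded_rows eta V ->
  (forall j, size (x j 0%R) <= k)%N -> (size ((V *m x) i 0%R) <= k + eta i)%N.
Proof.
move=> gV sx; rewrite mxE; apply: leq_trans (size_sum _ _ _) _; apply/bigmax_leqP => j _.
apply: leq_trans (size_polyMleq _ _) _; rewrite -subn1 leq_subLR add1n -addnS addnC.
by rewrite leq_add.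
Qed.

Lemma convmx_eq0 xi V : graded_rows eta V ->
  (xi *m convmx V == 0) = (V *m poly_of_row xi == 0).
Proof.
move=> gV; apply/eqP/eqP => [e|e].
  apply/matrixP => i o; rewrite ord1 [RHS]mxE; apply/polyP => b; rewrite coef0.
  have [lt|ge] := ltnP b (k + eta i); last first.
    rewrite nth_default // (leq_trans _ ge) // size_mul_graded // => j.
    exact: size_poly_of_row.
  have := mul_convmx xi V (Tagged (fun i : 'I_r => 'I_(k + eta i)) (Ordinal lt)).
  by rewrite e mxE /= => <-.
apply/rowP => v; rewrite -[v]enum_valK mul_convmx e !mxE coef0 //.
Qed.

Lemma row_free_convmxP V : graded_rows eta V ->
  reflect (forall x : 'cV[{poly F}]_n, (forall j, size (x j 0%R) <= k)%N -> V *m x = 0 -> x = 0)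
    (row_free (convmx V)).
Proof.
move=> gV; apply: (iffP idP) => [fr x sx Vx|H].
  have := convmx_eq0 (row_of_poly x) gV; rewrite row_of_polyK // Vx eqxx => /eqP e0.
  have r0 : row_of_poly x = 0 by apply: (row_free_inj fr); rewrite mul0mx.
  rewrite -(row_of_polyK sx) r0; apply/matrixP => i o; rewrite !mxE big1 // => c _.
  by rewrite mxE mul0r.
apply: row_freeI => xi /eqP; rewrite convmx_eq0 // => /eqP/H e.
rewrite -[xi]poly_of_rowK e; first by apply/rowP => u; rewrite !mxE coef0.
exact: size_poly_of_row.
Qed.

Lemma row_full_convmxP V : graded_rows eta V ->
  reflect (forall y : 'cV[{poly F}]_r, (forall i, size (y i 0%R) <= k + eta i)%N ->
      exists2 x : 'cV[{poly F}]_n, (forall j, size (x j 0%R) <= k)%N & V *m x = y)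
    (row_full (convmx V)).
Proof.
move=> gV; apply: (iffP idP) => [fu y sy|H].
  pose eta_y : 'rV[F]_#|{: Y}| := \row_(v < #|{: Y}|) (y (tag (enum_val v)) 0)`_(tagged (enum_val v)).
  have /submxP[xi exi] : (eta_y <= convmx V)%MS by rewrite submx_full.
  exists (poly_of_row xi); first exact: size_poly_of_row.
  apply/matrixP => i o; rewrite ord1; apply/polyP => b.
  have [lt|ge] := ltnP b (k + eta i); last first.
    rewrite !nth_default // (leq_trans _ ge) //.
    by apply: size_mul_graded => // j; exact: size_poly_of_row.
  have := mul_convmx xi V (Tagged (fun i : 'I_r => 'I_(k + eta i)) (Ordinal lt)).
  by rewrite -exi mxE enum_rankK /= => ->.
rewrite -sub1mx; apply/row_subP => v.
pose y : 'cV[{poly F}]_r := \col_i if i == tag (enum_val v) then 'X^(tagged (enum_val v)) else 0.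
have [|x sx Vx] := H y.
  move=> i; rewrite mxE; case: eqP => [->|_]; last by rewrite size_poly0.
  by rewrite size_polyXn ltn_ord.
apply/submxP; exists (row_of_poly x); apply/rowP => w; rewrite -[w]enum_valK mul_convmx.
rewrite row_of_polyK // Vx !mxE enum_valK -(inj_eq enum_val_inj).
case: (enum_val w) => i b /=; case: (enum_val v) => i' b' /=; rewrite -tag_eqE /tag_eq /=.
have [ii|] := eqVneq i' i; last by rewrite coef0.
by subst i'; rewrite tagged_asE coefXn val_eqE eq_sym.
Qed.
End Convolution.

Lemma convmxD r n k eta (V U : 'M[{poly F}]_(r, n)) t :
  convmx k eta (V + t%:P *: U) = convmx k eta V + t *: convmx k eta U.
Proof.
apply/matrixP => u v; rewrite !mxE mulrDr coefD; congr (_ + _).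
by rewrite mulrCA coefCM.
Qed.

Definition line r n (V V0 : 'M[{poly F}]_(r, n)) (t : F) := V + t%:P *: (V0 - V).

(** The convolution matrix is affine in V. The indeterminate here is the parameter t of the line,
    not lambda. *)
Definition convline r n k eta (V V0 : 'M[{poly F}]_(r, n)) :=
  C (convmx k eta V) + 'X *: C (convmx k eta (V0 - V)).

Lemma convlineE r n k eta (V V0 : 'M[{poly F}]_(r, n)) t :
  (convline k eta V V0).at t = convmx k eta (line V V0 t).
Proof.
rewrite convmxD; apply/matrixP => u v; rewrite !(mxE map_mx_key) /= /horner_eval mxE.
by rewrite hornerD !mxE hornerM hornerX !hornerC.
Qed.

Lemma line1 r n (V V0 : 'M[{poly F}]_(r, n)) : line V V0 1 = V0.
Proof. by rewrite /line scale1r addrC subrK. Qed.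

Lemma graded_line r n eta (V V0 : 'M[{poly F}]_(r, n)) t :
  graded_rows eta V -> graded_rows eta V0 -> graded_rows eta (line V V0 t).
Proof.
move=> gV gV0 i j; rewrite !mxE; apply: leq_trans (size_polyD _ _) _.
rewrite geq_max gV /= mul_polyC; apply: leq_trans (size_scale_leq _ _) _.
by apply: leq_trans (size_polyD _ _) _; rewrite geq_max gV0 size_polyN gV.
Qed.

(* The third condition makes V primitive, also at infinity. *)
Definition balanced r n m (alpha : nat) (eta eps : nat -> nat) (V : 'M[{poly F}]_(r, n)) :=
  [/\ graded_rows eta V,
      forall x : 'cV[{poly F}]_n, (forall j, size (x j 0%R) <= alpha)%N -> V *m x = 0 -> x = 0,
      forall y : 'cV[{poly F}]_r, (forall i, size (y i 0%R) <= alpha.+1 + eta i)%N ->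
        exists2 x : 'cV[{poly F}]_n, (forall j, size (x j 0%R) <= alpha.+1)%N & V *m x = y
    & exists N : 'M[{poly F}]_(n, m),
        [/\ graded_rows eps N^T, V *m N = 0 & row_free (lead_rows eps N^T)]].

(** Every condition holds at t = 1, where the line meets the zigzag matrix, and is a full rank
    condition on matrices polynomial in t; the product of the three witnesses excludes the bad
    parameters. *)
Lemma balanced_line r n m alpha eta (eps : nat -> nat) (V V0 : 'M_(r, n)) (N : 'M_(n, m)) :
    (forall i : 'I_m, alpha <= eps i <= alpha.+1)%N ->
    zigzag eta eps V0 N -> graded_rows eta V ->
  exists2 q : {poly F}, q != 0 & forall t, q.[t] != 0 -> balanced m alpha eta eps (line V V0 t).
Proof.
move=> heps [[gV0 gN VN] exN fN sV _] gV.
have g t : graded_rows eta (line V V0 t) := graded_line t gV gV0.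
(* A kernel vector of degree below alpha is N z, and since every [eps k] is at least alpha, the
   predictable degree property forces z = 0. *)
have fr : row_free ((convline alpha eta V V0).at 1).
  rewrite convlineE line1; apply/(row_free_convmxP _ gV0) => x sx /exN[z ez].
  have ez' : x^T = z^T *m N^T by rewrite ez trmx_mul.
  suff z0 : z^T = 0 by rewrite ez -[z]trmxK z0 trmx0 mulmx0.
  apply/rowP => k; rewrite [RHS]mxE; apply/polyP => l; rewrite coef0.
  apply: (@predictable_degree _ _ _ eps N^T _ alpha gN fN).
    by move=> j; rewrite -ez' mxE.
  by have /andP[ae _] := heps k; rewrite (leq_trans ae) ?leq_addl.
have fu k : (alpha < k)%N -> row_full ((convline k eta V V0).at 1).
  move=> ak; rewrite convlineE line1; apply/(row_full_convmxP _ gV0) => y sy.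
  by apply: sV sy => i; have /andP[_ ae] := heps i; rewrite (leq_trans ae).
have [q1 q11 Q1] := generic_row_free fr.
have [q2 q21 Q2] := generic_row_full (fu _ (ltnSn alpha)).
(* Each kernel column is continued polynomially in t; the second component records its coefficient
   at [eps k], so that independence of the leading rows is again a condition on t. *)
have kerN (k : 'I_m) : exists Nl : (F -> 'cV[{poly F}]_n) * 'rV[{poly F}]_n,
    forall t, [/\ forall j, (size (Nl.1 t j 0%R) <= (eps k).+1)%N, line V V0 t *m Nl.1 t = 0,
      forall j, (Nl.1 t j 0)`_(eps k) = (Nl.2 0 j).[t]
      & forall j, (Nl.2 0 j).[1] = (N j k)`_(eps k)].
  have sN j : (size (col k N j 0%R) <= (eps k).+1)%N by have := gN k j; rewrite !mxE.
  have /eqP k0 : row_of_poly (eps k).+1 (col k N) *m convmx (eps k).+1 eta V0 == 0.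
    by rewrite convmx_eq0 // row_of_polyK // colE mulmxA VN mul0mx.
  have [||xi xiT xi1] := @generic_kernel _ _ (convline (eps k).+1 eta V V0) 1
    (row_of_poly (eps k).+1 (col k N)).
  - by apply: fu; have /andP[ae _] := heps k; rewrite ltnS.
  - by rewrite convlineE line1.
  exists (fun t => poly_of_row (xi.at t), \row_j xi 0 (enum_rank (j, ord_max))) => t /=.
  split.
  - by move=> j; exact: size_poly_of_row.
  - apply/eqP; rewrite -(convmx_eq0 _ (g t)) -convlineE -at_mul xiT; apply/eqP.
    by apply/matrixP => i j; rewrite !mxE /= /horner_eval horner0.
  - by move=> j; rewrite (coef_poly_of_row _ j ord_max) !mxE.
  move=> j; rewrite mxE; move/rowP/(_ (enum_rank (j, ord_max))): xi1; rewrite !mxE /= /horner_eval => ->.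
  by rewrite enum_rankK.
have [Nl NlP] := fin_all_exists kerN.
pose L := \matrix_(k < m, j < n) (Nl k).2 0 j.
have fL : row_free (L.at 1).
  have -> : L.at 1 = lead_rows eps N^T.
    by apply/matrixP => k j; rewrite !mxE /= /horner_eval; have [_ _ _ ->] := NlP k 1.
  by [].
have [q3 q31 Q3] := generic_row_free fL.
exists (q1 * q2 * q3).
  by apply/eqP => e; move/(congr1 (horner^~ 1)): e; rewrite !hornerM horner0 => /eqP;
    rewrite !mulf_eq0 (negPf q11) (negPf q21) (negPf q31).
move=> t; rewrite !hornerM !mulf_eq0 !negb_or => /andP[/andP[t1 t2] t3].
split=> //.
- by apply/(row_free_convmxP _ (g t)); rewrite -convlineE; exact: Q1.
- by apply/(row_full_convmxP _ (g t)); rewrite -convlineE; exact: Q2.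
exists (\matrix_(j, k) (Nl k).1 t j 0); split.
- by move=> k j; rewrite !mxE; have [] := NlP k t.
- apply/matrixP => i k; rewrite [RHS]mxE; have [_ /matrixP/(_ i 0) e _ _] := NlP k t.
  by rewrite mxE [RHS]mxE in e; rewrite mxE -[RHS]e; apply: eq_bigr => j _; congr (_ * _); rewrite mxE.
have -> : lead_rows eps (\matrix_(j, k) (Nl k).1 t j 0)^T = L.at t.
  by apply/matrixP => k j; rewrite !mxE /= /horner_eval; have [_ _ -> _] := NlP k t.
exact: Q3.
Qed.
End Generic.

(** * Rank, kernel and minimal indices of V^T D V for balanced V *)

Section Balanced.
Variable F : numClosedFieldType.
Local Notation C := (map_mx (@polyC F)).
Variables (r n m alpha : nat) (eta eps : nat -> nat) (V : 'M[{poly F}]_(r, n)).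
Hypothesis hV : balanced m alpha eta eps V.

Lemma balanced_right_inv : exists W : 'M_(n, r), V *m W = 1%:M.
Proof.
have [gV _ sV _] := hV.
have H (i : 'I_r) : exists x : 'cV[{poly F}]_n, V *m x = delta_mx i 0.
  have [|x _ Vx] := sV (delta_mx i 0); last by exists x.
  by move=> j; rewrite mxE; case: (_ && _); rewrite ?size_poly1 ?size_poly0.
have [x Vx] := fin_all_exists H.
exists (\matrix_(j, i) x i j 0); apply/matrixP => k i.
have /matrixP/(_ k 0) := Vx i; rewrite mxE [in X in _ = X]mxE eqxx andbT => e.
by rewrite [RHS]mxE mxE -e; apply: eq_bigr => j _; congr (_ * _); rewrite mxE.
Qed.

Lemma balanced_rev_right_inv : exists W : 'M_(n, r), rev_rows eta V *m W = 1%:M.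
Proof.
have [gV _ sV _] := hV.
(* Reversing a solution of degree at most alpha turns the right-hand side X^(alpha + eta i) into 1,
   because row k of V reverses in degree [eta k]. *)
have H (i : 'I_r) : exists x : 'cV[{poly F}]_n, (forall j, size (x j 0%R) <= alpha.+1)%N /\
    V *m x = 'X^(alpha + eta i) *: delta_mx i 0.
  have [|x sx Vx] := sV ('X^(alpha + eta i) *: delta_mx i 0); last by exists x.
  move=> j; rewrite !mxE; case: (j =P i) => [->|_] /=; last by rewrite mulr0 size_poly0.
  by rewrite mulr1 size_polyXn addSn.
have [x Vx] := fin_all_exists H.
exists (\matrix_(j, i) revp alpha (x i j 0)); apply/matrixP => k i.
have [sx /matrixP/(_ k 0) e] := Vx i; move: e; rewrite mxE => e.
apply: poly_eq_nonzero => t t0; rewrite mxE horner_sum.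
transitivity (t ^+ eta k * t ^+ alpha * (\sum_j V k j * x i j 0).[t^-1]).
  rewrite horner_sum mulr_sumr; apply: eq_bigr => j _.
  by rewrite !mxE !hornerM !horner_revp ?gV // mulrACA.
rewrite e !mxE eqxx andbT hornerM hornerXn; case: (k =P i) => [->|_].
  by rewrite hornerC mulr1 -exprD exprVn addnC mulfV ?expf_neq0 // mulr1n hornerC.
by rewrite !hornerC !mulr0.
Qed.

Hypothesis nrm : n = (r + m)%N.
Hypothesis sum_eps : (\sum_(k < m) eps k = \sum_(i < r) eta i)%N.
Variable D : 'M[{poly F}]_r.
Hypothesis D0 : \det D != 0.

Let Q := V^T *m D *m V.

Lemma tofrac_mx_inj p q : injective (@fracmx F p q).
Proof.
by move=> A B /matrixP e; apply/matrixP => i j; apply/eqP; rewrite -tofrac_eq;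
  have := e i j; rewrite !mxE => ->.
Qed.

Lemma balanced_rank : \rank (fracmx Q) = r.
Proof.
have [W VW] := balanced_right_inv.
have eD : D = W^T *m Q *m W.
  by rewrite /Q !mulmxA -trmx_mul VW trmx1 mul1mx -mulmxA VW mulmx1.
apply/eqP; rewrite eqn_leq; apply/andP; split.
  by rewrite /Q /fracmx map_mxM; apply: leq_trans (mxrankM_maxr _ _) (rank_leq_row _).
apply: (@leq_trans (\rank (fracmx D))); first by rewrite rank_frac_det.
rewrite eD /fracmx !map_mxM -/(fracmx Q).
move: (fracmx Q) (map_mx _ W^T) (map_mx _ W) => A B B'.
by apply: leq_trans (mxrankM_maxl _ _) (mxrankM_maxr _ _).
Qed.

Lemma balanced_kernel p (B : 'M[{poly F}]_(p, n)) :
  (fracmx B <= kermx (fracmx Q))%MS -> V *m B^T = 0.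
Proof.
have [W VW] := balanced_right_inv.
move=> /sub_kermxP; rewrite /fracmx -map_mxM => e.
have {e} : B *m Q = 0 by by apply: tofrac_mx_inj; rewrite /fracmx e map_mx0.
rewrite /Q !mulmxA => /(congr1 (mulmx^~ W)); rewrite -mulmxA VW mulmx1 mul0mx.
move=> /(congr1 (@fracmx _ _ _)); rewrite /fracmx map_mxM map_mx0 => e.
have uD : map_mx (@tofrac _) D \in unitmx by rewrite unitmxE det_map_mx unitfE tofrac_eq0.
have e' : B *m V^T = 0.
  by apply: tofrac_mx_inj; rewrite /fracmx map_mx0 -[LHS](mulmxK uD) e mul0mx.
by rewrite -[V]trmxK -trmx_mul e' trmx0.
Qed.

(** If S is a right inverse of the leading matrix, B S has identity leading matrix, hence nonzero
    determinant by the predictable degree property. *)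
Lemma row_free_frac p (B : 'M[{poly F}]_(p, n)) e :
  graded_rows e B -> row_free (lead_rows e B) -> row_free (fracmx B).
Proof.
move=> gB fB; have /row_freeP[S LS] := fB.
have d0 : \det (B *m C S) != 0.
  have gM : graded_rows e (B *m C S).
    move=> i j; rewrite mxE; apply: leq_trans (size_sum _ _ _) _; apply/bigmax_leqP => k _.
    apply: leq_trans (size_polyMleq _ _) _; rewrite mxE -subn1 leq_subLR addnC leq_add //.
    exact: size_polyC_leq1.
  have fM : row_free (lead_rows e (B *m C S)).
    have -> : lead_rows e (B *m C S) = 1%:M.
      rewrite -LS; apply/matrixP => i j; rewrite !mxE coef_sum; apply: eq_bigr => k _.
      by rewrite !mxE coefMC.
    by rewrite -row_leq_rank mxrank1.
  apply/negP => /det0P[x x0 xM]; case/negP: x0; apply/eqP/rowP => k; rewrite [RHS]mxE.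
  apply/polyP => l; rewrite coef0; apply: (@predictable_degree _ _ _ e _ _ 0%N gM fM) => //.
  by move=> j; rewrite xM mxE size_poly0.
have u : fracmx (B *m C S) \in unitmx by rewrite unitmxE det_map_mx unitfE tofrac_eq0.
apply/row_freeP; exists (map_mx (@tofrac _) (C S) *m invmx (fracmx (B *m C S))).
by rewrite mulmxA -map_mxM mulmxV.
Qed.

(** The rows of degree at most alpha give independent vectors in the kernel of the surjective
    convolution matrix of size alpha + 1, whose dimension is (n - r)(alpha + 1) minus the sum of
    [eta]. *)
Lemma balanced_low_rows p (B : 'M[{poly F}]_(p, n)) :
    row_free (fracmx B) -> V *m B^T = 0 ->
  (#|[set i | (row_degree B i <= alpha)%N]| <= m * alpha.+1 - \sum_(i < r) eta i)%N.
Proof.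
move=> fB VB; have [gV iV sV _] := hV; set I := [set i | _].
have indep (v : 'rV[F]_p) : C v *m B = 0 -> v = 0.
  move=> /(congr1 (@fracmx _ _ _)); rewrite /fracmx map_mxM map_mx0 => e.
  have {}e : map_mx (@tofrac _) (C v) = 0 by apply: (row_free_inj fB); rewrite mul0mx.
  have e' : C v = 0.
    by apply: tofrac_mx_inj; rewrite /fracmx e map_mx0.
  by apply/rowP => j; move/rowP/(_ j): e'; rewrite !mxE => /polyC_inj.
have sB (u : 'I_#|I|) j : (size (B (enum_val u) j) <= alpha.+1)%N.
  have := enum_valP u; rewrite inE /row_degree => h.
  apply: leq_trans (_ : \max_(j < n) size (B (enum_val u) j) <= _)%N.
    by rewrite (bigD1 j) //= leq_max leqnn.
  by rewrite -subn1 leq_subLR add1n in h.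
pose X := ('I_n * 'I_alpha.+1)%type.
pose Xi : 'M[F]_(#|I|, #|{: X}|) :=
  \matrix_(u, v) (B (enum_val u) (enum_val v : X).1)`_((enum_val v : X).2).
have rXi u : row u Xi = row_of_poly alpha.+1 (row (enum_val u) B)^T.
  by apply/rowP => v; rewrite !mxE.
have fXi : row_free Xi.
  apply: row_freeI => w wXi.
  pose P : 'M[F]_(#|I|, p) := rowsub enum_val 1%:M.
  have wP : w *m P = 0.
    apply: indep; rewrite map_mxM -mulmxA; apply/rowP => j; rewrite [RHS]mxE.
    apply/polyP => c; rewrite coef0.
    have -> : C P *m B = rowsub enum_val B.
      have -> : C P = rowsub enum_val 1%:M.
        by apply/matrixP => u i; rewrite !mxE /= rmorph_nat.
      by rewrite mul_rowsub_mx mul1mx.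
    rewrite mxE coef_sum; have [lt|ge] := ltnP c alpha.+1; last first.
      apply: big1 => u _; rewrite !mxE coefCM nth_default ?mulr0 //.
      by apply: leq_trans (sB u j) ge.
    move/rowP/(_ (enum_rank ((j, Ordinal lt) : X))): wXi; rewrite mxE [RHS]mxE => e.
    by rewrite -[RHS]e; apply: eq_bigr => u _; rewrite !mxE coefCM enum_rankK.
  apply/rowP => u; move/rowP/(_ (enum_val u)): wP; rewrite mxE [RHS]mxE (bigD1 u) //= big1.
    by rewrite !mxE eqxx mulr1 addr0 => ->.
  move=> u' nu; rewrite !mxE (inj_eq enum_val_inj) (negPf nu) mulr0 //.
have XiT : Xi *m convmx alpha.+1 eta V = 0.
  apply/row_matrixP => u; rewrite row_mul rXi row0; apply/eqP.
  rewrite convmx_eq0 // row_of_polyK; last by move=> j; rewrite !mxE.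
  by rewrite tr_row -[col _ _]/(_) colE mulmxA VB mul0mx.
have fT : row_full (convmx alpha.+1 eta V) by apply/row_full_convmxP.
have /mxrankS : (Xi <= kermx (convmx alpha.+1 eta V))%MS by apply/sub_kermxP.
rewrite (eqnP fXi) mxrank_ker (eqnP fT) card_prod !card_ord.
have -> : #|{: {i : 'I_r & 'I_(alpha.+1 + eta i)}}| = (r * alpha.+1 + \sum_(i < r) eta i)%N.
  rewrite card_tagged sumnE big_map big_enum /=.
  under eq_bigr do rewrite card_ord.
  by rewrite big_split /= sum_nat_const card_ord.
by rewrite nrm mulnDl subnDl.
Qed.

Lemma row_degree_lead p (B : 'M[{poly F}]_(p, n)) e i :
  graded_rows e B -> row_free (lead_rows e B) -> row_degree B i = e i.
Proof.
move=> gB fB; rewrite /row_degree.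
have le : (\max_(j < n) size (B i j) <= (e i).+1)%N by apply/bigmax_leqP => j _; exact: gB.
have [j Bij] : exists j, (B i j)`_(e i) != 0.
  have : row i (lead_rows e B) != 0.
    apply: contraTneq fB => r0; apply/negP => /row_free_inj inj.
    have /matrixP/(_ 0 i) : delta_mx 0 i = 0 :> 'rV[F]_p by apply: inj; rewrite -rowE r0 mul0mx.
    by rewrite !mxE !eqxx => /eqP; rewrite oner_eq0.
  by case/rV0Pn => j; rewrite !mxE; exists j.
have ge : (e i < size (B i j))%N by rewrite ltnNge; apply: contra Bij => le'; rewrite nth_default.
have /eqP -> // : \max_(j < n) size (B i j) == (e i).+1.
by rewrite eqn_leq le (leq_trans ge) // (bigD1 j) //= leq_max leqnn.
Qed.

(** In any basis all degrees are at least alpha, and [balanced_low_rows] limits how many equal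
    alpha. The resulting lower bound on the total degree is the sum of [eta], attained by N. *)
Lemma balanced_minimal_indices : (forall k : 'I_m, alpha <= eps k <= alpha.+1)%N ->
  minimal_indices (kermx (fracmx Q)) [seq eps (nat_of_ord k) | k <- enum 'I_m].
Proof.
move=> heps; have [gV iV _ [N [gN VN fN]]] := hV.
exists m, N^T; split; last first.
  apply/seq.permP => a; congr count; apply: eq_map => k.
  by rewrite (row_degree_lead k gN fN).
have rk : \rank (kermx (fracmx Q)) = m by rewrite mxrank_ker balanced_rank nrm addKn.
split.
  rewrite /poly_basis (row_free_frac gN fN) /=.
  have sub : (fracmx N^T <= kermx (fracmx Q))%MS.
    apply/sub_kermxP; rewrite /fracmx -map_mxM /Q !mulmxA -trmx_mul VN trmx0 !mul0mx.
    by rewrite map_mx0.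
  have [_ <-] := mxrank_leqif_eq sub; rewrite rk.
  by have /eqnP -> := row_free_frac gN fN.
move=> B /andP[fB /eqmxP eB].
have VB : V *m B^T = 0 by apply: balanced_kernel; rewrite eB.
have low := balanced_low_rows fB VB.
have ge i : (alpha <= row_degree B i)%N.
  rewrite leqNgt; apply/negP => lt.
  have : (row i B)^T = 0.
    apply: iV; last by rewrite tr_row colE mulmxA VB mul0mx.
    move=> j; rewrite !mxE; apply: leq_trans (_ : \max_(j < n) size (B i j) <= _)%N.
      by rewrite (bigD1 j) //= leq_max leqnn.
    by move: lt; rewrite /row_degree; case: (\max_(j < n) _)%N => //=.
  move=> /(congr1 trmx); rewrite trmxK trmx0 => r0.
  have /matrixP/(_ 0 i) : delta_mx 0 i = 0 :> 'rV[{fraction {poly F}}]_m.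
    by apply: (row_free_inj fB); rewrite mul0mx -rowE -map_row r0 map_mx0.
  by rewrite !mxE !eqxx => /eqP; rewrite oner_eq0.
have -> : (\sum_(i < m) row_degree N^T i = \sum_(i < r) eta i)%N.
  by rewrite -sum_eps; apply: eq_bigr => i _; rewrite (row_degree_lead i gN fN).
have : (\sum_(i < m) (alpha + (alpha < row_degree B i)) <= \sum_(i < m) row_degree B i)%N.
  by apply: leq_sum => i _; case: ltnP (ge i); rewrite ?addn1 ?addn0.
apply: leq_trans; rewrite big_split /= sum_nat_const card_ord.
have -> : (\sum_(i < m) (alpha < row_degree B i) = m - #|[set i | row_degree B i <= alpha]|)%N.
  rewrite -[X in (X - _)%N](card_ord m) -(cardsC [set i | row_degree B i <= alpha]%N) addKn.
  rewrite -sum1_card [RHS]big_mkcond; apply: eq_bigr => i _ /=.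
  by rewrite !inE -ltnNge; case: (_ < _)%N.
(* This keeps the subtraction in [low] from truncating. *)
have : (\sum_(i < r) eta i <= m * alpha.+1)%N.
  rewrite -sum_eps -[X in (_ <= X * _)%N](card_ord m) -sum_nat_const.
  by apply: leq_sum => i _; have /andP[] := heps i.
by move: low; move: #|_| (\sum_(i < r) _)%N; clear; nia.
Qed.
End Balanced.

(** * Eigenstructures *)

Section Multiplicity.
Variable F : closedFieldType.
Implicit Types p q : {poly F}.

Lemma mup_prod mu (s : seq {poly F}) : all (fun p => p \is monic) s ->
  mup mu (\prod_(p <- s) p) = sumn (exponents mu s).
Proof.
rewrite /exponents; elim: s => [|p s IH] /=.
  by rewrite big_nil mupNroot // rootE hornerC oner_eq0.
case/andP => mp ms; rewrite big_cons mupM ?prod_monic_neq0 ?monic_neq0 // IH //.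
by case: (mup mu p).
Qed.

Lemma eqp_mup mu p q : p != 0 -> p %= q -> mup mu p = mup mu q.
Proof.
move=> p0 e; have q0 : q != 0 by rewrite -size_poly_eq0 -(eqp_size e) size_poly_eq0.
apply/eqP; rewrite eqn_leq; apply/andP; split.
  by rewrite mup_geq // -(eqp_dvdr _ e) -mup_geq.
by rewrite mup_geq // (eqp_dvdr _ e) -mup_geq.
Qed.

Lemma mup_sqr mu p q : p != 0 -> q != 0 ->
  mup mu (p * q ^+ 2) = (mup mu p + 2 * mup mu q)%N.
Proof. by move=> p0 q0; rewrite expr2 !mupM ?mulf_neq0 //; lia. Qed.

Lemma squarefree_points p c : p != 0 -> (forall mu, mup mu p <= 1)%N -> (c <= 1)%N ->
  exists L : seq (option F), [/\ uniq L, size L = ((size p).-1 + c)%N,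
    forall mu, count_mem (Some mu) L = mup mu p & count_mem None L = c].
Proof.
move=> p0 sq c1; have [rs ep] := closed_field_poly_normal p.
have lp : lead_coef p != 0 by rewrite lead_coef_eq0.
have mp mu : mup mu p = count_mem mu rs.
  rewrite -mu_prod_XsubC; apply: eqp_mup => //; rewrite {1}ep.
  by rewrite eqp_scale.
have ur : uniq rs.
  by apply: count_mem_uniq => x; have := sq x; rewrite mp -has_pred1 has_count; case: count => [|[]].
exists ([seq Some mu | mu <- rs] ++ nseq c None); split.
- rewrite cat_uniq map_inj_uniq ?ur => [|x y [] //]; rewrite /= andbC.
  by case: c c1 => [|[]] //= _; rewrite orbF; apply/mapP => -[].
- rewrite size_cat size_map size_nseq ep size_scale // size_prod_XsubC //.
- move=> mu; rewrite count_cat count_map count_nseq mul0n addn0 mp.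
  by apply: eq_count => x /=; rewrite (inj_eq Some_inj).
by rewrite count_cat count_map count_nseq mul1n (eq_count (a2 := pred0)) ?count_pred0.
Qed.

Lemma sumn_pos_le1 (e : seq nat) c : (c <= 1)%N -> all (fun k => 0 < k)%N e -> sumn e = c ->
  e = nseq c 1%N.
Proof.
by case: e c => [|x [|y e]] [|[|c]] //= _; case: x => [|[|x]] //=; case: y => [|y] //=; rewrite ?addSn ?addnS.
Qed.

End Multiplicity.

(** * Total multiplicities and their parity *)

Section OddPoints.
Variable F : eqType.
Implicit Types E : eigenstructure F.

Definition osum E (x : option F) := sumn [seq y.2 | y <- eldivs E & y.1 == x].

(** Their number is unchanged by renaming eigenvalues, and through [odd_points_count] it determines
    the sum of [eta]. *)
Definition odd_points E := [seq x <- undup [seq y.1 | y <- eldivs E] | odd (osum E x)].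

Lemma osum_notin E x : x \notin [seq y.1 | y <- eldivs E] -> osum E x = 0%N.
Proof.
move=> nx; rewrite /osum (eq_in_filter (a2 := pred0)) ?filter_pred0 //.
move=> y yE /=; apply/negbTE; apply: contraNneq nx => <-; exact: map_f.
Qed.

Lemma mem_odd_points E x : (x \in odd_points E) = odd (osum E x).
Proof.
rewrite mem_filter mem_undup; case: (boolP (x \in _)) => [_|/osum_notin ->]; by rewrite ?andbT.
Qed.

Lemma odd_points_uniq E : uniq (odd_points E).
Proof. by rewrite filter_uniq ?undup_uniq. Qed.

Lemma osum_map E E' f : {in [seq x.1 | x <- eldivs E] &, injective f} ->
    perm_eq (eldivs E') [seq (f x.1, x.2) | x <- eldivs E] ->
  forall x, x \in [seq x.1 | x <- eldivs E] -> osum E' (f x) = osum E x.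
Proof.
move=> fi pE x xE; rewrite /osum.
have pe := perm_sumn (perm_map snd (perm_filter (fun y => y.1 == f x) pE)).
rewrite pe filter_map -map_comp; congr sumn.
rewrite -(eq_in_filter (a1 := fun y => y.1 == x)); first by [].
move=> y yE /=; apply/eqP/eqP => [-> //|]; apply: fi => //; exact: map_f.
Qed.

Lemma same_osum E E' : same_up_to_eigenvalues E E' ->
  forall x, osum E' x = 0%N \/ exists y, osum E' x = osum E y.
Proof.
move=> [[f fi pE] _ _] x.
have [xE|/osum_notin ->] := boolP (x \in [seq y.1 | y <- eldivs E']); last by left.
right; move: xE; rewrite (perm_mem (perm_map fst pE)) -map_comp => /mapP[y yE ->].
by exists y.1; apply: (osum_map fi pE); exact: map_f.
Qed.

Lemma same_odd_points E E' : same_up_to_eigenvalues E E' ->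
  size (odd_points E') = size (odd_points E).
Proof.
move=> [[f fi pE] _ _]; rewrite -[RHS](size_map f); apply/perm_size/uniq_perm.
- exact: odd_points_uniq.
- rewrite map_inj_in_uniq ?odd_points_uniq // => x y.
  by rewrite !mem_filter !mem_undup => /andP[_ xE] /andP[_ yE]; exact: fi.
move=> x; rewrite mem_odd_points; apply/idP/mapP => [o|[y]].
  have : x \in [seq y.1 | y <- eldivs E'].
    by apply: contraLR o => /osum_notin ->.
  rewrite (perm_mem (perm_map fst pE)) -map_comp => /mapP[y yE /= ex].
  have yE1 : y.1 \in [seq x.1 | x <- eldivs E] by exact: map_f.
  by exists y.1 => //; rewrite mem_odd_points -(osum_map fi pE yE1) -ex.
move=> yo ->; have yE : y \in [seq x.1 | x <- eldivs E].
  by move: yo; rewrite mem_filter mem_undup => /andP[].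
by rewrite (osum_map fi pE yE) -mem_odd_points.
Qed.

End OddPoints.

Section SymPol.
Variables (R : realType) (d n : nat).
Local Notation F := (R[i]).
Implicit Types P : sympol R d n.

Lemma coef_pmx P i j (k : 'I_d.+1) : (pmx P i j)`_k = P k i j.
Proof.
rewrite /pmx summxE coef_sum (bigD1 k) //= big1 => [|l nl].
  by rewrite !mxE coefXnM ltnn subnn coefC eqxx addr0.
rewrite !mxE mulrC coefCM coefXn eq_sym val_eqE (negPf nl) mulr0 //.
Qed.

Lemma size_pmx P i j : (size (pmx P i j) <= d.+1)%N.
Proof.
rewrite /pmx summxE; apply: leq_trans (size_sum _ _ _) _; apply/bigmax_leqP => k _.
rewrite !mxE; apply: leq_trans (size_polyMleq _ _) _; rewrite size_polyXn addSn /=.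
apply: leq_trans (ltn_ord k); rewrite -[k.+1]addn1 leq_add2l; exact: size_polyC_leq1.
Qed.

Lemma coefm_sym P k : (P k)^T = P k.
Proof. by have /forallP/(_ k)/eqP := valP P. Qed.

Lemma pmx_sym P : (pmx P)^T = pmx P.
Proof.
apply/matrixP => i j; rewrite mxE /pmx !summxE; apply: eq_bigr => k _.
by rewrite !mxE -{1}(coefm_sym P k) mxE.
Qed.

Lemma revmxE P : revmx P = rev_sym d (pmx P).
Proof.
apply/matrixP => i j; rewrite /revmx summxE mxE /revp; apply/polyP => c.
rewrite coef_sum coef_poly ltnS; case: leqP => [cd|dc].
  have lt : (d - c < d.+1)%N by rewrite ltnS leq_subr.
  rewrite (bigD1 (Ordinal lt)) //= (coef_pmx _ _ _ (Ordinal lt)) big1 => [|l nl].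
    by rewrite !mxE subKn // coefXnM ltnn subnn coefC eqxx addr0.
  rewrite !mxE mulrC coefCM coefXn; case: eqP => [e|_]; last by rewrite mulr0.
  case/eqP: nl; apply/val_inj => /=; rewrite e subKn // -ltnS //.
rewrite big1 // => l _; rewrite !mxE mulrC coefCM coefXn; case: eqP => [e|_]; last by rewrite mulr0.
by move: dc; rewrite e ltnNge leq_subr.
Qed.

Lemma sympol_of_mx (Q : 'M[{poly F}]_n) : Q^T = Q -> (forall i j, size (Q i j) <= d.+1)%N ->
  exists P, pmx P = Q.
Proof.
move=> sQ szQ.
pose c : {ffun 'I_d.+1 -> 'M[F]_n} := [ffun k : 'I_d.+1 => \matrix_(i, j) (Q i j)`_k].
have sc : [forall k, (c k)^T == c k].
  apply/forallP => k; apply/eqP/matrixP => i j; rewrite !ffunE !mxE.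
  by rewrite -[in LHS]sQ mxE.
exists (SymPol sc); apply/matrixP => i j; apply/polyP => k.
have [lt|ge] := ltnP k d.+1.
  by rewrite (coef_pmx (SymPol sc) i j (Ordinal lt)) /= ffunE mxE.
by rewrite !nth_default // (leq_trans _ ge) // size_pmx.
Qed.

Lemma revmx_sym P : (revmx P)^T = revmx P.
Proof. by rewrite revmxE; apply/matrixP => i j; rewrite !mxE -[in LHS]pmx_sym mxE. Qed.

End SymPol.

Lemma smith_formP (F : fieldType) n (A : 'M[{poly F}]_n) s : smith_form A s <->
  [/\ (size s <= n)%N, all (fun p => p \is monic) s,
      sorted (fun p q => p %| q) s & equivmx A (diag_seq n s)].
Proof.
by split=> -[sn mon so [U [W [uU uW e]]]]; split=> //; exists U, W.
Qed.

Lemma rank_fact (F : fieldType) n r (V : 'M[{poly F}]_(r, n)) D :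
  (\rank (fracmx (V^T *m D *m V)) <= r)%N.
Proof.
by rewrite /fracmx map_mxM; apply: leq_trans (mxrankM_maxr _ _) (rank_leq_row _).
Qed.

Section SmithMultiplicity.
Variables (F : numClosedFieldType) (n r : nat) (Q : 'M[{poly F}]_n) (s : seq {poly F}).
Variables (V : 'M[{poly F}]_(r, n)) (D : 'M[{poly F}]_r).
Hypotheses (symQ : Q^T = Q) (sm : smith_form Q s) (rQ : \rank (fracmx Q) = r).
Hypothesis eQ : Q = V^T *m D *m V.

Lemma smith_form_size : size s = r.
Proof. by case/smith_formP: sm => sn mon _ eqv; rewrite -rQ /fracmx (smith_rank sn mon). Qed.

Lemma smith_mup : exists W, forall mu,
  sumn (exponents mu s) = (mup mu (\det D) + 2 * mup mu (\det (V *m W)))%N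
  /\ \det (V *m W) != 0.
Proof.
have [sn mon _ eqv] := (smith_formP _ _).1 sm.
have [W eW] := smith_fact_symm symQ smith_form_size sn mon eqv eQ.
exists W => mu; have p0 := prod_monic_neq0 mon.
have : \det D * \det (V *m W) ^+ 2 != 0 by rewrite -size_poly_eq0 -(eqp_size eW) size_poly_eq0.
rewrite mulf_eq0 negb_or sqrf_eq0 => /andP[D0 VW0]; split=> //.
by rewrite -mup_prod // (eqp_mup _ p0 eW) mup_sqr.
Qed.

Lemma smith_mup_right_inv W mu : V *m W = 1%:M -> sumn (exponents mu s) = mup mu (\det D).
Proof.
have [sn mon _ eqv] := (smith_formP _ _).1 sm; move=> VW.
by rewrite -mup_prod // (eqp_mup _ (prod_monic_neq0 mon)
  (smith_fact_right_inv symQ smith_form_size sn mon eqv eQ VW)).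
Qed.
End SmithMultiplicity.

(** The number of minimal indices is the nullity; this makes the rank constant on a bundle. *)
Lemma size_minimal_indices (F : fieldType) n (A : 'M[{fraction {poly F}}]_n) e :
  minimal_indices (kermx A) e -> (size e + \rank A = n)%N.
Proof.
case=> k [B [[/andP[fB /eqmxP eB] _] pe]].
rewrite (perm_size pe) size_map size_enum_ord -(eqnP fB) eB mxrank_ker subnK //.
exact: rank_leq_row.
Qed.

Lemma filter_const_snd (T : eqType) (L : seq T) y :
  [seq x.2 | x <- [seq (x, 1%N) | x <- L] & x.1 == y] = nseq (count_mem y L) 1%N.
Proof. by elim: L => //= x L IH; case: (x == y) => /=; rewrite IH. Qed.

(** * Eigenstructure read off a graded factorization *)

Section Eigenstructure.
Variables (R : realType) (d n : nat).
Local Notation F := (R[i]).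
Implicit Types P K : sympol R d n.

Lemma size_left_indices P E : has_eigenstructure P E ->
  (size (left_indices E) + pol_rank P = n)%N.
Proof. by case=> _ _ /size_minimal_indices. Qed.

Lemma has_osum P E : has_eigenstructure P E ->
  (exists2 s, smith_form (pmx P) s & forall mu, osum E (Some mu) = sumn (exponents mu s)) /\
  (exists2 t, smith_form (revmx P) t & osum E None = sumn (exponents 0 t)).
Proof.
case=> [[s ss Hs] [t st Ht] _ _]; split; first by exists s => // mu; exact: perm_sumn (Hs mu).
by exists t => //; exact: perm_sumn Ht.
Qed.

(** Reversing the factorization bounds the rank of the reversal by r; factoring the reversal through
    its own rank and reversing back gives the other inequality. *)
Lemma rev_rank P r eta (V : 'M[{poly F}]_(r, n)) D :
  pol_rank P = r -> graded_fact d (pmx P) eta V D -> \rank (fracmx (revmx P)) = r.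
Proof.
move=> rP f; apply/eqP; rewrite eqn_leq; apply/andP; split.
  have [_ _ _ _ ->] : graded_fact d (revmx P) eta (rev_rows eta V) (rev_gram d eta D).
    by rewrite revmxE; apply: graded_fact_rev => // i j; exact: size_pmx.
  exact: rank_fact.
have : exists eta' (V' : 'M_(\rank (fracmx (revmx P)), n)) D', graded_fact d (revmx P) eta' V' D'.
  by apply: (graded_fact_ex (revmx_sym P)) => i j; rewrite revmxE mxE size_revp.
move: (\rank _) => k [eta' [V' [D' f']]].
have := graded_fact_rev _ f'; rewrite revmxE rev_symK; last by move=> i j; exact: size_pmx.
case; first by move=> i j; rewrite mxE size_revp.
by move=> _ _ _ _ eP; rewrite -rP /pol_rank eP; exact: rank_fact.
Qed.

Variables (P : sympol R d n) (r : nat) (eta : nat -> nat).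
Variables (V : 'M[{poly F}]_(r, n)) (D : 'M[{poly F}]_r).
Hypotheses (rP : pol_rank P = r) (fP : graded_fact d (pmx P) eta V D).
Hypothesis (sD : squarefree_gram d eta D).

Let fR : graded_fact d (revmx P) eta (rev_rows eta V) (rev_gram d eta D).
Proof. by rewrite revmxE; apply: graded_fact_rev => // i j; exact: size_pmx. Qed.

(** The square in [smith_mup] contributes an even amount at every point, so the odd points are
    exactly the roots of the squarefree form det D, infinity included. *)
Lemma odd_points_count E : has_eigenstructure P E ->
  (size (odd_points E) + 2 * (\sum_(i < r) eta i) = r * d)%N.
Proof.
move=> /has_osum[[s ss Es] [t st Et]].
have [gV gD symD D0 eQ] := fP; have [_ _ _ R0 eR] := fR; have [sq sqR] := sD.
have [W eW] := smith_mup (pmx_sym P) ss rP eQ.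
have [W' eW'] := smith_mup (revmx_sym P) st (rev_rank rP fP) eR.
have [L [uL sL mL mN]] := squarefree_points D0 sq sqR.
have -> : size (odd_points E) = size L.
  apply/perm_size/uniq_perm; rewrite ?odd_points_uniq // => x.
  rewrite mem_odd_points -has_pred1 has_count; case: x => [mu|].
    rewrite Es; have [-> _] := eW mu.
    by rewrite mL oddD mul2n odd_double addbF; have := sq mu; case: (mup mu _) => [|[]].
  rewrite Et; have [-> _] := eW' 0.
  by rewrite mN oddD mul2n odd_double addbF; move: sqR; case: (mup 0 _) => [|[]].
by have [_ <-] := rev_gram_det gD D0; rewrite sL addnC addnA.
Qed.

(** A common zero of the maximal minors of V would add at least 2 to the multiplicity there. *)
Lemma osum_le1_full E : has_eigenstructure P E -> (forall x, osum E x <= 1)%N ->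
  (forall mu, exists W, (\det (V *m W)).[mu] != 0) /\
  (exists W, (\det (rev_rows eta V *m W)).[0] != 0).
Proof.
move=> /has_osum[[s ss Es] [t st Et]] le1.
have [gV gD symD D0 eQ] := fP; have [_ _ _ R0 eR] := fR.
have nz (p : {poly F}) mu : p != 0 -> mup mu p = 0%N -> p.[mu] != 0.
  by move=> p0 m0; rewrite -[_ == 0]/(root p mu) -dvdp_XsubCl XsubC_dvd // m0.
have [W eW] := smith_mup (pmx_sym P) ss rP eQ.
have [W' eW'] := smith_mup (revmx_sym P) st (rev_rank rP fP) eR.
split=> [mu|].
  exists W; have [e v0] := eW mu; apply: nz => //.
  by have := le1 (Some mu); rewrite Es e; move: (mup _ _) (mup _ _); clear; lia.
exists W'; have [e v0] := eW' 0; apply: nz => //.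
by have := le1 None; rewrite Et e; move: (mup _ _) (mup _ _); clear; lia.
Qed.

(** Right inverses of V and of its reversal identify all multiplicities with those of det D. They
    are 0 or 1 with r d - 2 a points in total, as many as the eigenvalues of [K]. *)
Lemma generic_mem K m a : is_generic r a K ->
    n = (r + m)%N -> (0 < m)%N -> (\sum_(i < r) eta i = a)%N ->
    balanced m (a %/ m)%N eta (fun k => a %/ m + (k < a %% m))%N V ->
  sym_bundle K P.
Proof.
move=> [_ rK [mus [umus smus hK]]] nrm m0 sa hV.
have [gV gD symD D0 eQ] := fP; have [_ _ _ R0 eR] := fR; have [sq sqR] := sD.
set eps := (fun k => _) in hV.
have heps (k : 'I_m) : (a %/ m <= eps k <= (a %/ m).+1)%N.
  by rewrite /eps; case: (_ < _)%N; rewrite ?addn0 ?addn1 ?leqnn ?leqnSn.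
have idxE : [seq eps (nat_of_ord k) | k <- enum 'I_m] =
    nseq (a %% m)%N (a %/ m)%N.+1 ++ nseq (m - a %% m)%N (a %/ m)%N.
  have lt := ltn_pmod a m0.
  rewrite [LHS](map_comp eps) val_enum_ord -{1}(subnKC (ltnW lt)) iotaD map_cat add0n.
  have mapc f c k l : {in iota k l, forall i, f i = c} -> map f (iota k l) = nseq l c :> seq nat.
    by move=> /eq_in_map ->; elim: l k => //= l IH k; rewrite IH.
  congr (_ ++ _); apply: mapc => i; rewrite mem_iota /eps.
    by move=> /= ->; rewrite addn1.
  by case/andP; rewrite leqNgt => /negPf -> _; rewrite addn0.
have sum_eps : (\sum_(k < m) eps k = \sum_(i < r) eta i)%N.
  have lt := ltn_pmod a m0.
  rewrite sa -big_enum /= -[LHS](big_map (fun k : 'I_m => eps k) xpredT id) /= idxE.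
  rewrite big_cat !big_nseq !iter_addn_0 /=.
  have := divn_eq a m; move: (a %/ m)%N (a %% m)%N lt => q s lt ->; move: lt; clear.
  nia.
have mi : minimal_indices (kermx (fracmx (pmx P))) (nseq (a %% m)%N (a %/ m)%N.+1 ++ nseq (m - a %% m)%N (a %/ m)%N).
  by rewrite -idxE eQ; exact: (balanced_minimal_indices hV nrm sum_eps D0 heps).
have [L [uL sL mL mN]] := squarefree_points D0 sq sqR.
exists (generic_eigenstructure n r a mus).
have nr : (n - r = m)%N by rewrite nrm addKn.
pose E' := Eigenstructure [seq (x, 1%N) | x <- L]
  (left_indices (generic_eigenstructure n r a mus)) (right_indices (generic_eigenstructure n r a mus)).
exists E'; split; first exact: hK.
  split.
  - have [s /smith_formP smf] := smith_ex (pmx P).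
    exists s; first exact: smf.
    move=> mu; have [W' VW'] := balanced_right_inv hV.
    have -> : exponents mu s = nseq (mup mu (\det D)) 1%N := sumn_pos_le1 (sq mu) (filter_all _ _)
      (smith_mup_right_inv (pmx_sym P) smf rP eQ mu VW').
    by rewrite /= filter_const_snd mL.
  - have [s /smith_formP smf] := smith_ex (revmx P).
    exists s; first exact: smf.
    have [W' VW'] := balanced_rev_right_inv hV.
    have -> : exponents 0 s = nseq (mup 0 (\det (rev_gram d eta D))) 1%N := sumn_pos_le1 sqR (filter_all _ _)
      (smith_mup_right_inv (revmx_sym P) smf (rev_rank rP fP) eR 0 VW').
    by rewrite /= filter_const_snd mN.
  - by rewrite /= nr.
  have -> : (fracmx (pmx P))^T = fracmx (pmx P) by rewrite /fracmx map_trmx pmx_sym.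
  by rewrite /= nr.
split; [|exact: perm_refl|exact: perm_refl].
set pts := [seq Some mu | mu <- mus].
have upts : uniq pts by rewrite map_inj_uniq // => x y [].
have spts : size pts = size L.
  rewrite size_map smus sL -sa; have [_ <-] := rev_gram_det gD D0.
  by rewrite -addnA addKn.
(* The i-th eigenvalue of [K] goes to the i-th root of det D, which may be infinity. *)
pose f x := nth None L (index x pts).
have fE : [seq f x | x <- pts] = L.
  apply: (@eq_from_nth _ None); first by rewrite size_map spts.
  move=> i; rewrite size_map => lti.
  by rewrite (nth_map None) // /f index_uniq.
exists f.
  rewrite -map_comp => x y xs ys /eqP.
  rewrite nth_uniq -?spts ?index_mem // => /eqP exy.
  by rewrite -(nth_index None xs) exy nth_index.
by rewrite /= -{1}fE -!map_comp.
Qed.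
End Eigenstructure.

(** * Minors of the elements of a generic bundle *)

Section GradedDet.
Variable F : numClosedFieldType.

Lemma det_rev_rows r eta (M : 'M[{poly F}]_r) N :
    graded_rows eta M -> (size (\det M) <= N.+1)%N ->
  'X^N * \det (rev_rows eta M) = 'X^(\sum_(i < r) eta i) * revp N (\det M).
Proof.
move=> gM sN; apply: poly_eq_nonzero => t t0.
rewrite !hornerM !hornerXn horner_revp //.
have E : map_mx (horner_eval t) (rev_rows eta M) =
    diag_mx (\row_i t ^+ eta i) *m map_mx (horner_eval t^-1) M.
  by apply/matrixP => i j; rewrite mul_diag_mx !mxE /= /horner_eval horner_revp ?gM.
have := congr1 determinant E; rewrite det_mulmx !det_map_mx /= /horner_eval det_diag => ->.
have -> : \prod_(i < r) (\row_i t ^+ eta i) 0 i = t ^+ \sum_(i < r) eta i.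
  by rewrite expr_sum; apply: eq_bigr => i _; rewrite mxE.
by rewrite mulrCA.
Qed.

Lemma size_det_graded r eta (M : 'M[{poly F}]_r) :
  graded_rows eta M -> (size (\det M) <= (\sum_(i < r) eta i).+1)%N.
Proof.
move=> gM; have [->|d0] := eqVneq (\det M) 0; first by rewrite size_poly0.
have sp0 : (0 < size (\det M))%N by rewrite size_poly_gt0.
set N := (size (\det M)).-1; have sN : size (\det M) = N.+1 by rewrite prednK.
have := det_rev_rows (N := N) gM; rewrite sN leqnn => /(_ isT) e.
have r0 : revp N (\det M) != 0 by rewrite revp_neq0 ?sN.
have q0 : \det (rev_rows eta M) != 0.
  apply: contra_eq_neq e => ->; rewrite mulr0 eq_sym mulf_neq0 ?expf_neq0 ?polyX_eq0 //.
have := congr1 (mup 0) e; rewrite -['X]subr0 -polyC0.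
rewrite !mupM ?expf_neq0 ?polyXsubC_eq0 // !mup_XsubCX eqxx.
have := mup0_revp (k := N) d0; rewrite sN leqnn => /(_ isT).
by move: (mup _ _) (mup _ _) (\sum_(i < r) eta i)%N => x y z; clear; lia.
Qed.

Lemma size_det_full r eta (M : 'M[{poly F}]_r) :
  graded_rows eta M -> (\det (rev_rows eta M)).[0] != 0 ->
  size (\det M) = (\sum_(i < r) eta i).+1.
Proof.
move=> gM q0; have [d0|d0] := eqVneq (\det M) 0.
  have := det_rev_rows (N := 0) gM; rewrite d0 size_poly0 => /(_ isT).
  have -> : revp 0 0 = 0 :> {poly F} by apply/polyP => i; rewrite coef_poly !coef0 if_same.
  by rewrite mulr0 expr0 mul1r => e; rewrite e horner0 eqxx in q0.
have sp0 : (0 < size (\det M))%N by rewrite size_poly_gt0.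
set N := (size (\det M)).-1; have sN : size (\det M) = N.+1 by rewrite prednK.
have := det_rev_rows (N := N) gM; rewrite sN leqnn => /(_ isT) e.
have r0 : revp N (\det M) != 0 by rewrite revp_neq0 ?sN.
have q00 : \det (rev_rows eta M) != 0 by apply: contraNneq q0 => ->; rewrite horner0.
have := congr1 (mup 0) e; rewrite -['X]subr0 -polyC0.
rewrite !mupM ?expf_neq0 ?polyXsubC_eq0 // !mup_XsubCX eqxx.
rewrite (mupNroot (q := \det (rev_rows eta M))) ?rootE //.
have := mup0_revp (k := N) d0; rewrite sN leqnn => /(_ isT).
by move: (mup _ _) (\sum_(i < r) eta i)%N => x y; clear; lia.
Qed.

Lemma full_minor n r (V : 'M[{poly F}]_(r, n)) (W : 'M_(n, r)) mu :
  (\det (V *m W)).[mu] != 0 -> exists f : {ffun 'I_r -> 'I_n}, (\det (colsub f V)).[mu] != 0.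
Proof.
move=> h; pose A := (map_mx (horner_eval mu) V)^T.
have fA : row_full A.
  apply/row_fullP; exists (invmx (map_mx (horner_eval mu) (V *m W))^T *m (map_mx (horner_eval mu) W)^T).
  rewrite -mulmxA -trmx_mul -map_mxM mulVmx // unitmx_tr unitmxE det_map_mx unitfE //.
exists (fullrankfun fA); have := fullrowsub_unit fA.
rewrite unitmxE unitfE; congr (_ != 0).
rewrite -det_tr /A.
have -> : (rowsub (fullrankfun fA) (map_mx (horner_eval mu) V)^T)^T =
  map_mx (horner_eval mu) (colsub (fullrankfun fA) V).
  by apply/matrixP => i j; rewrite !mxE.
by rewrite det_map_mx.
Qed.

End GradedDet.

(** Each Smith block is obtained from the other by multiplication with square matrices on both
    sides, so the determinants divide each other. *)
Lemma smith_form_prod (F : fieldType) n (A : 'M[{poly F}]_n) s s' :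
  smith_form A s -> smith_form A s' -> \prod_(p <- s) p %= \prod_(p <- s') p.
Proof.
move=> /smith_formP[sn mon _ e] /smith_formP[sn' mon' _ e'].
have ss : size s = size s' by rewrite -(smith_rank sn mon e) (smith_rank sn' mon' e').
suff H u u' : (size u <= n)%N -> (size u' <= n)%N -> size u = size u' ->
    equivmx A (diag_seq n u) -> equivmx A (diag_seq n u') -> \prod_(p <- u') p %| \prod_(p <- u) p.
  by rewrite /eqp !H.
move=> un un' uu eu eu'.
have [X [Y [Z [W [eA ZX YW]]]]] := smith_factors un eu.
have [X' [Y' [Z' [W' [eA' ZX' YW']]]]] := smith_factors un' eu'.
have eS : diag_seq (size u) u = (Z *m X') *m diag_seq (size u') u' *m (Y' *m W).
  have -> : diag_seq (size u) u = Z *m A *m W.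
    by rewrite eA !mulmxA ZX mul1mx -mulmxA YW mulmx1.
  by rewrite eA' !mulmxA.
move: (Z *m X') (Y' *m W) eS; rewrite -det_diag_seq -[X in _ %| X]det_diag_seq uu => B B' ->.
by rewrite !det_mulmx mulrAC dvdp_mull.
Qed.

Section BundleMinors.
Variables (R : realType) (d n r a : nat).
Local Notation F := (R[i]).
Implicit Types P K : sympol R d n.

Lemma osum_uniq P E E' : has_eigenstructure P E -> has_eigenstructure P E' ->
  forall x, osum E x = osum E' x.
Proof.
move=> /has_osum[[s ss Es] [t st Et]] /has_osum[[s' ss' Es'] [t' st' Et']].
have H (A : 'M[{poly F}]_n) u u' mu : smith_form A u -> smith_form A u' ->
    sumn (exponents mu u) = sumn (exponents (mu : F) u').
  move=> hu hu'; have e := smith_form_prod hu hu'.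
  have [_ mon _ _] := hu; have [_ mon' _ _] := hu'.
  by rewrite -!mup_prod // (eqp_mup _ (prod_monic_neq0 mon) e).
case=> [mu|]; first by rewrite Es Es' (H _ _ _ _ ss ss').
by rewrite Et Et' (H _ _ _ _ st st').
Qed.

Lemma osum_generic (mus : seq F) x :
  osum (generic_eigenstructure n r a mus) x = count_mem x [seq Some mu | mu <- mus].
Proof.
rewrite /osum /=; have -> : [seq (Some mu, 1%N) | mu <- mus] = [seq (x, 1%N) | x <- [seq Some mu | mu <- mus]].
  by rewrite -map_comp.
by rewrite filter_const_snd sumn_nseq mul1n.
Qed.

Lemma bundle_rank K P : sym_bundle K P -> pol_rank P = pol_rank K.
Proof.
case=> E [E' [/size_left_indices eK /size_left_indices eP [_ /perm_size pl _]]].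
by apply/eqP; rewrite -(eqn_add2l (size (left_indices E))) eK -pl eP.
Qed.

Lemma bundle_generic K P : is_generic r a K -> sym_bundle K P ->
  exists E, [/\ has_eigenstructure P E, (forall x, osum E x <= 1)%N
    & size (odd_points E) = (r * d - 2 * a)%N].
Proof.
move=> [_ rK [mus [umus smus hK]]] [E [E' [hE hE' same]]]; exists E'.
have eE x : osum E x = count_mem x [seq Some mu | mu <- mus].
  by rewrite (osum_uniq hE hK) osum_generic.
have um : uniq [seq Some mu | mu <- mus] by rewrite map_inj_uniq // => x y [].
split=> //.
  by move=> x; have [->//|[y ->]] := same_osum same x; rewrite eE count_uniq_mem // leq_b1.
rewrite (same_odd_points same) -smus -[RHS](size_map Some); apply/perm_size/uniq_perm.
- exact: odd_points_uniq.
- exact: um.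
by move=> x; rewrite mem_odd_points eE count_uniq_mem //; case: (_ \in _).
Qed.

Lemma pmx_squarefree P : pol_rank P = r ->
  exists eta (V : 'M_(r, n)) D, graded_fact d (pmx P) eta V D /\ squarefree_gram d eta D.
Proof.
move=> rP; apply: graded_fact_squarefree; first by move=> i j; exact: size_pmx.
rewrite -rP; apply: graded_fact_ex; [exact: pmx_sym|by move=> i j; exact: size_pmx].
Qed.

(** [p] stands for det D and [w] for the maximal minors of V. Columns are selected by arbitrary
    maps, repetitions and permutations included. *)
Definition minor_factor P p (w : {ffun 'I_r -> 'I_n} -> {poly F}) :=
  [/\ forall f g : {ffun 'I_r -> 'I_n}, \det (mxsub f g (pmx P)) = p * w f * w g, p != 0,
    (size p <= (r * d - 2 * a).+1)%N & forall f, (size (w f) <= a.+1)%N].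

(* The r x r minors of a rank r symmetric Q = V^T D V are those of the rank one
   matrix det(D) w w^T, where w lists the r x r minors of V. *)
Lemma bundle_minor_factor K P : (2 * a <= r * d)%N -> is_generic r a K -> sym_bundle K P ->
  exists p w, [/\ minor_factor P p w,
    (forall mu, mup mu p <= 1)%N, ((r * d - 2 * a).+1 <= size p + 1)%N,
    (forall mu, exists f, (w f).[mu] != 0) & exists f, size (w f) = a.+1].
Proof.
move=> a2 gK bP; have [E [hE le1 sE]] := bundle_generic gK bP.
have rP : pol_rank P = r by rewrite (bundle_rank bP); case: gK.
have [eta [V [D [fP sD]]]] := pmx_squarefree rP.
have [full fullR] := osum_le1_full rP fP hE le1.
have := odd_points_count rP fP sD hE; rewrite sE => ea.
have {}ea : (\sum_(i < r) eta i = a)%N.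
  by move: ea a2; move: (\sum_(i < r) eta i)%N (r * d)%N; clear; lia.
have [gV gD symD D0 eQ] := fP; have [_] := rev_gram_det gD D0; rewrite ea => eD.
have sp0 : (0 < size (\det D))%N by rewrite size_poly_gt0.
have gVf f : graded_rows eta (colsub f V) by move=> i j; rewrite mxE.
exists (\det D), (fun f => \det (colsub f V)); split.
- split=> //.
  + move=> f g.
    have -> : mxsub f g (pmx P) = (colsub f V)^T *m D *m colsub g V.
      by rewrite eQ; apply/matrixP => i j; rewrite !mxE; apply: eq_bigr => l _;
        rewrite !mxE; congr (_ * _); apply: eq_bigr => k _; rewrite !mxE.
    by rewrite !det_mulmx det_tr [_ * \det D]mulrC.
  + by move: eD sp0; move: (size _) (r * d)%N (mup _ _); clear; lia.
  + by move=> f; rewrite -ea size_det_graded.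
- by case: sD.
(* The order at infinity is at most one, so det D has degree at least r d - 2 a - 1. *)
- by case: sD => _; move: eD sp0 a2; move: (size _) (r * d)%N (mup _ _); clear; lia.
- by move=> mu; have [W h] := full mu; exact: full_minor h.
have [W h] := fullR; have [f hf] := full_minor h; exists f.
rewrite -ea; apply: size_det_full => //.
by move: hf; congr (_.[_] != 0); congr determinant; apply/matrixP => i j; rewrite !mxE.
Qed.

End BundleMinors.

Import numFieldNormedType.Exports.
Local Open Scope classical_set_scope.

(** * Limits of polynomials along filters *)

Section ComplexLimits.
Variables (R : realType) (T : Type) (Fi : set_system T).
Local Notation F := (R[i]).
Implicit Types (f g : T -> F) (l m : F).

Definition clim f l := forall e : R, 0 < e -> \forall x \near Fi, normc (f x - l) < e.

Lemma normc_ge0 (z : F) : 0 <= normc z.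
Proof. by case: z => a b; exact: sqrtr_ge0. Qed.

Lemma normc_eq0 (z : F) : (normc z == 0) = (z == 0).
Proof. by apply/eqP/eqP => [/eq0_normc|->]; rewrite ?normc0. Qed.

Lemma normcB_sym (z t : F) : normc (z - t) = normc (t - z).
Proof. by rewrite -normcN opprB. Qed.

Lemma normc_Re_Im (z : F) : normc z <= `|complex.Re z| + `|complex.Im z|.
Proof.
case: z => a b; rewrite /normc /= -[X in _ <= X]ger0_norm ?addr_ge0 //.
rewrite -sqrtr_sqr ler_wsqrtr // sqrrD !real_normK ?num_real //.
by rewrite addrAC lerDl mulrn_wge0 // mulr_ge0.
Qed.

Lemma normc_Re (z : F) : `|complex.Re z| <= normc z.
Proof. by case: z => a b /=; rewrite -sqrtr_sqr ler_wsqrtr // lerDl sqr_ge0. Qed.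

Lemma normc_Im (z : F) : `|complex.Im z| <= normc z.
Proof. by case: z => a b /=; rewrite -sqrtr_sqr ler_wsqrtr // lerDr sqr_ge0. Qed.

Context {FF : ProperFilter Fi}.

Lemma clim_cst l : clim (fun=> l) l.
Proof. by move=> e e0; near=> x; rewrite subrr normc0. Unshelve. all: by end_near. Qed.

Lemma clim_near f g l : (\forall x \near Fi, f x = g x) -> clim f l -> clim g l.
Proof.
by move=> fg fl e e0; apply: filterS2 fg (fl e e0) => x ->.
Qed.

Lemma climD f g l m : clim f l -> clim g m -> clim (fun x => f x + g x) (l + m).
Proof.
move=> fl gm e e0; have e2 : 0 < e / 2 by rewrite divr_gt0.
apply: filterS2 (fl _ e2) (gm _ e2) => x h1 h2.
rewrite opprD addrACA; apply: le_lt_trans (le_normcD _ _) _.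
by rewrite (splitr e) ltrD.
Qed.

Lemma clim_bound f l : clim f l -> \forall x \near Fi, normc (f x) <= normc l + 1.
Proof.
move=> /(_ 1 ltr01); apply: filterS => x h; rewrite -[f x](subrK l) addrC.
by apply: le_trans (le_normcD _ _) _; rewrite lerD2l ltW.
Qed.

Lemma climM f g l m : clim f l -> clim g m -> clim (fun x => f x * g x) (l * m).
Proof.
move=> fl gm e e0; pose K := normc l + 1 + normc m + 1.
have K0 : 0 < K by rewrite /K ltr_wpDl // !addr_ge0 ?normc_ge0.
have eK : 0 < e / K / 2 by rewrite !divr_gt0.
apply: filterS3 (fl _ eK) (gm _ eK) (clim_bound fl) => x h1 h2 h3.
have -> : f x * g x - l * m = f x * (g x - m) + (f x - l) * m by ring.
apply: le_lt_trans (le_normcD _ _) _; rewrite !normcM.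
apply: (@lt_le_trans _ _ (K * (e / K / 2) + (e / K / 2) * K)).
  apply: ltr_leD.
    apply: (@le_lt_trans _ _ (K * normc (g x - m))); last by rewrite ltr_pM2l.
    apply: ler_wpM2r; first exact: normc_ge0.
    apply: le_trans h3 _; have := normc_ge0 m.
    by rewrite /K; move: (normc l) (normc m) => u v; clear; lra.
  apply: ler_pM; rewrite ?normc_ge0 ?(ltW h1) //.
  have := normc_ge0 l.
  by rewrite /K; move: (normc l) (normc m) => u v; clear; lra.
have -> // : K * (e / K / 2) + e / K / 2 * K = e by field; rewrite lt0r_neq0.
Qed.

Lemma clim_unique f l m : clim f l -> clim f m -> l = m.
Proof.
move=> fl fm; apply/eqP; rewrite -subr_eq0 -normc_eq0; apply/negPn/negP => n0.
have e0 : 0 < normc (l - m) / 2 by rewrite divr_gt0 // lt0r n0 normc_ge0.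
have [x [h1 h2]] := filter_ex (filterI (fl _ e0) (fm _ e0)).
have : normc (l - m) < normc (l - m).
  have {1}-> : l - m = (l - f x) + (f x - m) by ring.
  apply: le_lt_trans (le_normcD _ _) _; rewrite [X in _ < X]splitr ltrD //.
  by rewrite normcB_sym.
by rewrite ltxx.
Qed.

Lemma clim_sum (I : Type) (s : seq I) (P : pred I) (f : I -> T -> F) (l : I -> F) :
  (forall i, P i -> clim (f i) (l i)) ->
  clim (fun x => \sum_(i <- s | P i) f i x) (\sum_(i <- s | P i) l i).
Proof.
move=> H; elim: s => [|i s IH].
  by rewrite big_nil; under eq_fun do rewrite big_nil; exact: clim_cst.
rewrite big_cons; under eq_fun do rewrite big_cons.
by case: ifP => // Pi; apply: climD => //; exact: H.
Qed.

Definition plim (f : T -> {poly F}) (p : {poly F}) :=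
  forall k, clim (fun x => (f x)`_k) p`_k.

Lemma plim_cst p : plim (fun=> p) p.
Proof. by move=> k; exact: clim_cst. Qed.

Lemma plim_unique (f : T -> {poly F}) p q : plim f p -> plim f q -> p = q.
Proof. by move=> fp fq; apply/polyP => k; exact: clim_unique (fp k) (fq k). Qed.

Lemma plimM (f g : T -> {poly F}) p q : plim f p -> plim g q -> plim (fun x => f x * g x) (p * q).
Proof.
move=> fp gq k; rewrite coefM; under eq_fun do rewrite coefM.
by apply: clim_sum => i _; exact: climM.
Qed.

Lemma plim_sum (I : Type) (s : seq I) (P : pred I) (f : I -> T -> {poly F}) (l : I -> {poly F}) :
  (forall i, P i -> plim (f i) (l i)) ->
  plim (fun x => \sum_(i <- s | P i) f i x) (\sum_(i <- s | P i) l i).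
Proof.
move=> H k; rewrite coef_sum; under eq_fun do rewrite coef_sum.
by apply: clim_sum => i Pi; exact: H.
Qed.

Lemma plim_prod (I : Type) (s : seq I) (f : I -> T -> {poly F}) (l : I -> {poly F}) :
  (forall i, plim (f i) (l i)) ->
  plim (fun x => \prod_(i <- s) f i x) (\prod_(i <- s) l i).
Proof.
move=> H; elim: s => [|i s IH].
  by rewrite big_nil; under eq_fun do rewrite big_nil; exact: plim_cst.
by rewrite big_cons; under eq_fun do rewrite big_cons; exact: plimM.
Qed.

Lemma plim_det n (A : T -> 'M[{poly F}]_n) (B : 'M[{poly F}]_n) :
  (forall i j, plim (fun x => A x i j) (B i j)) -> plim (fun x => \det (A x)) (\det B).
Proof.
move=> H; apply: plim_sum => s _; apply: plimM; first exact: plim_cst.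
by apply: plim_prod.
Qed.

End ComplexLimits.

(** Real and imaginary parts stay in a compact segment, and a cluster point of an ultrafilter is a
    limit. *)
Lemma clim_ultra (R : realType) (T : Type) (U : set_system T) (UU : UltraFilter U)
    (f : T -> R[i]) (M : R) :
  (\forall x \near U, normc (f x) <= M) -> exists l, clim U f l.
Proof.
move=> bM.
have H (h : T -> R) : (\forall x \near U, `|h x| <= M) -> exists a : R, h @ U --> a.
  move=> hM; have [|a [_ ha]] := @segment_compact R (- M) M (h @ U) _.
    by apply: filterS hM => x; rewrite /= in_itv /= -ler_norml.
  exists a => B aB; have [//|UB] := in_ultra_setVsetC (h @^-1` B) UU.
  by have [x []] := ha (~` B) B UB aB.
have [a ha] : exists a : R, (fun x => complex.Re (f x)) @ U --> a.
  by apply: H; apply: filterS bM => x; apply: le_trans; exact: normc_Re.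
have [b hb] : exists b : R, (fun x => complex.Im (f x)) @ U --> b.
  by apply: H; apply: filterS bM => x; apply: le_trans; exact: normc_Im.
exists (a +i* b)%C => e e0; have e2 : 0 < e / 2 by rewrite divr_gt0.
move/cvgrPdist_lt: ha => /(_ _ e2) ha; move/cvgrPdist_lt: hb => /(_ _ e2) hb.
apply: filterS2 ha hb => x h1 h2; apply: le_lt_trans (normc_Re_Im _) _.
rewrite (splitr e); case: (f x) h1 h2 => u v /= h1 h2.
by rewrite ltrD // distrC.
Qed.

(** * Coefficientwise limits and the metric *)

Section SympolLimits.
Variables (R : realType) (d n : nat).
Local Notation F := (R[i]).
Implicit Types P Q : sympol R d n.

Lemma normc_le_dist P Q k i j : normc (P k i j - Q k i j) <= sympol_dist P Q.
Proof.
rewrite sympol_distE -[X in X <= _]ger0_norm ?normc_ge0 // -sqrtr_sqr ler_wsqrtr //.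
rewrite (bigD1 (k, (i, j))) //= lerDl sumr_ge0 // => u _; exact: sqr_ge0.
Qed.

Lemma plim_pmx (Fi : set_system (sympol R d n)) {FF : ProperFilter Fi} Q : Fi --> Q ->
  forall i j, plim Fi (fun P => pmx P i j) (pmx Q i j).
Proof.
move=> FQ i j k; have [lt|ge] := ltnP k d.+1; last first.
  rewrite nth_default ?(leq_trans (size_pmx _ _ _)) //.
  under eq_fun do rewrite nth_default ?(leq_trans (size_pmx _ _ _)) //.
  exact: clim_cst.
rewrite (coef_pmx _ _ _ (Ordinal lt)); under eq_fun do rewrite (coef_pmx _ _ _ (Ordinal lt)).
move=> e e0; have := FQ _ (nbhsx_ballx Q e e0); apply: filterS => P.
rewrite ballEmdist /= => h; rewrite -normcN opprB; apply: le_lt_trans h.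
exact: normc_le_dist.
Qed.

Lemma closure_plim (A : set (sympol R d n)) (T : Type) (Fi : set_system T) {FF : ProperFilter Fi}
    (f : T -> sympol R d n) Q :
  (forall i j, plim Fi (fun x => pmx (f x) i j) (pmx Q i j)) ->
  (forall B, Fi B -> exists2 x, B x & A (f x)) -> closure A Q.
Proof.
move=> lim dense B /nbhs_ballP[e /= e0 sB].
(* M exceeds the number of coefficients and is at least 1, so that many squares (e / M)^2 sum to
   less than e^2. *)
pose I := ('I_d.+1 * ('I_n * 'I_n))%type; pose M : R := #|{: I}|%:R + 1.
have M1 : 1 <= M by rewrite lerDr ler0n.
have M0 : 0 < M := lt_le_trans ltr01 M1.
have eM : 0 < e / M by rewrite divr_gt0.
have H : \forall x \near Fi, forall u : I, normc (f x u.1 u.2.1 u.2.2 - Q u.1 u.2.1 u.2.2) < e / M.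
  apply: filter_forall => -[k [i j]] /=; have := lim i j k _ eM.
  by apply: filterS => x; rewrite !coef_pmx.
have [x Hx Ax] := dense _ H; exists (f x); split=> //; apply: sB.
rewrite ballEmdist /= -[mdist _ _]/(sympol_dist Q (f x)) sympol_dist_sym sympol_distE.
rewrite -[e]ger0_norm ?(ltW e0) // -sqrtr_sqr ltr_sqrt ?exprn_gt0 //.
apply: (@le_lt_trans _ _ (\sum_(u : I) (e / M) ^+ 2)).
  apply: ler_sum => u _; rewrite ler_sqr ?nnegrE ?normc_ge0 ?(ltW eM) //; exact: ltW (Hx u).
rewrite sumr_const -[X in X < _]mulr_natl expr_div_n mulrCA -[X in _ < X]mulr1.
rewrite ltr_pM2l ?exprn_gt0 // ltr_pdivrMr ?exprn_gt0 // mul1r.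
apply: (@lt_le_trans _ _ M); first by rewrite ltrDl.
by rewrite expr2 -[X in X <= _]mul1r ler_pM2r.
Qed.

End SympolLimits.

(** * Closedness of the rank condition *)

Section RankBound.
Variables (R : realType) (d n : nat).
Local Notation F := (R[i]).
Implicit Types P Q : sympol R d n.

Lemma rank_minors (K : fieldType) (A : 'M[K]_n) r :
  (forall f g : {ffun 'I_r.+1 -> 'I_n}, \det (mxsub f g A) = 0) -> (\rank A <= r)%N.
Proof.
move=> H; rewrite leqNgt; apply/negP => lt.
pose B := rowsub (maxrankfun A \o widen_ord lt) A.
have fB : row_free B.
  have /row_freeP[N MN] := maxrowsub_free A; apply/row_freeP.
  exists (N *m colsub (widen_ord lt) 1%:M).
  have -> : B = rowsub (widen_ord lt) (rowsub (maxrankfun A) A).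
    by apply/matrixP => i j; rewrite !mxE.
  rewrite mulmxA mul_rowsub_mx MN mulmx_colsub mulmx1.
  by apply/matrixP => i j; rewrite !mxE -!val_eqE.
have fBt : row_full B^T by rewrite /row_full mxrank_tr.
pose f : {ffun 'I_r.+1 -> 'I_n} := [ffun i => maxrankfun A (widen_ord lt i)].
have := fullrowsub_unit fBt; rewrite unitmxE unitfE -det_tr.
have -> : (rowsub (fullrankfun fBt) B^T)^T = mxsub f (fullrankfun fBt) A.
  by apply/matrixP => i j; rewrite !mxE /=; congr (A _ _); rewrite /f ffunE.
by rewrite H eqxx.
Qed.

Lemma pol_rank_minors P r : (pol_rank P <= r)%N <->
  forall f g : {ffun 'I_r.+1 -> 'I_n}, \det (mxsub f g (pmx P)) = 0.
Proof.
split=> [le f g|H].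
  apply/eqP; rewrite -tofrac_eq0 -det_map_mx; apply/negPn/negP => nz.
  have u : map_mx (@tofrac _) (mxsub f g (pmx P)) \in unitmx by rewrite unitmxE unitfE.
  have := mxrank_unit u; have -> : map_mx (@tofrac {poly F}) (mxsub f g (pmx P)) =
      rowsub f 1%:M *m fracmx (pmx P) *m colsub g 1%:M.
    by rewrite mul_rowsub_mx mul1mx mulmx_colsub mulmx1; apply/matrixP => i j; rewrite !mxE.
  move=> e; have : (r.+1 <= pol_rank P)%N.
    rewrite -{1}e /pol_rank; move: (fracmx (pmx P)) => A.
    by apply: leq_trans (mxrankM_maxl _ _) (mxrankM_maxr _ _).
  by rewrite ltnNge le.
apply: rank_minors => f g; have -> : mxsub f g (fracmx (pmx P)) = fracmx (mxsub f g (pmx P)).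
  by apply/matrixP => i j; rewrite !mxE.
by rewrite det_map_mx H rmorph0.
Qed.

Lemma closed_rank_le r : closed [set P : sympol R d n | (pol_rank P <= r)%N].
Proof.
move=> Q; rewrite closureEcvg => -[G PG [GQ sG]] /=; apply/pol_rank_minors => f g.
apply: (@plim_unique _ _ G _ (fun P => \det (mxsub f g (pmx P)))).
  by apply: plim_det => i j; rewrite mxE; under eq_fun do rewrite mxE; exact: plim_pmx.
have H : \forall P \near G, \det (mxsub f g (pmx P)) = 0.
  by apply: sG => P /pol_rank_minors; exact.
move=> k; apply: (@clim_near _ _ G _ (fun=> 0)); last by rewrite coef0; exact: clim_cst.
by apply: filterS H => P ->; rewrite coef0.
Qed.
End RankBound.

(** * Density *)

Section RankExtension.
Variable F : numClosedFieldType.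

Lemma size_mul_gram d n r eta (V : 'M[{poly F}]_(r, n)) D i j :
  graded_rows eta V -> graded_gram d eta D -> (size ((V^T *m D *m V) i j) <= d.+1)%N.
Proof.
move=> gV gD; rewrite mxE; apply: leq_trans (size_sum _ _ _) _; apply/bigmax_leqP => l _.
rewrite mxE mulr_suml; apply: leq_trans (size_sum _ _ _) _; apply/bigmax_leqP => k _.
rewrite mxE; have [->|] := gD k l; first by rewrite mulr0 mul0r size_poly0.
have := gV k i; have := gV l j.
have := size_polyMleq (V k i * D k l) (V l j); have := size_polyMleq (V k i) (D k l).
move: (size _) (size _) (size _) (size _) (size _) => a b c e f; clear; lia.
Qed.

(** A double root would be a zero of the derivative d X^(d-1), which can only be 0, where the value
    is -c. *)
Lemma mup_Xn_sub_nat d (c : F) mu : (0 < d)%N -> c != 0 -> (mup mu ('X^d - c%:P) <= 1)%N.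
Proof.
move=> d0 c0; have p0 : 'X^d - c%:P != 0 by rewrite -size_poly_eq0 size_XnsubC.
rewrite mup_leq //; apply/negP => h.
have r0 : root ('X^d - c%:P) mu.
  by rewrite -dvdp_XsubCl; apply: dvdp_trans h; rewrite dvdp_exp.
have r1 : root ('X^d - c%:P)^`() mu.
  move: h => /dvdpP[q ->]; rewrite rootE expr2 !derivM !(hornerD, hornerM, hornerN, hornerX, hornerC) subrr.
  by rewrite !(mulr0, mul0r, addr0).
move: r0 r1; rewrite !rootE derivB derivXn derivC subr0 !hornerE hornerMn hornerXn.
rewrite mulrn_eq0 -leqn0 leqNgt d0 /= expf_eq0 => e /andP[_ /eqP mu0].
by move: e; rewrite mu0 expr0n; case: d d0 {p0 h} => // d' _; rewrite sub0r oppr_eq0 (negPf c0).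
Qed.

(** A zero row of degree bound 0 does not change Q. The new diagonal entry X^d - c has full degree,
    hence no root at infinity, and c is chosen so that it shares no root with det D. *)
Lemma graded_fact_extend d n (Q : 'M[{poly F}]_n) r eta (V : 'M_(r, n)) D : (0 < d)%N ->
    graded_fact d Q eta V D -> squarefree_gram d eta D ->
  exists eta' (V' : 'M_(1 + r, n)) D', [/\ graded_fact d Q eta' V' D', squarefree_gram d eta' D'
    & (\sum_(i < 1 + r) eta' i = \sum_(i < r) eta i)%N].
Proof.
move=> d0 [gV gD symD D0 eQ] [sq sqR].
have [rs ers] := closed_field_poly_normal (\det D).
have [c c0 crs] : exists2 c : F, c != 0 & c \notin [seq z ^+ d | z <- rs].
  (* One candidate more than there are roots of det D, so one of them is not the d-th power of a
     root. *)
  pose s := [seq i.+1%:R : F | i <- iota 0 (size rs).+1].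
  have us : uniq s.
    by rewrite map_inj_uniq ?iota_uniq // => i j /eqP; rewrite eqr_nat eqSS => /eqP.
  have /hasP[c cs ncs] : has (fun c => c \notin [seq z ^+ d | z <- rs]) s.
    apply/negPn/negP; rewrite -all_predC => /allP al.
    have /(uniq_leq_size us) : {subset s <= [seq z ^+ d | z <- rs]}.
      by move=> x /al /=; rewrite negbK.
    by rewrite !size_map size_iota ltnn.
  by exists c => //; case/mapP: cs => i _ ->; rewrite pnatr_eq0.
pose p : {poly F} := 'X^d - c%:P.
have sp : size p = d.+1 by rewrite size_XnsubC.
have p0 : p != 0 by rewrite -size_poly_eq0 sp.
pose eta' i := if i is j.+1 then eta j else 0%N.
pose D' : 'M_(1 + r) := block_mx p%:M 0 0 D.
have dD' : \det D' = p * \det D by rewrite det_ublock det_scalar expr1.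
have gD' : graded_gram d eta' D'.
  move=> i j; rewrite mxE; case: splitP => i' ei; rewrite mxE; case: splitP => j' ej; rewrite ?mxE; try by left.
    by right; rewrite ei ej !ord1 mulr1n sp addn0.
  by rewrite ei ej; exact: gD.
have rD' : rev_gram d eta' D' = block_mx (revp d p)%:M 0 0 (rev_gram d eta D).
  apply/matrixP => i j; rewrite !mxE; case: splitP => i' ei; rewrite !mxE; case: splitP => j' ej; rewrite ?mxE.
  - by rewrite ei ej !ord1 !mulr1n /= addn0 subn0.
  - by case: ifP => // _; apply/polyP => k; rewrite coef_poly !coef0 if_same.
  - by case: ifP => // _; apply/polyP => k; rewrite coef_poly !coef0 if_same.
  by rewrite ei ej.
exists eta', (col_mx 0 V), D'; split; last by rewrite big_ord_recl /= add0n.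
- split=> //.
  + move=> i j; rewrite mxE; case: splitP => i' ei; first by rewrite mxE size_poly0.
    by rewrite ei; exact: gV.
  + by rewrite tr_block_mx tr_scalar_mx !trmx0 symD.
  + by rewrite dD' mulf_neq0.
  by rewrite tr_col_mx mul_row_block mul_row_col !mulmx0 !add0r.
split.
  move=> mu; rewrite dD' mupM //.
  have [rp|nrp] := boolP (root p mu); last by rewrite mupNroot // sq.
  rewrite (mupNroot (q := \det D)) ?addn0 ?mup_Xn_sub_nat //.
  apply: contra crs; rewrite {1}ers rootZ ?lead_coef_eq0 // root_prod_XsubC => mrs.
  apply/mapP; exists mu => //; move: rp; rewrite rootE !(hornerD, hornerN, hornerC, hornerXn) subr_eq0.
  by move=> /eqP ->.
have [R0 _] := rev_gram_det gD D0.
rewrite rD' det_ublock det_scalar expr1 mupM ?revp_neq0 ?sp //.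
by have := mup0_revp (k := d) p0; rewrite sp leqnn => /(_ isT) /eqP; rewrite -[X in _ == X]add0n eqn_add2r => /eqP ->.
Qed.

Lemma graded_fact_extends d n (Q : 'M[{poly F}]_n) r k eta (V : 'M_(r, n)) D : (0 < d)%N ->
    graded_fact d Q eta V D -> squarefree_gram d eta D ->
  exists eta' (V' : 'M_(k + r, n)) D', [/\ graded_fact d Q eta' V' D', squarefree_gram d eta' D'
    & (\sum_(i < k + r) eta' i = \sum_(i < r) eta i)%N].
Proof.
move=> d0 f s; elim: k => [|k [eta' [V' [D' [f' s' e']]]]]; first by exists eta, V, D.
have [eta2 [V2 [D2 [f2 s2 e2]]]] := graded_fact_extend d0 f' s'.
by exists eta2, V2, D2; split=> //; rewrite -e' -e2.
Qed.

Lemma zigzag_ex_dim r m n (eta eps : nat -> nat) : n = (r + m)%N ->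
    (\sum_(i < r) eta i = \sum_(i < m) eps i)%N ->
  exists (V : 'M[{poly F}]_(r, n)) (N : 'M_(n, m)), zigzag eta eps V N.
Proof. by move=> ->; exact: zigzag_ex. Qed.

Lemma sum_balanced a m : (0 < m)%N ->
  (\sum_(k < m) (a %/ m + (k < a %% m)) = a)%N.
Proof.
move=> m0; rewrite big_split /= sum_nat_const card_ord.
have -> : (\sum_(i < m) (i < a %% m) = a %% m)%N.
  rewrite -[RHS](card_ord (a %% m)) -sum1_card (big_ord_widen_cond _ xpredT (fun=> 1%N) (ltnW (ltn_pmod a m0))).
  by rewrite [RHS]big_mkcond; apply: eq_bigr => i _ /=; case: (_ < _)%N.
by rewrite mulnC -divn_eq.
Qed.

End RankExtension.

(** * Approximation by elements of the generic bundles *)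

Section Density.
Variables (R : realType) (d n r : nat) (K : nat -> sympol R d n).
Local Notation F := (R[i]).
Hypotheses (d0 : (0 < d)%N) (rn : (r < n)%N).
Hypothesis hK : forall a, (a <= (r * d) %/ 2)%N -> is_generic r a (K a).

Let tk (k : nat) : F := (k.+1%:R^-1)%:C%C.

Let clim_tk : clim \oo tk 0.
Proof.
move=> e e0; have := @near_infty_natSinv_lt R (PosNum e0); apply: filterS => k /= h.
by rewrite subr0 /tk /normc /= subrr expr0n addr0 sqrtr_sqr ger0_norm ?invr_ge0.
Qed.

Let tk_good (q : {poly F}) N : q != 0 -> exists2 k, (N <= k)%N & q.[tk k] != 0.
Proof.
move=> q0; apply: contrapT => no.
pose s := [seq tk i | i <- iota N (size q)].
have us : uniq s.
  rewrite map_inj_uniq ?iota_uniq // => i j /complexI /invr_inj /eqP.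
  by rewrite eqr_nat eqSS => /eqP.
have rs : all (root q) s.
  apply/allP => x /mapP [j]; rewrite mem_iota => /andP[Nj _] ->; apply/negPn/negP => h.
  by apply: no; exists j.
by have := max_poly_roots q0 rs us; rewrite size_map size_iota ltnn.
Qed.

(** D is kept fixed, so all approximants share one squarefree form det D; only V moves, along the
    line and through parameters 1/(k+1) that avoid the zeros of [q]. *)
Lemma graded_fact_closure (Q : sympol R d n) eta (V : 'M_(r, n)) D :
    graded_fact d (pmx Q) eta V D -> squarefree_gram d eta D ->
  (\sum_(i < r) eta i <= (r * d) %/ 2)%N /\
  closure (sym_bundle (K (\sum_(i < r) eta i)%N)) Q.
Proof.
move=> f s; have [gV gD symD D0 eQ] := f.
have le : (\sum_(i < r) eta i <= (r * d) %/ 2)%N.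
  by rewrite leq_divRL // mulnC; exact: graded_fact_sum_le f.
split=> //; have gK := hK le; move: le gK; set a := (\sum_(i < r) eta i)%N => le gK.
pose m := (n - r)%N; have m0 : (0 < m)%N by rewrite subn_gt0.
have nrm : n = (r + m)%N by rewrite subnKC // ltnW.
pose eps k := (a %/ m + (k < a %% m))%N.
have [|V0 [N z]] := @zigzag_ex_dim F r m n eta eps nrm; first by rewrite sum_balanced.
have heps (i : 'I_m) : (a %/ m <= eps i <= (a %/ m).+1)%N.
  by rewrite /eps; case: (_ < _)%N; rewrite ?addn0 ?addn1 ?leqnn ?leqnSn.
have [q q0 good] := balanced_line heps z gV.
have gV0 : graded_rows eta V0 by case: z => [[]].
have H k : exists P : sympol R d n, pmx P = (line V V0 (tk k))^T *m D *m line V V0 (tk k).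
  apply: sympol_of_mx; first by rewrite !trmx_mul trmxK symD mulmxA.
  by move=> i j; apply: size_mul_gram => //; exact: graded_line.
have [P eP] := choice H.
apply: (@closure_plim _ _ _ _ nat \oo _ P).
  have linelim i j : plim \oo (fun k => line V V0 (tk k) i j) (V i j).
    have -> : V i j = V i j + 0%:P * (V0 - V) i j by rewrite mul0r addr0.
    have -> : (fun k => line V V0 (tk k) i j) = (fun k => V i j + (tk k)%:P * (V0 - V) i j).
      by apply/funext => k; rewrite !mxE.
    move=> l; rewrite coefD; under eq_fun do rewrite coefD.
    apply: climD; first exact: clim_cst.
    apply: plimM; last exact: plim_cst.
    move=> c; rewrite coefC; under eq_fun do rewrite coefC.
    by case: ifP => _; [exact: clim_tk | exact: clim_cst].
  move=> i j; rewrite eQ; under eq_fun do rewrite eP mxE.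
  rewrite mxE; apply: plim_sum => l _; apply: plimM; last exact: linelim.
  rewrite mxE; under eq_fun do rewrite mxE.
  apply: plim_sum => l' _; apply: plimM; last exact: plim_cst.
  by rewrite mxE; under eq_fun do rewrite mxE; exact: linelim.
move=> B [N0 _ sB]; have [k Nk qk] := tk_good N0 q0.
exists k; first exact: sB.
have bal := good _ qk.
have fP : graded_fact d (pmx (P k)) eta (line V V0 (tk k)) D.
  by split=> //; exact: graded_line.
have rP : pol_rank (P k) = r by rewrite /pol_rank eP; exact: (balanced_rank bal).
exact: (generic_mem rP fP s gK nrm m0 (erefl _) bal).
Qed.

(** The last clause expresses a through data shared by a whole bundle, so that one index serves all
    its elements. *)
Lemma rank_le_closure (Q : sympol R d n) : (pol_rank Q <= r)%N ->
  exists a, [/\ (a <= (r * d) %/ 2)%N, closure (sym_bundle (K a)) Q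
    & forall E, has_eigenstructure Q E ->
        (size (odd_points E) + 2 * a = pol_rank Q * d)%N].
Proof.
move=> le; have [eta [V [D [f s]]]] := pmx_squarefree (erefl (pol_rank Q)).
have := graded_fact_extends (r - pol_rank Q) d0 f s; rewrite subnK //.
move=> [eta' [V' [D' [f' s' e']]]]; have [le' cl] := graded_fact_closure f' s'.
exists (\sum_(i < r) eta' i)%N; split=> // E hE; rewrite e'.
exact: odd_points_count f s E hE.
Qed.

End Density.

(** * Disjointness *)

Lemma size_eq_mup (F : closedFieldType) (p q : {poly F}) : p != 0 -> q != 0 ->
  (forall mu, mup mu p = mup mu q) -> size p = size q.
Proof.
move=> p0 q0 pq.
have H (u : {poly F}) : u != 0 -> {rs | size u = (size rs).+1 & forall mu, mup mu u = count_mem mu rs}.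
  move=> u0; have [rs eu] := closed_field_poly_normal u.
  have lu : lead_coef u != 0 by rewrite lead_coef_eq0.
  exists rs; first by rewrite {1}eu size_scale // size_prod_XsubC.
  move=> mu; rewrite -mu_prod_XsubC; apply: eqp_mup => //; by rewrite {1}eu eqp_scale.
have [rs -> mp] := H _ p0; have [rs' -> mq] := H _ q0; congr _.+1.
by apply/perm_size/allP => x _ /=; rewrite -mp -mq pq.
Qed.

(* At every point of the projective line, comparing p w_f^2 = p' w'_f^2 for an f
   with w'_f nonzero there shows that p and p' vanish to the same order. *)
Lemma minor_factor_degree (F : numClosedFieldType) (I : Type) N a a' (p p' : {poly F})
    (w w' : I -> {poly F}) :
    (forall f, p * w f * w f = p' * w' f * w' f) ->
    p' != 0 -> (forall mu, mup mu p' <= 1)%N ->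
    (forall mu, exists f, (w' f).[mu] != 0) -> (exists f, size (w' f) = a'.+1) ->
    (size p <= (N - 2 * a).+1)%N -> (forall f, size (w f) <= a.+1)%N ->
    ((N - 2 * a').+1 <= size p' + 1)%N -> (2 * a <= N)%N -> (2 * a' <= N)%N -> a = a'.
Proof.
move=> e p'0 sq nz [f0 sf0] sp sw sp' aN a'N.
have nz' f : w' f != 0 -> [/\ p != 0 & w f != 0].
  move=> wf0; have : p * w f * w f != 0 by rewrite e !mulf_neq0.
  by rewrite !mulf_eq0 !negb_or => /andP[/andP[]].
have w0 : w' f0 != 0 by rewrite -size_poly_eq0 sf0.
have [p0 wf0] := nz' _ w0.
have mm mu : mup mu p = mup mu p'.
  have [f fmu] := nz mu.
  have w'0 : w' f != 0 by apply: contraNneq fmu => ->; rewrite horner0.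
  have [_ wf] := nz' _ w'0; have := congr1 (mup mu) (e f).
  rewrite !mupM ?mulf_neq0 // (mupNroot (q := w' f)) //.
  by have := sq mu; move: (mup _ _) (mup _ _) (mup _ _); clear; lia.
have ss := size_eq_mup p0 p'0 mm.
(* Equal degrees of p and p' give deg w_{f0} = a', hence a' <= a; the bounds on the size of p give 2
   a <= 2 a' + 1. This is the comparison at infinity. *)
have := congr1 (fun u : {poly F} => size u) (e f0).
rewrite !size_mul ?mulf_neq0 // sf0 -ss.
have := sw f0; rewrite -ss in sp'; have : (0 < size p)%N by rewrite size_poly_gt0.
have : (0 < size (w f0))%N by rewrite size_poly_gt0.
by move: (size p) (size (w f0)) sp sp' aN a'N; clear; lia.
Qed.

Section Disjoint.
Variables (R : realType).
Local Notation F := (R[i]).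

Lemma normalize_family (I : finType) (v : I -> F) i1 : v i1 != 0 ->
  exists2 c : F, c != 0 & (forall i, normc (c^-1 * v i) <= 1) /\ exists i, c^-1 * v i = 1.
Proof.
move=> vi1; have [i0 _ imax] := Order.TotalTheory.arg_maxP (fun i => normc (v i)) (isT : xpredT i1).
have v0 : v i0 != 0.
  rewrite -normc_eq0 gt_eqF //; apply: lt_le_trans (imax i1 isT).
  by rewrite lt0r normc_eq0 vi1 normc_ge0.
exists (v i0) => //; split; last by exists i0; rewrite mulVf.
have n0 : 0 < normc (v i0) by rewrite lt0r normc_eq0 v0 normc_ge0.
by move=> i; rewrite normcM normcV mulrC ler_pdivrMr // mul1r; exact: imax.
Qed.

Lemma plim_ultra (T : Type) (U : set_system T) (UU : UltraFilter U) (f : T -> {poly F}) N :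
    (\forall x \near U, (size (f x) <= N.+1)%N /\ forall k : 'I_N.+1, normc (f x)`_k <= 1) ->
  exists2 p, plim U f p & (size p <= N.+1)%N.
Proof.
move=> H.
have /fin_all_exists[l hl] (k : 'I_N.+1) : exists l, clim U (fun x => (f x)`_k) l.
  by apply: (@clim_ultra _ _ _ _ _ 1); apply: filterS H => x [_]; exact.
exists (\poly_(k < N.+1) l (inord k)); last exact: size_poly.
move=> k; rewrite coef_poly; case: ltnP => [lt|ge].
  by have := hl (inord k); rewrite inordK.
apply: (@clim_near _ _ _ _ (fun=> 0)); last exact: clim_cst.
by apply: filterS H => x [sx _]; rewrite nth_default // (leq_trans sx).
Qed.

(** The coordinate equal to 1 may vary with x; were all limits 0, finitely many coordinates would
    eventually all have modulus below 1. *)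
Lemma clim_ultra_neq0 (T : Type) (U : set_system T) (UU : UltraFilter U) (I : finType)
    (f : T -> I -> F) (l : I -> F) :
  (forall i, clim U (fun x => f x i) (l i)) -> (\forall x \near U, exists i, f x i = 1) ->
  exists i, l i != 0.
Proof.
move=> hl H; apply: contrapT => no.
have H0 : \forall x \near U, forall i, normc (f x i) < 1.
  apply: filter_forall => i; have := hl i 1 ltr01.
  have -> : l i = 0 by apply/eqP/negPn/negP => h; apply: no; exists i.
  by apply: filterS => x; rewrite subr0.
have [x [[i fi] h]] := filter_ex (filterI H H0).
by have := h i; rewrite fi normc1 ltxx.
Qed.

(** No bound on [c] is given: it is bounded because [q] stays away from 0 while the product
    converges. *)
Lemma clim_ultra_quotient (T : Type) (U : set_system T) (UU : UltraFilter U)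
    (c q : T -> F) l k : clim U (fun x => c x * q x) l -> clim U q k -> k != 0 ->
  exists m, clim U c m.
Proof.
move=> hcq hq k0.
have nk : 0 < normc k by rewrite lt0r normc_eq0 k0 normc_ge0.
have nk2 : 0 < normc k / 2 by rewrite divr_gt0.
apply: (@clim_ultra _ _ _ _ _ ((normc l + 1) / (normc k / 2))).
apply: filterS2 (clim_bound hcq) (hq _ nk2) => x h1 h2.
rewrite ler_pdivlMr //; apply: le_trans h1; rewrite normcM.
apply: ler_wpM2l; first exact: normc_ge0.
have := le_normcD (k - q x) (q x); rewrite subrK normcB_sym.
by move: h2; move: (normc _) (normc _) (normc _) => u v w; clear; lra.
Qed.

Variables (d n r : nat).
Implicit Types P : sympol R d n.

(** After separate normalization p and w have nonzero limits, and the remaining scalar converges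
    because the minors do. Its limit may be 0, so no nonvanishing is claimed. *)
Lemma ultra_minor_factor (U : set_system (sympol R d n)) (UU : UltraFilter U) Q a :
    U --> Q ->
    (\forall P \near U, exists p (w : {ffun 'I_r -> 'I_n} -> {poly F}),
       minor_factor a P p w /\ exists f, w f != 0) ->
  exists p (w : {ffun 'I_r -> 'I_n} -> {poly F}),
    [/\ forall f g : {ffun 'I_r -> 'I_n}, \det (mxsub f g (pmx Q)) = p * w f * w g,
      (size p <= (r * d - 2 * a).+1)%N & forall f, (size (w f) <= a.+1)%N].
Proof.
set N := (r * d - 2 * a)%N => UQ H.
pose good P (x : F * {poly F} * ({ffun 'I_r -> 'I_n} -> {poly F})) :=
  [/\ forall f g : {ffun 'I_r -> 'I_n}, \det (mxsub f g (pmx P)) = x.1.1%:P * (x.1.2 * x.2 f * x.2 g),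
    (size x.1.2 <= N.+1)%N /\ (forall k : 'I_N.+1, normc (x.1.2`_k) <= 1),
    exists k : 'I_N.+1, x.1.2`_k = 1,
    forall f, (size (x.2 f) <= a.+1)%N /\ (forall k : 'I_a.+1, normc ((x.2 f)`_k) <= 1)
    & exists i : {ffun 'I_r -> 'I_n} * 'I_a.+1, (x.2 i.1)`_(i.2) = 1].
(* The hypothesis sits under the existential quantifier, so that choice yields a function of all
   P. *)
have norm P : exists x, (exists p (w : {ffun 'I_r -> 'I_n} -> {poly F}), minor_factor a P p w /\ exists f, w f != 0) -> good P x.
  have [[p [w [[e p0 sp sw] [f0 wf0]]]]|no] :=
      pselect (exists p (w : {ffun 'I_r -> 'I_n} -> {poly F}), minor_factor a P p w /\ exists f, w f != 0).
    2: by exists (0 : F, 0 : {poly F}, fun=> 0); move=> h; case: no.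
  have top (u : {poly F}) M : u != 0 -> (size u <= M.+1)%N -> exists k : 'I_M.+1, u`_k != 0.
    move=> u0 su; have su0 : (0 < size u)%N by rewrite size_poly_gt0.
    have lt : ((size u).-1 < M.+1)%N by rewrite prednK // ltnW // ltnS.
    by exists (Ordinal lt); rewrite /= -lead_coefE lead_coef_eq0.
  have [k0 pk0] := top _ _ p0 sp; have [k1 wk1] := top _ _ wf0 (sw f0).
  have [cp cp0 [ple [kp pk]]] := normalize_family (v := fun k : 'I_N.+1 => p`_k) pk0.
  have [cw cw0 [wle [[fw kw] wk]]] := normalize_family
    (v := fun i : {ffun 'I_r -> 'I_n} * 'I_a.+1 => (w i.1)`_(i.2)) (i1 := (f0, k1)) wk1.
  (* A minor contains p once and w twice, hence this scalar. *)
  exists (cp * cw ^+ 2, cp^-1 *: p, fun f => cw^-1 *: w f) => _; split=> /=.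
  - move=> f g; rewrite e -!mul_polyC.
    transitivity ((cp * cp^-1)%:P * (cw * cw^-1)%:P ^+ 2 * (p * w f * w g)).
      by rewrite !mulfV // expr1n !mul1r.
    by rewrite !polyCM expr2; move: (cp%:P) (cp^-1%:P) (cw%:P) (cw^-1%:P) (w f) (w g) (p); clear => *; ring.
  - split; first exact: leq_trans (size_scale_leq _ _) sp.
    by move=> k; rewrite coefZ; exact: ple.
  - by exists kp; rewrite coefZ.
  - move=> f; split; first exact: leq_trans (size_scale_leq _ _) (sw f).
    by move=> k; rewrite coefZ; exact: (wle (f, k)).
  by exists (fw, kw); rewrite coefZ.
have [x hx] := choice norm; have {H}gU : \forall P \near U, good P (x P) by apply: filterS H => P /hx.
have [p lp sp] : exists2 p, plim U (fun P => (x P).1.2) p & (size p <= N.+1)%N.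
  by apply: plim_ultra; apply: filterS gU => P [].
have wex f : exists wf, plim U (fun P => (x P).2 f) wf /\ (size wf <= a.+1)%N.
  have [wf] : exists2 wf, plim U (fun P => (x P).2 f) wf & (size wf <= a.+1)%N.
    by apply: plim_ultra; apply: filterS gU => P [].
  by exists wf.
have [w hw] := choice wex.
have [kp pk] : exists k : 'I_N.+1, p`_k != 0.
  by apply: (@clim_ultra_neq0 _ U _ _ (fun P (k : 'I_N.+1) => (x P).1.2`_k)) => //; apply: filterS gU => P [].
have [[f0 k0] /= wk] : exists i : {ffun 'I_r -> 'I_n} * 'I_a.+1, (w i.1)`_(i.2) != 0.
  apply: (@clim_ultra_neq0 _ U _ _ (fun P (i : {ffun 'I_r -> 'I_n} * 'I_a.+1) => ((x P).2 i.1)`_(i.2))).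
    by move=> i; have [] := hw i.1.
  by apply: filterS gU => P [].
have p0 : p != 0 by apply: contraNneq pk => ->; rewrite coef0.
have w0 : w f0 != 0 by apply: contraNneq wk => ->; rewrite coef0.
have lprod f g : plim U (fun P => (x P).1.2 * (x P).2 f * (x P).2 g) (p * w f * w g).
  by apply: plimM; [apply: plimM => //|]; [have [] := hw f|have [] := hw g].
have lminor (f g : {ffun 'I_r -> 'I_n}) :
    plim U (fun P => (x P).1.1%:P * ((x P).1.2 * (x P).2 f * (x P).2 g)) (\det (mxsub f g (pmx Q))).
  have L : plim U (fun P => \det (mxsub f g (pmx P))) (\det (mxsub f g (pmx Q))).
    by apply: plim_det => i j; rewrite mxE; under eq_fun do rewrite mxE; exact: plim_pmx.
  by move=> k; apply: clim_near (L k); apply: filterS gU => P [-> _ _ _ _].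
have q0 : p * w f0 * w f0 != 0 by rewrite !mulf_neq0.
(* The scalar is compared at the leading coefficient of the limit product, which is nonzero. *)
have [c lc] : exists c, clim U (fun P => (x P).1.1) c.
  have lq := lead_coef_eq0 (p * w f0 * w f0); rewrite (negPf q0) in lq.
  set m := (size (p * w f0 * w f0)).-1.
  apply: (@clim_ultra_quotient _ U _ _ (fun P => ((x P).1.2 * (x P).2 f0 * (x P).2 f0)`_m) _ _ _ (lprod f0 f0 m)).
    by have := lminor f0 f0 m; under eq_fun do rewrite coefCM; exact.
  by rewrite -lead_coefE lq.
exists (c%:P * p), w; split.
- move=> f g; rewrite -!mulrA; apply: plim_unique (lminor f g) _.
  apply: plimM; last by rewrite mulrA; exact: lprod.
  move=> k; rewrite coefC; under eq_fun do rewrite coefC.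
  by case: ifP => _ //; exact: clim_cst.
- by rewrite mul_polyC; exact: leq_trans (size_scale_leq _ _) sp.
by move=> f; have [] := hw f.
Qed.

(** The minors of Q factor in two ways: as a limit, with degree bounds from a, and as an element of
    the bundle of K', with exact vanishing data for a'. *)
Lemma closure_bundle_generic (K K' Q : sympol R d n) a a' : (2 * a <= r * d)%N -> (2 * a' <= r * d)%N ->
    is_generic r a K -> is_generic r a' K' ->
  closure (sym_bundle K) Q -> sym_bundle K' Q -> a = a'.
Proof.
move=> aN a'N gK gK'; rewrite closureEcvg => -[G PG [GQ sG]] bQ.
have [U [UU GU]] := ultraFilterLemma PG.
have UQ : U --> Q by move=> B /GQ /GU.
have [|p [w [e sp sw]]] := ultra_minor_factor (a := a) UU UQ.
  apply: GU; apply: sG => P bP.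
  have [p [w [mf _ _ _ [f sf]]]] := bundle_minor_factor aN gK bP.
  by exists p, w; split=> //; exists f; rewrite -size_poly_eq0 sf.
have [p' [w' [[e' p'0 _ _] sq sp' nz sz]]] := bundle_minor_factor a'N gK' bQ.
apply: (minor_factor_degree (N := (r * d)%N) (w := w) _ p'0 sq nz sz sp sw sp' aN a'N).
by move=> f; rewrite -e -e'.
Qed.

End Disjoint.

Lemma closed_subset_closure (T : topologicalType) (A B : set T) :
  A `<=` closure B -> closure A `<=` closure B.
Proof.
move=> /closureS AB; have /closure_id -> := @closed_closure _ B; exact: AB.
Qed.

Theorem theorem6p3 (R : realType) (n r d : nat)
    (hn : (2 <= n)%N) (hd : (1 <= d)%N) (hodd : odd d)
    (hr : (1 <= r <= n - 1)%N)
    (K : nat -> sympol R d n)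
    (hK : forall a : nat, (a <= (r * d) %/ 2)%N -> is_generic r a (K a)) :
  [/\ (forall M : sympol R d n, (pol_rank M <= r)%N ->
         exists2 a : nat, (a <= (r * d) %/ 2)%N &
           closure (sym_bundle M) `<=` closure (sym_bundle (K a))),
      (forall a a' : nat, (a <= (r * d) %/ 2)%N -> (a' <= (r * d) %/ 2)%N ->
         a <> a' ->
         closure (sym_bundle (K a)) `&` sym_bundle (K a') = set0)
    & closed [set M : sympol R d n | (pol_rank M <= r)%N] /\
      [set M : sympol R d n | (pol_rank M <= r)%N] =
        \bigcup_(a in [set a : nat | (a <= (r * d) %/ 2)%N])
          closure (sym_bundle (K a))].
Proof.
have rn : (r < n)%N by case/andP: hr => _; move: hn; clear; lia.
have le2 a : (a <= (r * d) %/ 2)%N -> (2 * a <= r * d)%N by rewrite leq_divRL // mulnC.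
have dense := rank_le_closure hd rn hK.
split.
- move=> M rM; have [[Q0 bQ0]|no] := pselect (exists Q, sym_bundle M Q); last first.
    (* An empty bundle has empty closure, so any index serves. *)
    exists 0%N; first exact: leq0n.
    suff -> : sym_bundle M = set0 by rewrite closure0; exact: sub0set.
    by apply/seteqP; split=> // P bP; case: no; exists P.
  have [E [E' [hE _ _]]] := bQ0; have [a [le _ aE]] := dense M rM.
  exists a; first exact: le.
  apply: closed_subset_closure => Q bQ; have rQ := bundle_rank bQ.
  have [E1 [E2 [hE1 hE2 same]]] := bQ.
  (* Density gives Q its own index b. Rank and number of odd points are the same for Q and M, so a =
     b. *)
  have [|b [leb cl bE]] := dense Q; first by rewrite rQ.
  have e := bE _ hE2; rewrite rQ -(aE _ hE1) (same_odd_points same) in e.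
  have -> : a = b by move/eqP: e; clear; rewrite eqn_add2l eqn_pmul2l // => /eqP.
  exact: cl.
- move=> a a' la la' ne; apply/seteqP; split; last exact: sub0set.
  move=> Q [cQ bQ]; apply: ne.
  exact: (closure_bundle_generic (le2 _ la) (le2 _ la') (hK _ la) (hK _ la') cQ bQ).
split; first exact: closed_rank_le.
apply/seteqP; split=> [M rM|M [a /= la]].
  by have [a [le cl _]] := dense M rM; exists a.
move=> cl; apply: (@closed_rank_le R d n r); apply: closureS cl => P bP /=.
by rewrite (bundle_rank bP); have [_ -> _] := hK _ la.
Qed.
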